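(* The Banach space $X$ (defined in the context) is hereditarily indecomposable, and hence it does not contain any unconditional basic sequence.
   Context: Notation. For finite sets $E,F\subset\mathbb{N}$ and $n\in\mathbb{N}$: $E<F$ means $\max E<\min F$; $n\le E$ means $n\le\min E$; $E<n$ means $\max E<n$; $E\le n$ means $\max E\le n$. $c_{00}$ is the space of finitely supported real sequences, with unit vectors $e_n$; $\mathrm{supp}\,x$ is the support of $x$; for $E\subset\mathbb{N}$, $Ex$ is the restriction of $x$ to $E$ (zero off $E$). For $f,x\in c_{00}$, $f(x)=\sum_nf(n)x(n)$, and $f<g$ means $\mathrm{supp}\,f<\mathrm{supp}\,g$. Families. $\mathcal{S}=\{F\subset\mathbb{N}: F \text{ finite}, \#F\le\min F\}$. For families $\mathcal{M},\mathcal{N}$ of finite subsets of $\mathbb{N}$, $\mathcal{M}[\mathcal{N}]$ is the family of all $F=\bigcup_{i=1}^sF_i$ with $F_i\in\mathcal{N}$ and $m_1\le F_1<m_2\le F_2<\dots<m_s\le F_s$ for some $\{m_1,\dots,m_s\}\in\mathcal{M}$. $\mathcal{F}_0=\{\{n\}:n\in\mathbb{N}\}$, $\mathcal{F}_{n+1}=\mathcal{S}[\mathcal{F}_n]$. A finite sequence $E_1,\dots,E_n$ of finite sets is $\mathcal{M}$-admissible if there is $\{k_1,\dots,k_n\}\in\mathcal{M}$ with $k_1\le E_1<k_2\le E_2<\dots<k_n\le E_n$. $|\cdot|_n$ denotes the norm on $c_{00}$ given implicitly by $|x|_n=\max\{\|x\|_\infty,\frac12\sup\sum_{i}|E_ix|_n\}$,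 sup over all $\mathcal{F}_n$-admissible sequences $(E_i)$. Choice of $(m_j)$ and $(\mathcal{M}_j)$. Fix integers $m_0=2$, $m_j>m_{j-1}^{m_{j-1}}$ for $j\ge1$. Put $\mathcal{M}_0=\mathcal{F}_1$. Inductively, given $\mathcal{M}_0,\dots,\mathcal{M}_n$, increasing and with integers $k_j$ such that $\mathcal{M}_j\subset\mathcal{F}_{k_j}$ for $j\le n$ (and $\mathcal{F}_{k_j}\subset\mathcal{M}_{j+1}$ for $j<n$), choose $s_{n+1}>k_n$ such that for every infinite $D\subset\mathbb{N}$ there is a convex combination $x=\sum_{i=1}^sa_ie_{r_i}$ ($r_1<\dots<r_s$) with $\mathrm{supp}\,x\subset D$, $\mathrm{supp}\,x\in\mathcal{F}_{s_{n+1}}$, $(a_i)$ decreasing and $|x|_{k_n}<\frac{1}{m_{n+2}^4}$; choose $l_{n+1}$ with $\frac{1}{2^{l_{n+1}}}<\frac{1}{2m_{n+1}}$; set $\mathcal{M}_{n+1}=\mathcal{F}_{s_{n+1}}[\cdots[\mathcal{F}_{s_{n+1}}]\cdots]$ ($l_{n+1}$ times). This keeps $\mathcal{M}_j\subset\mathcal{F}_{k_j}\subset\mathcal{M}_{j+1}$ for suitable $k_j$. The sets $K_j$. $K^0_j=\{\pm e_n:n\in\mathbb{N}\}$; $K^n=\bigcup_{i\ge0}K^n_i$; $K^{n+1}_j=K^n_j\cup\{\frac{1}{m_j}(f_1+\dots+f_d): d\in\mathbb{N},\ f_1,\dots,f_d\in K^n,\ (\mathrm{supp}\,f_1<\dots<\mathrm{supp}\,f_d)\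 \mathcal{M}_j\text{-admissible}\}$; $K_j=\bigcup_nK^n_j$. The space $X$. Let $G=\{(x_1^*,\dots,x_k^* ): k\in\mathbb{N},\ x_i^*\in\bigcup_jK_j,\ x_1^*<\dots<x_k^*\}$ (a countable set). Fix a one-to-one function $\Phi:G\to\{2j:j\ge0\}$ such that $\Phi(x_1^*,\dots,x_k^* )>j$ whenever, for some $1\le i\le k$, $x_i^*\in K_j$ and $x_i^*\notin\{\pm e_n\}$. Define $L^0_j=\{\pm e_n:n\in\mathbb{N}\}$ for $j\ge0$ and, inductively for $n\ge 0$ and $j\ge 0$: $L^{n+1}_{2j}=\pm L^n_{2j}\cup\{\frac{1}{m_{2j}}(x_1^*+\dots+x_d^* ): x_i^*\in\bigcup_{i'}L^n_{i'},\ (\mathrm{supp}\,x_1^*,\dots,\mathrm{supp}\,x_d^* )\ \mathcal{M}_{2j}\text{-admissible}\}$; $L'^{\,n+1}_{2j+1}=\pm L^n_{2j+1}\cup\{\frac{1}{m_{2j+1}}(x_1^*+\dots+x_d^* ): x_1^*\in L^n_{2k}\text{ for some }k>2j+1,\ x_i^*\in L^n_{\Phi(x_1^*,\dots,x_{i-1}^* )}\text{ for }1<i\le d,\ (\mathrm{supp}\,x_1^*,\dots,\mathrm{supp}\,x_d^* )\ \mathcal{M}_{2j+1}\text{-admissible}\}$; $L^{n+1}_{2j+1}=\{E_sx^*: x^*\in L'^{\,n+1}_{2j+1},\ s\in\mathbb{N}\}$, where $E_s=\{s,s+1,\dots\}$. Put $L_j=\bigcup_nL^n_j$, $L=\bigcup_jL_j$.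 $X$ is the completion of $c_{00}$ under $\|x\|=\sup\{f(x):f\in L\}$. A Banach space is hereditarily indecomposable if it is infinite-dimensional and no closed subspace of it is the topological direct sum of two infinite-dimensional closed subspaces. *)

(* Defs.v *)
From HB Require Import structures.
From mathcomp Require Import all_boot all_order all_algebra.
From mathcomp Require Import all_classical all_reals all_analysis.
Import Order.TTheory GRing.Theory Num.Theory.
Import numFieldNormedType.Exports.

Set Implicit Arguments.
Unset Strict Implicit.
Unset Printing Implicit Defensive.

Local Open Scope classical_set_scope.
Local Open Scope card_scope.
Local Open Scope ring_scope.

(* The index set N = {1, 2, ...} of the coordinates. *)
Definition Npos : set nat := [set n | (0 < n)%N].

Definition nat_family := set (set nat).

(* k_1 <= E_1 < k_2 <= E_2 < ... < k_n <= E_n, the k_i being listed in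
   increasing order.  Empty E_i impose no constraint of their own. *)
Definition interlaced (k : seq nat) (E : seq (set nat)) : Prop :=
  [/\ size k = size E, sorted ltn k &
      forall i p, (i < size E)%N -> nth set0 E i p ->
        (nth 0%N k i <= p)%N /\ ((i.+1 < size E)%N -> (p < nth 0%N k i.+1)%N)].

Definition admissible (M : nat_family) (E : seq (set nat)) : Prop :=
  (forall i, (i < size E)%N -> finite_set (nth set0 E i)) /\
  exists k, M [set` k] /\ interlaced k E.

(* M[N] *)
Definition bracket (M N : nat_family) : nat_family :=
  [set F | exists (ms : seq nat) (Fs : seq (set nat)),
     [/\ M [set` ms], interlaced ms Fs,
         forall i, (i < size Fs)%N -> N (nth set0 Fs i) &
         F = \bigcup_(i in `I_(size Fs)) nth set0 Fs i]].

(* #F <= min F, with the convention that the empty set qualifies. *)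
Definition schreier : nat_family :=
  [set F | finite_set F /\ forall n, F n -> F #<= `I_n].

Fixpoint Ffam (n : nat) : nat_family :=
  if n is n'.+1 then bracket schreier (Ffam n')
  else [set [set p] | p in Npos].

(* M_0 = F_1 and, for j > 0, M_j = F_{s_j}[...[F_{s_j}]...] with l_j
   occurrences of F_{s_j}; the values s 0 and l 0 are irrelevant. *)
Definition Mfam (s l : nat -> nat) (j : nat) : nat_family :=
  if j is 0 then Ffam 1
  else iter (l j).-1 (bracket (Ffam (s j))) (Ffam (s j)).

Section c00.
Variable R : realType.
Implicit Types (x y f g : nat -> R) (E : set nat) (j n : nat).

Definition supp x : set nat := [set n | x n != 0].

(* Sequences indexed by Npos are functions on nat vanishing at 0. *)
Definition c00 : set (nat -> R) :=
  [set x | finite_set (supp x) /\ supp x `<=` Npos].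

Definition unitv n : nat -> R := fun p => (p == n)%:R.

Definition restr E x : nat -> R := fun n => if n \in E then x n else 0.

Definition pairing f x : R := \sum_(n \in [set: nat]) f n * x n.

Definition supnorm x : R := sup [set `|x n| | n in [set: nat]].

Definition is_norm_c00 (N : (nat -> R) -> R) : Prop :=
  [/\ forall x, c00 x -> 0 <= N x,
      forall x, c00 x -> N x = 0 -> x = (fun=> 0),
      forall a x, c00 x -> N (fun n => a * x n) = `|a| * N x &
      forall x y, c00 x -> c00 y -> N (fun n => x n + y n) <= N x + N y].

(* N is the norm |.|_n; the conditions determine N on c00. *)
Definition is_implicit_norm n (N : (nat -> R) -> R) : Prop :=
  is_norm_c00 N /\
  forall x, c00 x ->
    N x = Num.max (supnorm x)
      (2^-1 * sup [set \sum_(E <- Es) N (restr E x)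
                  | Es in admissible (Ffam n)]).

Definition valid_choice (tnorm : nat -> (nat -> R) -> R)
    (m k s l : nat -> nat) : Prop :=
  [/\ m 0%N = 2%N /\ (forall j, (m j ^ m j < m j.+1)%N),
      forall j, Mfam s l j `<=` Ffam (k j) /\ Ffam (k j) `<=` Mfam s l j.+1,
      forall n, (k n < s n.+1)%N,
      forall n (D : set nat), D `<=` Npos -> infinite_set D ->
        exists (a : seq R) (r : seq nat),
          let x := fun p => \sum_(i < size r) nth 0 a i * unitv (nth 0%N r i) p in
          [/\ size a = size r /\ sorted ltn r,
              (forall i, (i < size a)%N -> 0 <= nth 0 a i) /\
                \sum_(i < size a) nth 0 a i = 1,
              sorted (fun b c : R => c <= b) a,
              supp x `<=` D /\ Ffam (s n.+1) (supp x) &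
              tnorm (k n) x < ((m n.+2)%:R ^+ 4)^-1] &
      forall n, (2 ^+ l n.+1)^-1 < (2 * (m n.+1)%:R)^-1 :> R].

Section norming_sets.
Variables (m : nat -> nat) (M : nat -> nat_family).

Definition pm_units : set (nat -> R) :=
  [set f | exists2 n, Npos n & f = unitv n \/ f = (fun p => - unitv n p)].

Definition pm (A : set (nat -> R)) : set (nat -> R) :=
  A `|` [set (fun p => - f p) | f in A].

(* All (f_1 + ... + f_d) / m_j with d >= 1, (f_1, ..., f_d) satisfying P
   and supp f_1, ..., supp f_d an M_j-admissible sequence. *)
Definition averages j (P : seq (nat -> R) -> Prop) : set (nat -> R) :=
  [set (fun n => (m j)%:R^-1 * \sum_(f <- fs) f n)
  | fs in [set fs | [/\ (0 < size fs)%N, P fs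
                     & admissible (M j) [seq supp f | f <- fs]]]].

Fixpoint Kn n j : set (nat -> R) :=
  if n is n'.+1 then
    Kn n' j `|` averages j (fun fs =>
      forall t, (t < size fs)%N -> exists i, Kn n' i (nth (fun=> 0) fs t))
  else pm_units.

Definition K j : set (nat -> R) := \bigcup_n Kn n j.

Definition G : set (seq (nat -> R)) :=
  [set fs | [/\ (0 < size fs)%N,
      forall t, (t < size fs)%N -> exists j, K j (nth (fun=> 0) fs t) &
      forall t u p q, (t < u < size fs)%N ->
        supp (nth (fun=> 0) fs t) p -> supp (nth (fun=> 0) fs u) q ->
        (p < q)%N]].

(* Phi is only meaningful on G. *)
Definition is_coding (Phi : seq (nat -> R) -> nat) : Prop :=
  [/\ set_inj G Phi,
      forall fs, G fs -> ~~ odd (Phi fs) &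
      forall fs j t, G fs -> (t < size fs)%N ->
        K j (nth (fun=> 0) fs t) -> ~ pm_units (nth (fun=> 0) fs t) ->
        (j < Phi fs)%N].

Variable Phi : seq (nat -> R) -> nat.

Fixpoint Ln n i : set (nat -> R) :=
  if n is n'.+1 then
    if odd i then
      [set restr [set p | (t <= p)%N] x | t in Npos & x in
         pm (Ln n' i) `|` averages i (fun fs =>
           (exists2 k, (i < k)%N & Ln n' k.*2 (nth (fun=> 0) fs 0)) /\
           forall t, (0 < t < size fs)%N ->
             G (take t fs) /\ Ln n' (Phi (take t fs)) (nth (fun=> 0) fs t))]
    else
      pm (Ln n' i) `|` averages i (fun fs =>
        forall t, (t < size fs)%N -> exists i', Ln n' i' (nth (fun=> 0) fs t))
  else pm_units.

Definition L : set (nat -> R) := \bigcup_i \bigcup_n Ln n i.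

Definition normL x : R := sup [set pairing f x | f in L].

End norming_sets.
End c00.

Section banach.
Variables (R : realType) (X : completeNormedModType R).
Implicit Types (Y Z W : set X) (u : nat -> X).

(* (X, iota) is the completion of c00 under the norm N. *)
Definition is_completion (N : (nat -> R) -> R) (iota : (nat -> R) -> X) : Prop :=
  [/\ forall a x y, c00 x -> c00 y ->
        iota (fun n => a * x n + y n) = a *: iota x + iota y,
      forall x, c00 x -> `|iota x| = N x &
      dense (iota @` (@c00 R))].

Definition subspace_of_X Y : Prop :=
  Y 0 /\ forall (a : R) x y, Y x -> Y y -> Y (a *: x + y).

Definition finite_dim Y : Prop :=
  exists (n : nat) (v : 'I_n -> X),
    Y = [set \sum_(i < n) a i *: v i | a in [set: 'I_n -> R]].

(* The projection onto Y along W being continuous on Z (hence also the one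
   onto W) says that Y x W -> Z, (y, w) |-> y + w, is a homeomorphism. *)
Definition topological_direct_sum Z Y W : Prop :=
  [/\ Z = [set y + w | y in Y & w in W],
      Y `&` W = [set 0] &
      exists P : X -> X, {within Z, continuous P} /\
        forall y w, Y y -> W w -> P (y + w) = y].

Definition hereditarily_indecomposable : Prop :=
  ~ finite_dim [set: X] /\
  ~ exists Z Y W,
      [/\ closed Z /\ subspace_of_X Z,
          [/\ closed Y, subspace_of_X Y & ~ finite_dim Y],
          [/\ closed W, subspace_of_X W & ~ finite_dim W] &
          topological_direct_sum Z Y W].

Definition closed_span u : set X :=
  closure [set x | exists n (a : nat -> R), x = \sum_(i < n) a i *: u i].

(* Schauder basis of its closed linear span *)
Definition basic_sequence u : Prop :=
  forall x, closed_span u x ->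
    exists! a : nat -> R, series (fun n => a n *: u n) @ \oo --> x.

(* All expansions converge unconditionally, i.e. after any rearrangement. *)
Definition unconditional_basic_sequence u : Prop :=
  basic_sequence u /\
  forall a : nat -> R, cvgn (series (fun n => a n *: u n)) ->
    forall p : nat -> nat, bijective p ->
      cvgn (series (fun n => a (p n) *: u (p n))).

End banach.

(* Main.v *)
(** For infinite-dimensional subspaces Y and W there are y in Y and w in W with
    |y - w| much smaller than |y + w|.  This contradicts the boundedness of the
    projection of Y + W onto Y, hence excludes topological direct sums; applied to
    the spans of the terms of even and of odd rank of a sequence, it also excludes
    unconditional basic sequences.

    To evaluate a functional f of L on a combination sum_r beta_r x_r of blocks, go
    down the tree of averages defining f.  A node of large weight is small on each
    block.  A node of weight m_i with i <= n cuts a few blocks and splits the others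
    into pieces that are admissible for |.|_(k_n), so that the value of f is controlled
    by |beta|_(k_n), which is tiny for the special combinations provided by the choice
    of s_(n+1).  With James' argument this yields, in every infinite-dimensional
    subspace, vectors y and functionals y* of a prescribed weight such that y*(y) = 1
    while functionals of other weights are small on y.

    Choosing such pairs alternately near Y and near W, with weights prescribed by the
    coding Phi, makes (y*_1 + ... + y*_d) / m_(n+1) a special functional, which takes
    the value 1 / m_(n+1) on sum_r beta_r y_r.  On the alternating sum, a special
    functional follows the sequence (y*_r) up to a first mismatch, where consecutive
    terms cancel; afterwards its weights differ from those of the y_r because Phi is
    injective.  Hence the alternating sum is much smaller.

    The support of beta has to be known before the pairs are chosen, whereas the pairs
    have to be compatible with it: so the pairs are defined for all histories, that is
    finite sets of starting points, and the support is chosen sparse with respect to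
    all of them. *)

Require Import Defs.
From mathcomp Require Import all_boot all_order all_algebra.
From mathcomp Require Import all_classical all_reals all_analysis.
From mathcomp Require Import ring lra zify.
Import Order.TTheory GRing.Theory Num.Theory.
Import numFieldNormedType.Exports.

Set Implicit Arguments.
Unset Strict Implicit.
Unset Printing Implicit Defensive.

Local Open Scope classical_set_scope.
Local Open Scope card_scope.
Local Open Scope ring_scope.

(** * Admissible families *)

(** The estimate going down the tree has to reproduce itself. For a set [A] of blocks that is an
    interval of the support, it bounds the value of f on the part over [A] by C times (the
    |.|_(k_n)-norm of beta restricted to [A], plus theta times the sum of beta over [A]). Over the
    pieces of an admissible splitting the first term grows by a factor 2 at most, by the implicit
    equation of the norm, and the second is additive. Blocks cut by a marker escape the induction:
    at most one per gap and one before the first marker, at a cost of 3 norms. A weight 1/m_i with i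
    > 0 absorbs 2 + 3 = 5, but the weight 1/2 of M_0 leaves no room; there pieces and cut blocks
    have to form one admissible sequence.

    Theta is set by the first weight that is bounded directly: 1/m_(n+1) for exact pairs, 1/m_(n+2)
    for alternating sums, where index n+1 is handled by cancellation. Parity matters: for odd n all
    admissible averages of index n+1 are allowed, for even n they must be coded. At the end
    1/m_(n+1) meets 512/m_(n+2), and m_(n+2) is at least the cube of m_(n+1). *)

Lemma sorted_nth_ltn (s : seq nat) i j : sorted ltn s -> (i < j < size s)%N ->
  (nth 0%N s i < nth 0%N s j)%N.
Proof.
move=> ss /andP[ij js]; apply: (sorted_ltn_nth ltn_trans 0%N ss) => //.
by rewrite inE (ltn_trans ij).
Qed.

Lemma nat_nthP (s : seq nat) q : q \in s ->
  exists j, (j < size s)%N /\ q = nth 0%N s j.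
Proof. by move=> /(nthP 0%N)[j js <-]; exists j. Qed.

Lemma interlacedP k E : interlaced k E ->
  [/\ size k = size E, sorted ltn k,
    forall i p, (i < size E)%N -> nth set0 E i p -> (nth 0%N k i <= p)%N &
    forall i j p, (i < j < size E)%N -> nth set0 E i p ->
      (p < nth 0%N k j)%N].
Proof.
case=> szE sk H; split=> // [i p iE /(H i p iE)[]//|i j p /andP[ij jE] Ei].
have [_ /(_ (leq_ltn_trans ij jE)) pi] := H i p (ltn_trans ij jE) Ei.
apply: (leq_trans pi); rewrite leq_eqVlt.
have [->|ne] := eqVneq i.+1 j; first by rewrite eqxx.
by rewrite sorted_nth_ltn ?orbT// szE jE andbT ltn_neqAle ne.
Qed.

Lemma interlaced_intro k E : size k = size E -> sorted ltn k ->
  (forall i p, (i < size E)%N -> nth set0 E i p -> (nth 0%N k i <= p)%N) ->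
  (forall i j p, (i < j < size E)%N -> nth set0 E i p ->
     (p < nth 0%N k j)%N) -> interlaced k E.
Proof.
move=> sz sk H1 H2; split=> // i p iE Ei; split; first exact: H1.
by move=> jE; apply: (H2 i) => //; rewrite ltnSn.
Qed.

Lemma interlaced_sub k E idx E' : interlaced k E ->
  sorted ltn idx -> (forall i, i \in idx -> (i < size E)%N) ->
  (forall i, i \in idx -> E' i `<=` nth set0 E i) ->
  interlaced (map (nth 0%N k) idx) (map E' idx).
Proof.
move=> /interlacedP[sz sk H1 H2] sidx idxE EE.
apply: interlaced_intro; rewrite ?size_map//.
- apply: (homo_sorted_in _ _ sidx (P := mem idx)); last by apply/allP.
  by move=> x y _ yi /= xy; apply: sorted_nth_ltn => //; apply/andP; rewrite sz idxE.
- move=> i p iE; rewrite !(nth_map 0%N)// => /EE; rewrite mem_nth// => /(_ isT).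
  by apply: H1; rewrite idxE// mem_nth.
- move=> i j p /andP[ij jE]; have iE := ltn_trans ij jE.
  rewrite !(nth_map 0%N)// => /EE; rewrite mem_nth// => /(_ isT).
  apply: H2; rewrite idxE ?mem_nth// andbT.
  by rewrite sorted_nth_ltn// ij.
Qed.

Lemma interlaced_subsets k E E' : interlaced k E -> size E' = size E ->
  (forall i, nth set0 E' i `<=` nth set0 E i) -> interlaced k E'.
Proof.
move=> [sz sk H] szE EE; split; rewrite ?szE// => i p iE /EE; exact: H.
Qed.

(* [ilc lo k E hi] is [interlaced k E] inside the interval [lo, hi); unlike
   [interlaced] it is stable under concatenation. *)
Fixpoint ilc (lo : nat) (k : seq nat) (E : seq (set nat)) (hi : nat) : Prop :=
  match k, E with
  | [::], [::] => (lo <= hi)%N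
  | a :: k', F :: E' => (lo <= a)%N /\ exists mid, [/\ (a < mid)%N,
      (forall p, F p -> (a <= p < mid)%N) & ilc mid k' E' hi]
  | _, _ => False
  end.

Lemma ilc_le lo k E hi : ilc lo k E hi -> (lo <= hi)%N.
Proof.
elim: k E lo => [|a k IH] [|F E] lo //= [la [mid [am _ /IH]]].
by apply: leq_trans; exact: leq_trans (ltnW am).
Qed.

Lemma ilcW lo lo' k E hi : (lo' <= lo)%N -> ilc lo k E hi -> ilc lo' k E hi.
Proof.
case: k E => [|a k] [|F E] //= ll; first exact: leq_trans.
by case=> la ex; split=> //; exact: leq_trans ll la.
Qed.

Lemma ilc_cat lo k1 E1 mid k2 E2 hi : ilc lo k1 E1 mid -> ilc mid k2 E2 hi ->
  ilc lo (k1 ++ k2) (E1 ++ E2) hi.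
Proof.
elim: k1 E1 lo => [|a k IH] [|F E] lo //=; first exact: ilcW.
move=> [la [md [am H1 H2]]] H3; split=> //; exists md; split=> //; exact: IH.
Qed.

Lemma ilc_mem lo k E hi : ilc lo k E hi ->
  (forall a, a \in k -> (lo <= a < hi)%N) /\
  (forall i p, nth set0 E i p -> (lo <= p < hi)%N).
Proof.
elim: k E lo => [|a k IH] [|F E] lo //=; first by split=> // i p; rewrite nth_nil.
move=> [la [mid [am HF H]]]; have [I1 I2] := IH _ _ H.
have lm : (lo <= mid)%N by apply: leq_trans la (ltnW am).
have mh := ilc_le H.
split=> [b|[|i] p /=].
- rewrite inE => /orP[/eqP->|/I1 /andP[h1 h2]].
    by rewrite la (leq_trans am mh).
  by rewrite (leq_trans lm h1).
- by move=> /HF /andP[h1 h2]; rewrite (leq_trans la h1) (leq_trans h2 mh).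
- by move=> /I2 /andP[h1 h2]; rewrite (leq_trans lm h1).
Qed.

Lemma ilc_interlaced lo k E hi : ilc lo k E hi -> interlaced k E.
Proof.
elim: k E lo => [|a k IH] [|F E] lo //=.
move=> [la [mid [am HF H]]]; have [sz sk I] := IH _ _ H.
have [M1 M2] := ilc_mem H.
split=> /=; first by rewrite sz.
- rewrite path_sortedE; last exact: ltn_trans.
  by rewrite sk andbT; apply/allP => b /M1 /andP[h _]; exact: leq_trans am h.
- move=> [|i] p iE /= Fp; last by rewrite ltnS; apply: I.
  have /andP[h1 h2] := HF p Fp; split=> // kE; apply: (leq_trans h2).
  have k0 : nth 0%N k 0 \in k by apply: mem_nth; rewrite sz.
  by have /andP[] := M1 _ k0.
Qed.

Definition singleton_one (M : nat_family) := M [set 1%N].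
(** Restricted to nonempty subsets, because [Ffam 0] consists of the singletons. *)
Definition hereditary (M : nat_family) :=
  forall A B, M A -> B `<=` A -> B !=set0 -> M B.
Definition positive_family (M : nat_family) := forall A, M A -> A `<=` Npos.

Lemma setof_seq1 (a : nat) : [set` [:: a]] = [set a].
Proof. by apply/seteqP; split=> p /=; rewrite inE => /eqP. Qed.

Lemma setof_seq0 : [set` [::]] = set0 :> set nat.
Proof. by apply/seteqP; split. Qed.

(** A single piece with marker 1 suffices, as 1 is the least positive integer. *)
Lemma bracket_sub M N : singleton_one M -> positive_family N -> N `<=` bracket M N.
Proof.
move=> M1 N1 F NF; exists [:: 1%N], [:: F]; split.
- by rewrite setof_seq1.
- by split=> // -[|i]// p _ /= /(N1 _ NF); split.
- by case.
- by apply/seteqP; split=> [p Fp|p [[|i]//]]; exists 0%N.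
Qed.

Lemma bracket_positive M N : positive_family N -> positive_family (bracket M N).
Proof. by move=> N1 A [ms [Fs [_ _ NF ->]]] p [i /= iF]; apply: N1; exact: NF. Qed.

Lemma bracket_one M N : singleton_one M -> singleton_one N ->
  positive_family N -> singleton_one (bracket M N).
Proof. by move=> M1 N1 N2; apply: bracket_sub. Qed.

(** Only the pieces that meet [B] are kept, with their markers, since the empty set need not belong
    to [N]. *)
Lemma bracket_hereditary M N : hereditary M -> hereditary N ->
  hereditary (bracket M N).
Proof.
move=> hM hN A B [ms [Fs [Mms il NFs ->]]] BA B0.
pose idx := [seq i <- iota 0 (size Fs) | `[< (nth set0 Fs i `&` B) !=set0 >]].
have idxP i : i \in idx <-> (i < size Fs)%N /\ (nth set0 Fs i `&` B) !=set0.
  rewrite mem_filter mem_iota /= add0n.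
  by split=> [/andP[/asboolP]|[? /asboolP ->]].
have [sz _ _] := il.
exists (map (nth 0%N ms) idx), (map (fun i => nth set0 Fs i `&` B) idx); split.
- apply: hM Mms _ _.
    move=> p /= /mapP[i /idxP[iF _] ->]; by apply: mem_nth; rewrite sz.
  case: B0 => b Bb; have [i /= iF Fb] := BA b Bb.
  exists (nth 0%N ms i) => /=; apply: map_f; apply/idxP; split=> //.
  by exists b.
- apply: (interlaced_sub il).
  + by apply: sorted_filter; [exact: ltn_trans|exact: iota_ltn_sorted].
  + by move=> i /idxP[].
  + by move=> i _ p [].
- move=> i; rewrite size_map => ii; rewrite (nth_map 0%N)//.
  have /idxP[iF ne] := mem_nth 0%N ii.
  by apply: (hN _ _ (NFs _ iF)) ne => p [].
- apply/seteqP; split=> [p Bp|p [i /=]].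
    have [i /= iF Fp] := BA p Bp.
    have ii : i \in idx by apply/idxP; split=> //; exists p.
    exists (index i idx) => /=; first by rewrite size_map index_mem.
    by rewrite (nth_map 0%N) ?index_mem// nth_index.
  by rewrite size_map => ii; rewrite (nth_map 0%N)// => -[].
Qed.

Lemma card_le_seq (s : seq nat) n : uniq s -> ([set` s] #<= `I_n) = (size s <= n)%N.
Proof.
move=> us; have cs : [set` s] #= `I_(size s).
  elim: s us => [|x s IH] /=; first by rewrite setof_seq0 -II0.
  move=> /andP[xs us]; apply/eq_cardSP; exists x; first by rewrite /= inE eqxx.
  suff -> : [set` x :: s] `\ x = [set` s] by exact: IH.
  apply/seteqP; split=> p /=; rewrite inE; first by case=> /orP[/eqP ->|].
  by move=> ps; split; [rewrite ps orbT|move=> px; move: xs; rewrite -px ps].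
by rewrite (card_le_eql cs) card_le_II.
Qed.

Lemma schreier_seq (s : seq nat) : uniq s ->
  (forall r, r \in s -> (size s <= r)%N) -> schreier [set` s].
Proof.
by move=> us H; split; [exact: finite_seq|move=> n /= ns; rewrite card_le_seq// H].
Qed.

Lemma schreier_seq_size (s : seq nat) r : uniq s -> schreier [set` s] ->
  r \in s -> (size s <= r)%N.
Proof. by move=> us [_ H] /H; rewrite card_le_seq. Qed.

Lemma schreier_one : singleton_one schreier.
Proof.
rewrite /singleton_one -setof_seq1; apply: schreier_seq => // r.
by rewrite inE => /eqP ->.
Qed.

Lemma schreier_hereditary : hereditary schreier.
Proof.
move=> A B [fA HA] BA _; split; first exact: sub_finite_set BA fA.
by move=> n /BA /HA; apply: card_le_trans; apply: subset_card_le.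
Qed.

Lemma Ffam_positive n : positive_family (Ffam n).
Proof.
elim: n => [A [p p0 <-] q -> //|n IH] /=; exact: bracket_positive.
Qed.

Lemma Ffam_one n : singleton_one (Ffam n).
Proof.
elim: n => [|n IH] /=; first by exists 1%N.
by apply: bracket_one => //; [exact: schreier_one|exact: Ffam_positive].
Qed.

Lemma Ffam_hereditary n : hereditary (Ffam n).
Proof.
elim: n => [A B [p p0 <-] BA [b Bb]|n IH].
  exists p => //; apply/seteqP; split=> // q ->.
  by rewrite -(BA _ Bb).
by apply: bracket_hereditary => //; exact: schreier_hereditary.
Qed.

Lemma Ffam_le a b : (a <= b)%N -> Ffam a `<=` Ffam b.
Proof.
move=> /subnK <-; elim: (b - a)%N => // n IH A /IH; rewrite addSn /=.
by apply: bracket_sub; [exact: schreier_one|exact: Ffam_positive].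
Qed.

Lemma Ffam_set0 n : Ffam n.+1 set0.
Proof.
exists [::], [::]; split=> //.
by rewrite predeqE => p; split=> [|[]].
Qed.

Lemma interlaced_heads (ls : seq (seq nat)) :
  (forall t, t \in ls -> t <> [::]) -> sorted ltn (flatten ls) ->
  interlaced (map (head 0%N) ls) (map (fun t => [set` t]) ls).
Proof.
move=> H s1.
have [hi il] : exists hi,
    ilc 0 (map (head 0%N) ls) (map (fun t => [set` t]) ls) hi.
  suff gen lo : (forall r, r \in flatten ls -> (lo <= r)%N) ->
      exists hi, ilc lo (map (head 0%N) ls) (map (fun t => [set` t]) ls) hi.
    exact: gen.
  elim: ls lo H s1 => [|t ls IH] lo H s1 lor; first by exists lo => /=.
  case: t H s1 lor => [|a t] H; first by have := H [::]; rewrite ?inE ?eqxx => /(_ isT).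
  rewrite -[flatten _]/((a :: t) ++ flatten ls) (sorted_pairwise ltn_trans).
  rewrite pairwise_cat.
  move=> /and3P[/allrelP ar pt pls] lor.
  pose mid := (\max_(p <- a :: t) p).+1.
  have midP p : p \in a :: t -> (p < mid)%N.
    by move=> pt'; rewrite ltnS (leq_bigmax_seq _ pt').
  have [||r rls|hi I] := IH mid.
  - by move=> u uls; apply: H; rewrite inE uls orbT.
  - by rewrite (sorted_pairwise ltn_trans).
  - have ar' x : x \in a :: t -> (x < r)%N by move=> xt; exact: ar _ _ xt rls.
    have r0 : (0 < r)%N by apply: leq_ltn_trans (ar' a (mem_head _ _)).
    rewrite -(prednK r0) ltnS; apply/bigmax_leqP_seq => x /ar' + _; lia.
  exists hi; split; first by apply: lor; rewrite inE eqxx.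
  exists mid; split=> //; first by apply: midP; rewrite inE eqxx.
  move=> p /= pt'; rewrite midP// andbT; move: pt'; rewrite inE.
  by move: pt => /= /andP[/allP h _] /orP[/eqP ->//|/h /ltnW].
exact: ilc_interlaced il.
Qed.

(** The first elements of the lists serve as markers; the bound on [size ls] makes them a Schreier
    set. *)
Lemma Ffam_flatten n (ls : seq (seq nat)) :
  (forall t, t \in ls -> t <> [::] /\ Ffam n [set` t]) ->
  sorted ltn (flatten ls) ->
  (forall r, r \in flatten ls -> (size ls <= r)%N) ->
  Ffam n.+1 [set` flatten ls].
Proof.
move=> H s1 s2; exists (map (head 0%N) ls), (map (fun t => [set` t]) ls).
have il := interlaced_heads (fun t tls => (H t tls).1) s1.
split.
- apply: schreier_seq.
  + have := il; case=> _ + _.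
    by apply: sorted_uniq; [exact: ltn_trans|exact: ltnn].
  + move=> r /mapP[t tls ->]; rewrite size_map; apply: s2.
    apply/flattenP; exists t => //; have [] := H t tls.
    by case: t {tls} => //= a t _ _; rewrite inE eqxx.
- exact: il.
- move=> i; rewrite size_map => ii; rewrite (nth_map [::])//.
  by have [] := H _ (mem_nth [::] ii).
- apply/seteqP; split=> [p /= /flattenP[t tls pt]|p [i /=]].
    exists (index t ls); first by rewrite /= size_map index_mem.
    by rewrite (nth_map [::]) ?index_mem// nth_index.
  rewrite size_map => ii; rewrite (nth_map [::])//= => pt.
  by apply/flattenP; exists (nth [::] ls i) => //; exact: mem_nth.
Qed.

Lemma Ffam1_seq (s : seq nat) : sorted ltn s ->
  (forall r, r \in s -> (size s <= r)%N) -> Ffam 1 [set` s].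
Proof.
move=> ss H; have := @Ffam_flatten 0 [seq [:: r] | r <- s].
have -> : flatten [seq [:: r] | r <- s] = s.
  by elim: s {ss H} => //= a s ->.
apply=> //; last by move=> r; rewrite size_map; exact: H.
move=> t /mapP[r rs ->]; split=> //; exists r; last by rewrite setof_seq1.
by apply: leq_trans (H r rs); case: (s) rs.
Qed.

(** The pieces are singletons, so [size s] is at most the number of markers; by the Schreier
    condition that number is at most the marker below [r]. *)
Lemma Ffam1_seq_size (s : seq nat) r : sorted ltn s -> Ffam 1 [set` s] ->
  r \in s -> (size s <= r)%N.
Proof.
move=> ss [ms [Fs [Sms il NF sF]]] rs.
have us := sorted_uniq ltn_trans ltnn ss.
have [szE sms mle _] := interlacedP il.
have : [set` s] r by [].
rewrite sF => -[i /= iF Fr].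
have iM : nth 0%N ms i \in ms by rewrite mem_nth// szE.
apply: leq_trans (mle i r iF Fr).
apply: leq_trans (schreier_seq_size (sorted_uniq ltn_trans ltnn sms) Sms iM).
rewrite szE.
have /choice[q qP] : forall F : set nat, exists q, Ffam 0 F -> F = [set q].
  move=> F; have [[q _ <-]|nF] := pselect (Ffam 0 F); first by exists q.
  by exists 0%N.
rewrite -(size_map q Fs); apply: uniq_leq_size => // p ps.
have : [set` s] p by [].
rewrite sF => -[j /= jF]; rewrite (qP _ (NF j jF)) => ->.
by apply: map_f; exact: mem_nth.
Qed.

(** Three pieces need three markers, and a Schreier set with three elements starts at 3 or later.
    This is the origin of the bound [3 <= r] on the supports of special combinations. *)
Lemma Ffam2_cat3 (s0 s1 s2 : seq nat) : sorted ltn (s0 ++ s1 ++ s2) ->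
  Ffam 1 [set` s0] -> Ffam 1 [set` s1] -> Ffam 1 [set` s2] ->
  (forall r, r \in s0 ++ s1 ++ s2 -> (3 <= r)%N) ->
  Ffam 2 [set` s0 ++ s1 ++ s2].
Proof.
move=> ss F0 F1 F2 H.
pose ls := [seq t <- [:: s0; s1; s2] | t != [::]].
have E : flatten ls = s0 ++ s1 ++ s2.
  by rewrite /ls; case: (s0) (s1) (s2) => [|? ?] [|? ?] [|? ?]; rewrite /= ?cats0.
rewrite -E; apply: Ffam_flatten.
- move=> t; rewrite mem_filter => /andP[/eqP tn H0]; split=> //.
  by move: H0; rewrite !inE => /or3P[]/eqP->.
- by rewrite E.
- move=> r; rewrite E => /H; apply: leq_trans.
  by rewrite size_filter; exact: count_size.
Qed.

Lemma Mfam_one s l j : singleton_one (Mfam s l j).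
Proof.
case: j => [|j]; first exact: Ffam_one.
rewrite /Mfam; elim: (l _).-1 => [|n IH] /=; first exact: Ffam_one.
apply: bracket_one => //; first exact: Ffam_one.
by elim: n {IH} => [|n IH] /=; [exact: Ffam_positive|exact: bracket_positive].
Qed.

Lemma Mfam_hereditary s l j : hereditary (Mfam s l j).
Proof.
case: j => [|j]; first exact: Ffam_hereditary.
rewrite /Mfam; elim: (l _).-1 => [|n IH] /=; first exact: Ffam_hereditary.
by apply: bracket_hereditary => //; exact: Ffam_hereditary.
Qed.

Lemma iter_bracket_Mfam s l j n : (0 < j)%N -> (n < l j)%N ->
  iter n (bracket (Ffam (s j))) (Ffam (s j)) `<=` Mfam s l j.
Proof.
case: j => // j _ nl; rewrite /Mfam.
have : (n <= (l j.+1).-1)%N by case: (l _) nl.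
move=> /subnK <-; elim: (_ - _)%N => // d IH A /IH; rewrite addSn /=.
apply: bracket_sub; first exact: Ffam_one.
by elim: (d + n)%N => [|n' IH'] /=; [exact: Ffam_positive|exact: bracket_positive].
Qed.

(** * Finitely supported vectors and their pairing *)

Section Vectors.
Variable R : realType.
Implicit Types (f g x y : nat -> R).

Definition tail t f := restr [set p | (t <= p)%N] f.
Definition init q f := restr [set p | (p < q)%N] f.

Lemma restrE E f p : restr E f p = if `[< E p >] then f p else 0.
Proof. by rewrite /restr; congr (if _ then _ else _); rewrite in_setE. Qed.

Lemma restr_in E f p : E p -> restr E f p = f p.
Proof. by rewrite restrE => /asboolP ->. Qed.

Lemma tailE t f p : tail t f p = if (t <= p)%N then f p else 0.
Proof. by rewrite /tail restrE asboolb. Qed.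

Lemma initE t f p : init t f p = if (p < t)%N then f p else 0.
Proof. by rewrite /init restrE asboolb. Qed.

Lemma tail_tail t u f : tail t (tail u f) = tail (maxn t u) f.
Proof.
apply/funext => p; rewrite !tailE geq_max.
by case: (t <= p)%N; case: (u <= p)%N.
Qed.

Lemma tail0 f : tail 0 f = f.
Proof. by apply/funext => p; rewrite tailE. Qed.

Lemma tail_opp t f : tail t (fun p => - f p) = (fun p => - tail t f p).
Proof. by apply/funext => p; rewrite !tailE; case: ifP; rewrite ?oppr0. Qed.

Lemma init_opp t f : init t (fun p => - f p) = (fun p => - init t f p).
Proof. by apply/funext => p; rewrite !initE; case: ifP; rewrite ?oppr0. Qed.

Lemma init_tail t u f : init t (tail u f) = tail u (init t f).
Proof.
apply/funext => p; rewrite !(tailE, initE).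
by case: (p < t)%N; case: (u <= p)%N.
Qed.

Lemma supp_restr E f : supp (restr E f) `<=` supp f.
Proof. by move=> p; rewrite /supp /= restrE; case: ifP; rewrite // eqxx. Qed.

Lemma c00P x : c00 x <-> (exists N, forall p, (N <= p)%N -> x p = 0) /\ x 0%N = 0.
Proof.
split=> [[fx px]|[[N xN] x0]].
  split; last by apply/eqP/negP => /negP /px.
  have /finite_seqP[s sE] := fx; exists (\max_(p <- s) p).+1 => p pN.
  apply/eqP/negP => /negP xp; have : supp x p by [].
  by rewrite sE /= => ps; move: pN; rewrite ltnNge (leq_bigmax_seq _ ps).
split.
  apply: (sub_finite_set (B := `I_N)); last exact: finite_II.
  by move=> p /= /eqP xp; rewrite ltnNge; apply/negP => /xN.
by move=> [|p] //= /eqP.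
Qed.

Lemma c00_supp x : c00 x -> exists N, forall p, (N <= p)%N -> x p = 0.
Proof. by move=> /c00P[]. Qed.

Lemma c00_0 x : c00 x -> x 0%N = 0.
Proof. by move=> /c00P[]. Qed.

Lemma c00_sub x y : c00 x -> supp y `<=` supp x -> c00 y.
Proof.
by move=> [fx px] yx; split; [exact: sub_finite_set yx fx|move=> p /yx /px].
Qed.

Lemma c00_zero : c00 (fun=> 0 : R).
Proof. by apply/c00P; split=> //; exists 0%N. Qed.

Lemma c00_opp x : c00 x -> c00 (fun p => - x p).
Proof. by move=> /c00_sub; apply => p; rewrite /supp /= oppr_eq0. Qed.

Lemma c00_restr E x : c00 x -> c00 (restr E x).
Proof. by move=> /c00_sub; apply; exact: supp_restr. Qed.

Lemma c00_scale a x : c00 x -> c00 (fun p => a * x p).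
Proof. by move=> /c00_sub; apply => p; rewrite /supp /= mulf_eq0 negb_or => /andP[]. Qed.

Lemma c00_lin a x y : c00 x -> c00 y -> c00 (fun p => a * x p + y p).
Proof.
move=> /c00P[[N1 H1] h1] /c00P[[N2 H2] h2]; apply/c00P; split; last first.
  by rewrite h1 h2 mulr0 addr0.
exists (maxn N1 N2) => p; rewrite geq_max => /andP[/H1 -> /H2 ->].
by rewrite mulr0 addr0.
Qed.

Lemma c00_add x y : c00 x -> c00 y -> c00 (fun p => x p + y p).
Proof.
move=> cx cy; have := c00_lin 1 cx cy; congr c00.
by apply/funext => p; rewrite mul1r.
Qed.

Lemma c00_sum (I : Type) (r : seq I) (P : pred I) (c : I -> R) (x : I -> nat -> R) :
  (forall i, P i -> c00 (x i)) -> c00 (fun p => \sum_(i <- r | P i) c i * x i p).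
Proof.
move=> cx; elim: r => [|i r IH].
  by have := c00_zero; congr c00; apply/funext => p; rewrite big_nil.
have [Pi|Pi] := boolP (P i); last first.
  by move: IH; congr c00; apply/funext => p; rewrite big_cons (negbTE Pi).
have := c00_lin (c i) (cx i Pi) IH; congr c00.
by apply/funext => p; rewrite big_cons Pi.
Qed.

Lemma c00_unitv n : (0 < n)%N -> c00 (unitv R n).
Proof.
move=> n0; apply/c00P; split; last by rewrite /unitv eq_sym; case: eqP n0 => // ->.
by exists n.+1 => p np; rewrite /unitv; case: eqP np => // ->; rewrite ltnn.
Qed.

Lemma pairingE f x N : (forall p, (N <= p)%N -> f p * x p = 0) ->
  pairing f x = \sum_(p < N) f p * x p.
Proof.
move=> H; rewrite /pairing -(@fsbig_widen _ _ _ _ `I_N)//; first by rewrite -fsbig_ord.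
by move=> p /= [_ /negP]; rewrite -leqNgt => /H.
Qed.

Lemma pairing_c00 f x N : (forall p, (N <= p)%N -> x p = 0) ->
  pairing f x = \sum_(p < N) f p * x p.
Proof. by move=> H; apply: pairingE => p /H ->; rewrite mulr0. Qed.

Lemma pairing_lin f a x y : c00 x -> c00 y ->
  pairing f (fun p => a * x p + y p) = a * pairing f x + pairing f y.
Proof.
move=> /c00_supp[N1 H1] /c00_supp[N2 H2].
have K1 p : (maxn N1 N2 <= p)%N -> x p = 0 by rewrite geq_max => /andP[/H1].
have K2 p : (maxn N1 N2 <= p)%N -> y p = 0 by rewrite geq_max => /andP[_ /H2].
rewrite (pairing_c00 _ K1) (pairing_c00 _ K2) (@pairing_c00 _ _ (maxn N1 N2)).
  by rewrite mulr_sumr -big_split; apply: eq_bigr => i _ /=; ring.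
by move=> p pN; rewrite K1// K2// mulr0 addr0.
Qed.

Lemma pairing0r f : pairing f (fun=> 0) = 0.
Proof. by rewrite (@pairing_c00 _ _ 0%N)// big_ord0. Qed.

Lemma pairing_scale f a x : c00 x -> pairing f (fun p => a * x p) = a * pairing f x.
Proof.
move=> cx; have := pairing_lin f a cx c00_zero; rewrite pairing0r addr0 => <-.
by congr pairing; apply/funext => p; rewrite addr0.
Qed.

Lemma pairing_sum f (I : eqType) (r : seq I) (P : pred I) (c : I -> R) (x : I -> nat -> R) :
  (forall i, c00 (x i)) ->
  pairing f (fun p => \sum_(i <- r | P i) c i * x i p) =
  \sum_(i <- r | P i) c i * pairing f (x i).
Proof.
move=> cx; elim: r => [|i r IH].
  rewrite big_nil -[RHS](pairing0r f); congr pairing.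
  by apply/funext => p; rewrite big_nil.
rewrite big_cons; case: ifP => Pi.
  rewrite -IH -pairing_lin//; last exact: c00_sum.
  by congr pairing; apply/funext => p; rewrite big_cons Pi.
by rewrite -IH; congr pairing; apply/funext => p; rewrite big_cons Pi.
Qed.

Lemma pairing_avg c (fs : seq (nat -> R)) x : c00 x ->
  pairing (fun p => c * \sum_(f <- fs) f p) x = c * \sum_(f <- fs) pairing f x.
Proof.
move=> /c00_supp[N H]; rewrite (pairing_c00 _ H).
rewrite (eq_bigr _ (fun f _ => pairing_c00 f H)) exchange_big /= mulr_sumr.
by apply: eq_bigr => i _; rewrite -mulrA mulr_suml.
Qed.

Lemma pairing_opp f x : c00 x -> pairing (fun p => - f p) x = - pairing f x.
Proof.
move=> /c00_supp[N H]; rewrite !(pairing_c00 _ H) -sumrN.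
by apply: eq_bigr => i _; rewrite mulNr.
Qed.

Lemma pairing_eq f g x : (forall p, x p != 0 -> f p = g p) ->
  pairing f x = pairing g x.
Proof.
move=> H; apply: eq_fsbigr => p _.
by have [->|/H ->//] := eqVneq (x p) 0; rewrite !mulr0.
Qed.

Lemma pairing_eq0 f x : (forall p, x p != 0 -> f p = 0) -> pairing f x = 0.
Proof.
move=> H; rewrite (@pairingE _ _ 0%N) ?big_ord0// => p _.
by have [->|/H ->] := eqVneq (x p) 0; rewrite ?mulr0 ?mul0r.
Qed.

Lemma pairing_unitv n x : c00 x -> pairing (unitv R n) x = x n.
Proof.
move=> /c00_supp[N H]; have K p : (maxn N n.+1 <= p)%N -> x p = 0.
  by rewrite geq_max => /andP[/H].
rewrite (pairing_c00 _ K).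
have nN : (n < maxn N n.+1)%N by rewrite leq_maxr.
rewrite (bigD1 (Ordinal nN))//= big1 ?addr0; first by rewrite /unitv eqxx mul1r.
by move=> i; rewrite -val_eqE /unitv /= => /negbTE ->; rewrite mul0r.
Qed.

(** Interlaced supports are pairwise disjoint, so that a sum of such functionals inherits pointwise
    bounds from its terms. *)
Lemma interlaced_sum k (fs : seq (nat -> R)) p :
  interlaced k [seq supp f | f <- fs] ->
  (\sum_(f <- fs) f p = 0 /\ forall t, nth (fun=> 0) fs t p = 0) \/
  exists t, [/\ (t < size fs)%N, nth (fun=> 0) fs t p != 0,
    \sum_(f <- fs) f p = nth (fun=> 0) fs t p &
    forall u, u != t -> nth (fun=> 0) fs u p = 0].
Proof.
move=> /interlacedP[_ sk H1 H2].
rewrite (big_nth (fun=> 0)) big_mkord.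
have [[t [tf tp]]|ne] := pselect (exists t, (t < size fs)%N /\ nth (fun=> 0) fs t p != 0).
  have key u : u != t -> nth (fun=> 0) fs u p = 0.
    move=> ut; have [uf|?] := ltnP u (size fs); last by rewrite nth_default.
    apply/eqP/negP => /negP up; rewrite size_map in H1 H2.
    have nE v : (v < size fs)%N -> nth set0 [seq supp f | f <- fs] v =
        supp (nth (fun=> 0) fs v) by move=> vf; rewrite (nth_map (fun=> 0)).
    move: ut; rewrite neq_ltn => /orP[h|h].
      have := H2 u t p; rewrite h tf nE// => /(_ isT up).
      by rewrite ltnNge H1// nE.
    have := H2 t u p; rewrite h uf nE// => /(_ isT tp).
    by rewrite ltnNge H1// nE.
  right; exists t; split=> //.
  rewrite (bigD1 (Ordinal tf))//= big1 ?addr0// => i; rewrite -val_eqE /=; exact: key.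
left; have key t : nth (fun=> 0) fs t p = 0.
  have [tf|?] := ltnP t (size fs); last by rewrite nth_default.
  by apply/eqP/negP => /negP tp; apply: ne; exists t.
by split=> //; apply: big1 => i _; exact: key.
Qed.

End Vectors.

(** * Norming sets *)

Section NormingSet.
Variables (R : realType) (m s l : nat -> nat) (Phi : seq (nat -> R) -> nat).
Hypothesis m_gt1 : forall i, (1 < m i)%N.
Local Notation M := (Mfam s l).
Local Notation Ln := (@Ln R m M Phi).
Local Notation K := (@K R m M).
Local Notation G := (@G R m M).
Local Notation z0 := (fun=> 0 : R).
Implicit Types (f g x : nat -> R) (fs : seq (nat -> R)).

Definition average_of i fs : nat -> R := fun n => (m i)%:R^-1 * \sum_(f <- fs) f n.
Local Notation avg := average_of.

Definition ok_list (L' : nat -> set (nat -> R)) i fs : Prop :=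
  if odd i then
    (exists2 k, (i < k)%N & L' k.*2 (nth z0 fs 0)) /\
    forall t, (0 < t < size fs)%N ->
      G (take t fs) /\ L' (Phi (take t fs)) (nth z0 fs t)
  else forall t, (t < size fs)%N -> exists i', L' i' (nth z0 fs t).

(* [L' = Ln n] gives the averages of [Ln n.+1 i], [L' = Li] those of [L_i]. *)
Definition okavg (L' : nat -> set (nat -> R)) i fs : Prop :=
  [/\ (0 < size fs)%N, admissible (M i) [seq supp f | f <- fs] & ok_list L' i fs].

Definition Li i : set (nat -> R) := [set f | exists n, Ln n i f].

Lemma mR_gt0 i : 0 < (m i)%:R :> R.
Proof. by rewrite ltr0n (leq_trans _ (m_gt1 i)). Qed.

Lemma mR_ge1 i : 1 <= (m i)%:R :> R.
Proof. by rewrite ler1n (leq_trans _ (m_gt1 i)). Qed.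

Lemma mRV_ge0 i : 0 <= (m i)%:R^-1 :> R.
Proof. by rewrite invr_ge0 ltW// mR_gt0. Qed.

Lemma mRV_le1 i : (m i)%:R^-1 <= 1 :> R.
Proof. by rewrite invf_le1 ?mR_gt0// mR_ge1. Qed.

Lemma okavg_mem L' i fs t : okavg L' i fs -> (t < size fs)%N ->
  exists i', L' i' (nth z0 fs t).
Proof.
case=> _ _; rewrite /ok_list; case: ifP => _; last exact.
case=> [[k _ H0] H1] tf; case: t tf => [|t] tf; first by exists k.*2.
by have [_ ?] := H1 t.+1 tf; exists (Phi (take t.+1 fs)).
Qed.

Lemma okavgW (L1 L2 : nat -> set (nat -> R)) i fs :
  (forall j, L1 j `<=` L2 j) -> okavg L1 i fs -> okavg L2 i fs.
Proof.
move=> LL [? ? H]; split=> //; move: H; rewrite /ok_list; case: ifP => _.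
  by case=> [[k ik /LL ?] H]; split; [exists k|move=> t /H [? /LL]].
by move=> H t /H [i' /LL ?]; exists i'.
Qed.

(** For even [i] the tail is the trivial one, from 0 on. Both parities are then covered by one
    induction, at the price of carrying a tail along. *)
Lemma Ln_inv n i f : Ln n.+1 i f -> exists t x, f = tail t x /\
  (pm (Ln n i) x \/ exists fs, okavg (Ln n) i fs /\ x = avg i fs).
Proof.
rewrite /=; case: ifP => oi.
  case=> t t0 [x H <-]; exists t, x; split=> //; case: H; first by left.
  case=> fs [h1 h2 h3] <-; right; exists fs; split=> //; split=> //.
  by rewrite /ok_list oi.
case; first by exists 0%N, f; rewrite tail0; split=> //; left.
case=> fs [h1 h2 h3] <-; exists 0%N, (avg i fs); rewrite tail0; split=> //; right.
by exists fs; split=> //; split=> //; rewrite /ok_list oi.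
Qed.

Lemma avg_c00 i fs : (forall t, (t < size fs)%N -> c00 (nth z0 fs t)) ->
  c00 (avg i fs).
Proof.
move=> H; apply: c00_scale; have -> : (fun n => \sum_(f <- fs) f n) =
    (fun p => \sum_(t < size fs) 1 * nth z0 fs t p).
  apply/funext => p; rewrite (big_nth z0) big_mkord.
  by apply: eq_bigr => t _; rewrite mul1r.
by apply: c00_sum => t _; exact: H.
Qed.

Lemma avg_opp i fs : (fun p => - avg i fs p) = avg i [seq (fun p => - f p) | f <- fs].
Proof. by apply/funext => p; rewrite /avg big_map sumrN mulrN. Qed.

Lemma avg_restr E i fs : restr E (avg i fs) = avg i [seq restr E f | f <- fs].
Proof.
apply/funext => p; rewrite /avg big_map restrE.
under eq_bigr do rewrite restrE.
by case: ifP => //; rewrite big1 ?mulr0.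
Qed.

Lemma admissible_interlaced N Es : admissible N Es ->
  exists k, N [set` k] /\ interlaced k Es.
Proof. by case. Qed.

Lemma Ln_props n i f : Ln n i f -> c00 f /\ forall p, `|f p| <= 1.
Proof.
elim: n i f => [|n IH] i f.
  case=> p p0 H; have c := @c00_unitv R p p0.
  have b q : `|unitv R p q| <= 1 by rewrite /unitv; case: eqP; rewrite ?normr1 ?normr0.
  by case: H => ->; split=> // [|q]; [exact: c00_opp|rewrite normrN].
move=> /Ln_inv[t [x [-> H]]].
suff [cx bx] : c00 x /\ forall p, `|x p| <= 1.
  by split=> [|p]; [exact: c00_restr|rewrite tailE; case: ifP; rewrite ?normr0].
case: H => [[/IH//|[y /IH[cy yb] <-]]|[fs [ok ->]]].
  by split=> [|p]; [exact: c00_opp|rewrite normrN].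
split; first by apply: avg_c00 => u uf; have [i' /IH[]] := okavg_mem ok uf.
move=> p; have [_ [k [_ il]]] : admissible (M i) [seq supp f | f <- fs] by case: ok.
rewrite /avg normrM ger0_norm ?mRV_ge0//.
have [[-> _]|[u [uf _ -> _]]] := interlaced_sum p il; first by rewrite normr0 mulr0.
have [i' /IH[_ b]] := okavg_mem ok uf.
by apply: le_trans (b p); rewrite ler_piMl// mRV_le1.
Qed.

Lemma Ln_c00 n i f : Ln n i f -> c00 f. Proof. by case/Ln_props. Qed.
Lemma Li_c00 i f : Li i f -> c00 f. Proof. by case=> n /Ln_c00. Qed.

(** Tails in [Ln] start at positive integers; the start 1 is what embeds [Ln n] in [Ln n.+1] for odd
    indices. *)
Lemma tail1 f : f 0%N = 0 -> tail 1 f = f.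
Proof. by move=> f0; apply/funext => -[|p]; rewrite tailE. Qed.

Lemma Ln_avg n i fs : okavg (Ln n) i fs -> Ln n.+1 i (avg i fs).
Proof.
move=> ok; have [h1 h2 h3] := ok; have c : c00 (avg i fs).
  by apply: avg_c00 => u uf; have [i' /Ln_c00] := okavg_mem ok uf.
move: h3; rewrite /ok_list /=; case: ifP => oi h3; last by right; exists fs.
exists 1%N => //; exists (avg i fs); first by right; exists fs.
by apply: tail1; exact: c00_0.
Qed.

Lemma Ln_pm n i f : Ln n i f -> Ln n.+1 i f.
Proof.
move=> Lf /=; case: ifP => oi; last by left; left.
by exists 1%N => //; exists f; [left; left|apply: tail1; exact: c00_0 (Ln_c00 Lf)].
Qed.

Lemma Ln_opp n i f : Ln n i f -> Ln n.+1 i (fun p => - f p).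
Proof.
move=> Lf /=; case: ifP => oi; last by left; right; exists f.
exists 1%N => //; exists (fun p => - f p); first by left; right; exists f.
by apply: tail1; rewrite (c00_0 (Ln_c00 Lf)) oppr0.
Qed.

Lemma Ln_le n n' i : (n <= n')%N -> Ln n i `<=` Ln n' i.
Proof.
by move=> /subnK <-; elim: (n' - n)%N => // d IH f /IH; exact: Ln_pm.
Qed.

Lemma Li_opp i f : Li i f -> Li i (fun p => - f p).
Proof. by case=> n /Ln_opp ?; exists n.+1. Qed.

Lemma Li_unit i f : pm_units f -> Li i f.
Proof. by exists 0%N. Qed.

Lemma seq_level (P : nat -> nat -> Prop) d :
  (forall n n' t, (n <= n')%N -> P n t -> P n' t) ->
  (forall t, (t < d)%N -> exists n, P n t) ->
  exists n, forall t, (t < d)%N -> P n t.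
Proof.
move=> mono; elim: d => [|d IH] H; first by exists 0%N.
have [|n1 H1] := IH; first by move=> t td; apply: H; exact: ltnW.
have [n2 H2] := H d (ltnSn d).
exists (maxn n1 n2) => t; rewrite ltnS leq_eqVlt => /orP[/eqP ->|td].
  by apply: mono H2; exact: leq_maxr.
by apply: mono (H1 _ td); exact: leq_maxl.
Qed.

Lemma okavg_level i fs : okavg Li i fs -> exists n, okavg (Ln n) i fs.
Proof.
case=> h1 h2; rewrite /okavg /ok_list; case: ifP => oi.
  case=> [[k ik [n1 Hk]] H].
  have [||n2 H2] := @seq_level (fun n t => (0 < t)%N ->
    G (take t fs) /\ Ln n (Phi (take t fs)) (nth z0 fs t)) (size fs).
  - by move=> n n' t nn' H' t0; have [? ?] := H' t0; split=> //; exact: Ln_le nn' _ _.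
  - move=> [|t] tf; first by exists 0%N.
    by have [g [n Hn]] := H t.+1 tf; exists n.
  exists (maxn n1 n2); split=> //; split.
    by exists k => //; apply: Ln_le Hk; exact: leq_maxl.
  move=> t /andP[t0 tf]; have [? Ht] := H2 t tf t0; split=> //.
  by apply: Ln_le Ht; exact: leq_maxr.
move=> H.
have [||n Hn] := @seq_level (fun n t => exists i', Ln n i' (nth z0 fs t)) (size fs).
- by move=> n n' t nn' [i' Hi]; exists i'; exact: Ln_le nn' _ Hi.
- by move=> t /H [i' [n Hn]]; exists n, i'.
by exists n.
Qed.

Lemma Li_avg i fs : okavg Li i fs -> Li i (avg i fs).
Proof. by move=> /okavg_level[n /Ln_avg ?]; exists n.+1. Qed.

Lemma admissible_subsets N Es Es' : admissible N Es -> size Es' = size Es ->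
  (forall i, nth set0 Es' i `<=` nth set0 Es i) -> admissible N Es'.
Proof.
move=> [fE [k [Nk il]]] sz EE; split.
  by move=> i; rewrite sz => iE; apply: sub_finite_set (EE i) (fE i iE).
by exists k; split=> //; exact: interlaced_subsets il sz EE.
Qed.

Lemma admissible_map_restr N fs E :
  admissible N [seq supp f | f <- fs] ->
  admissible N [seq supp f | f <- [seq restr E f | f <- fs]].
Proof.
move=> /admissible_subsets; apply; first by rewrite !size_map.
move=> t; have [tf|tf] := ltnP t (size fs); last first.
  by rewrite nth_default ?size_map.
rewrite -map_comp !(nth_map z0)//; exact: supp_restr.
Qed.

Lemma Ln_tail_odd n i t f : odd i -> Ln n.+1 i f -> Ln n.+1 i (tail t f).
Proof.
move=> oi /=; rewrite oi => -[u u0 [x Hx <-]].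
exists (maxn t u); first by rewrite /Npos /= leq_max [(0 < u)%N]u0 orbT.
by exists x => //; rewrite -/(tail _ _) -/(tail _ _) tail_tail.
Qed.

Lemma restr_unit E f : pm_units f -> restr E f = f \/ restr E f = z0.
Proof.
case=> p p0 H; have [Ep|nEp] := pselect (E p); [left|right];
  apply/funext => q; rewrite restrE; case: asboolP => // Eq;
  have qp : q <> p by [move=> qp; apply: Eq; rewrite qp|move=> qp; apply: nEp; rewrite -qp];
  by case: H => ->; rewrite /unitv; case: eqP => //; rewrite oppr0.
Qed.

(** For odd [i], zero is the tail from 2 on of e_1; for even [i], it is the average of that zero.
    Restrictions may annihilate terms, and lists are read through [nth] with default 0, so zero has
    to be available in every family. *)
Lemma Li_zero i : Li i z0.
Proof.
have zo j : odd j -> Li j z0.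
  move=> oj; exists 1%N => /=; rewrite oj; exists 2%N => //; exists (unitv R 1).
    by left; left; exists 1%N => //; left.
  apply/funext => q; rewrite -/(tail _ _) tailE /unitv; case: leqP => //.
  by case: eqP => // ->.
have [/zo//|oi] := boolP (odd i).
have <- : avg i [:: z0] = z0 by apply/funext => q; rewrite /avg big_seq1 mulr0.
have supp0 : supp z0 = set0 by apply/seteqP; split=> q //; rewrite /supp /= eqxx.
apply: Li_avg; split=> //; last first.
  by rewrite /ok_list (negbTE oi) => -[|u]// _; exists 1%N; exact: zo.
rewrite /= supp0; split; first by case=> // _ /=; exact: finite_set0.
exists [:: 1%N]; split; first by rewrite setof_seq1; exact: Mfam_one.
by split=> // -[|u].
Qed.

Lemma Li_tail i t f : Li i f -> Li i (tail t f).
Proof.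
case=> n; elim: n i f => [|n IH] i f Hf.
  have [|] := restr_unit [set p | (t <= p)%N] Hf; rewrite -/(tail t f) => ->.
    by exists 0%N.
  exact: Li_zero.
have [oi|oi] := boolP (odd i); first by exists n.+1; exact: Ln_tail_odd.
move: Hf => /=; rewrite (negbTE oi); case.
  by case=> [/IH//|[y /IH Hy <-]]; rewrite tail_opp; exact: Li_opp.
case=> fs [h1 h3 h2] <-; rewrite -/(avg i fs) /tail avg_restr.
apply: Li_avg; split; [by rewrite size_map|exact: admissible_map_restr|].
rewrite /ok_list (negbTE oi) => u; rewrite size_map => uf.
by have [i' /IH ?] := h3 u uf; exists i'; rewrite (nth_map z0).
Qed.

(* Truncating a special functional leaves an initial part of the special
   sequence untouched, changes one term and annihilates the later ones; the
   index prescribed by Phi only depends on the untouched part. *)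
Lemma Li_init i q f : Li i f -> Li i (init q f).
Proof.
case=> n; elim: n i f => [|n IH] i f Hf.
  have [|] := restr_unit [set p | (p < q)%N] Hf; rewrite -/(init q f) => ->.
    by exists 0%N.
  exact: Li_zero.
have [t [x [-> H]]] := Ln_inv Hf; rewrite init_tail; apply: Li_tail.
case: H => [[/IH//|[y /IH Hy <-]]|[fs [ok ->]]].
  by rewrite init_opp; exact: Li_opp.
have [h1 h2 h3] := ok.
rewrite /init avg_restr; have [oi|oi] := boolP (odd i); last first.
  apply: Li_avg; split; [by rewrite size_map|exact: admissible_map_restr|].
  rewrite /ok_list (negbTE oi) => u; rewrite size_map => uf.
  move: h3; rewrite /ok_list (negbTE oi) => h3.
  by have [i' /IH ?] := h3 u uf; exists i'; rewrite (nth_map z0).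
pose u := find (fun f => init q f != f) fs.
have [uf|uf] := ltnP u (size fs); last first.
  have -> : [seq restr [set p | (p < q)%N] f | f <- fs] = fs.
    rewrite -[RHS]map_id; apply/eq_in_map => g gfs; apply/eqP/negP => /negP gq.
    have : has (fun f => init q f != f) fs by apply/hasP; exists g.
    by rewrite has_find ltnNge uf.
  by exists n.+1; exact: Ln_avg.
have before v : (v < u)%N -> init q (nth z0 fs v) = nth z0 fs v.
  by move=> /(before_find z0) /negbFE /eqP.
have at_u : exists p, (q <= p)%N /\ nth z0 fs u p != 0.
  have : has (fun f => init q f != f) fs by rewrite has_find.
  move=> /(nth_find z0); rewrite -/u => ne; apply: contrapT => nex.
  move: ne => /negP; apply; apply/eqP/funext => p; rewrite initE; case: leqP => // qp.
  by apply/esym/eqP/negP => /negP ?; apply: nex; exists p.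
have [k [Mk il]] := admissible_interlaced h2.
have [szk sk H1 H2] := interlacedP il.
rewrite size_map in H1 H2.
have nE v : (v < size fs)%N -> nth set0 [seq supp f | f <- fs] v =
   supp (nth z0 fs v) by move=> vf; rewrite (nth_map z0).
have after v : (u < v < size fs)%N -> init q (nth z0 fs v) = z0.
  move=> /andP[uv vf]; have [p [qp up]] := at_u.
  have pk : (p < nth 0%N k v)%N by apply: (H2 u); rewrite ?uv// nE.
  apply/funext => p'; rewrite initE; case: ltnP => // p'q.
  apply/eqP/negP => /negP np; have := H1 v p' vf; rewrite nE// => /(_ np); lia.
pose fs' := rcons (take u fs) (init q (nth z0 fs u)).
have szfs' : size fs' = u.+1 by rewrite size_rcons size_takel// ltnW.
have nth' v : (v < u)%N -> nth z0 fs' v = nth z0 fs v.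
  by move=> vu; rewrite nth_rcons size_takel ?(ltnW uf)// vu nth_take.
have nthu : nth z0 fs' u = init q (nth z0 fs u).
  by rewrite nth_rcons size_takel ?(ltnW uf)// ltnn eqxx.
have -> : avg i [seq restr [set p | (p < q)%N] f | f <- fs] = avg i fs'.
  apply/funext => p; rewrite /avg big_map; congr (_ * _).
  rewrite (big_nth z0) [RHS](big_nth z0) szfs'.
  rewrite (big_cat_nat (n := u.+1))//= [X in _ + X]big_nat [X in _ + X]big1 ?addr0.
    rewrite !big_nat; apply: eq_bigr => v /=; rewrite ltnS leq_eqVlt.
    move=> /orP[/eqP ->|vu]; first by rewrite nthu.
    by rewrite nth'// -/(init q _) before.
  by move=> v /after; rewrite -/(init q _) => ->.
apply: Li_avg; split; first by rewrite szfs'.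
  split=> [v|].
    rewrite size_map szfs' => vu; rewrite (nth_map z0) ?szfs'//.
    move: vu; rewrite ltnS leq_eqVlt => /orP[/eqP ->|vu].
      rewrite nthu; apply: sub_finite_set (@supp_restr _ _ _) _.
      by have [+ _] := h2 => /(_ u); rewrite size_map nE// => /(_ uf).
    rewrite nth'//; have vf := ltn_trans vu uf.
    by have [+ _] := h2 => /(_ v); rewrite size_map nE// => /(_ vf).
  exists (take u.+1 k); split.
    apply: Mfam_hereditary Mk _ _ => [r /= /mem_take//|].
    exists (nth 0%N k 0) => /=; rewrite -(nth_take 0%N (ltn0Sn u)).
    by rewrite mem_nth// size_takel// szk size_map.
  have szk' : size (take u.+1 k) = u.+1 by rewrite size_takel// szk size_map.
  apply: interlaced_intro; rewrite ?size_map ?szfs' ?szk'//.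
  - exact: take_sorted.
  - move=> v p vu; rewrite nth_take// (nth_map z0) ?szfs'// => vp.
    have vf : (v < size fs)%N by apply: leq_trans uf.
    apply: H1 => //; rewrite nE//; move: vu vp; rewrite ltnS leq_eqVlt.
    by move=> /orP[/eqP ->|vu]; [rewrite nthu; exact: supp_restr|rewrite nth'].
  - move=> v w p /andP[vw wu]; rewrite nth_take// (nth_map z0) ?szfs' => [vp|]; last exact: ltn_trans wu.
    have vu : (v < u)%N by apply: leq_trans vw _.
    have wf : (w < size fs)%N by apply: leq_trans uf.
    apply: (H2 v); first by rewrite vw.
    by rewrite nE -?nth'//; exact: ltn_trans wf.
rewrite /ok_list oi; move: h3; rewrite /ok_list oi => -[[k0 ik0 Hk0] h3]; split.
  exists k0 => //; case: (posnP u) => [u0|u0].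
    by rewrite -u0 nthu u0; apply: IH.
  by rewrite nth'//; exists n.
move=> v /andP[v0]; rewrite szfs' ltnS => vu.
have tk : take v fs' = take v fs.
  rewrite /fs' -cats1 take_cat size_takel ?(ltnW uf)//.
  move: vu; rewrite leq_eqVlt => /orP[/eqP ->|vu]; last by rewrite vu; apply: take_takel; exact: ltnW.
  by rewrite ltnn subnn take0 cats0.
have [|g Hg] := h3 v; first by rewrite v0 (leq_ltn_trans vu).
rewrite tk; split=> //; move: vu; rewrite leq_eqVlt => /orP[/eqP vE|vu].
  by rewrite vE nthu; apply: IH; rewrite -vE.
by rewrite nth'//; exists n.
Qed.

End NormingSet.

(** * From the families [L_i] to the sets [K_i], and the norm of the space *)

Section Norm.
Variables (R : realType) (m s l : nat -> nat) (Phi : seq (nat -> R) -> nat).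
Hypothesis m_gt1 : forall i, (1 < m i)%N.
Local Notation M := (Mfam s l).
Local Notation Ln := (@Ln R m M Phi).
Local Notation Kn := (@Kn R m M).
Local Notation K := (@K R m M).
Local Notation G := (@G R m M).
Local Notation avg := (@average_of R m).
Local Notation Li := (@Li R m s l Phi).
Local Notation N := (@normL R m M Phi).
Local Notation z0 := (fun=> 0 : R).
Implicit Types (f g x : nat -> R) (fs : seq (nat -> R)).

Lemma Kn_pm n i f : Kn n i f -> Kn n.+1 i f. Proof. by left. Qed.

Lemma Kn_le n n' i : (n <= n')%N -> Kn n i `<=` Kn n' i.
Proof. by move=> /subnK <-; elim: (n' - n)%N => // d IH f /IH; exact: Kn_pm. Qed.

Lemma K_avg i fs : (0 < size fs)%N -> admissible (M i) [seq supp f | f <- fs] ->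
  (forall t, (t < size fs)%N -> exists j, K j (nth z0 fs t)) -> K i (avg i fs).
Proof.
move=> h1 h2 H.
have [||n Hn] := @seq_level (fun n t => exists j, Kn n j (nth z0 fs t)) (size fs).
- by move=> n n' t nn' [j Hj]; exists j; exact: Kn_le nn' _ Hj.
- by move=> t /H[j [n _ Hn]]; exists n, j.
exists n.+1 => //; right; exists fs => //; split=> //.
Qed.

Lemma supp_opp f : supp (fun p => - f p) = supp f.
Proof. by apply/seteqP; split=> p; rewrite /supp /= oppr_eq0. Qed.

Lemma pm_units_opp f : pm_units f -> pm_units (fun p => - f p).
Proof.
by case=> p p0 [->|->]; exists p => //; [right|left; apply/funext => q; rewrite opprK].
Qed.

Lemma Kn_opp n i f : Kn n i f -> Kn n i (fun p => - f p).
Proof.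
elim: n i f => [|n IH] i f /=; first exact: pm_units_opp.
case=> [/IH ?|[fs [h1 h2 h3] <-]]; first by left.
right; exists [seq (fun p => - f p) | f <- fs]; last first.
  by rewrite -/(avg i _) -avg_opp.
split; first by rewrite size_map.
  move=> t; rewrite size_map => tf; have [j Hj] := h2 t tf.
  by exists j; rewrite (nth_map z0)//; exact: IH.
by rewrite -map_comp (eq_map (g := fun f => supp f))// => g /=; exact: supp_opp.
Qed.

Lemma K_opp i f : K i f -> K i (fun p => - f p).
Proof. by case=> n _ /Kn_opp ?; exists n. Qed.

Lemma K_unit i f : pm_units f -> K i f.
Proof. by exists 0%N. Qed.

Lemma supp_neq0 f : f <> z0 -> supp f !=set0.
Proof.
move=> f0; apply: contrapT => H; apply: f0; apply/funext => p.
by apply/eqP/negP => /negP ?; apply: H; exists p.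
Qed.

Lemma admissible_filter i fs : admissible (M i) [seq supp f | f <- fs] ->
  (exists t, (t < size fs)%N /\ nth z0 fs t <> z0) ->
  admissible (M i) [seq supp f | f <- [seq f <- fs | f != z0]].
Proof.
move=> [fE [k [Mk il]]] [t0 [t0f ft0]].
pose idx := [seq t <- iota 0 (size fs) | nth z0 fs t != z0].
have E : [seq f <- fs | f != z0] = [seq nth z0 fs t | t <- idx].
  by rewrite /idx -[in LHS](mkseq_nth z0 fs) /mkseq filter_map.
have idxP t : t \in idx -> (t < size fs)%N.
  by rewrite mem_filter mem_iota /= => /andP[].
split.
  move=> t; rewrite size_map => tf; rewrite (nth_map z0)//.
  have : nth z0 [seq f <- fs | f != z0] t \in fs.
    by have := mem_nth z0 tf; rewrite mem_filter => /andP[].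
  move=> /(nthP z0)[u uf <-]; have := fE u; rewrite size_map => /(_ uf).
  by rewrite (nth_map z0).
exists (map (nth 0%N k) idx); have [szE _ _] := il; split.
  apply: Mfam_hereditary Mk _ _.
    move=> r /= /mapP[t /idxP tf ->]; by rewrite mem_nth// szE size_map.
  exists (nth 0%N k t0) => /=; apply: map_f; rewrite mem_filter mem_iota /= t0f.
  by rewrite andbT; apply/eqP.
rewrite E -map_comp; apply: (interlaced_sub il).
- by apply: sorted_filter; [exact: ltn_trans|exact: iota_ltn_sorted].
- by move=> t /idxP; rewrite size_map.
- by move=> t /idxP tf; rewrite (nth_map z0).
Qed.

Lemma avg_filter i fs : avg i [seq f <- fs | f != z0] = avg i fs.
Proof.
apply/funext => p; rewrite /avg big_filter [in RHS](bigID (fun f => f != z0)) /=.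
by rewrite [X in _ = _ * (_ + X)]big1 ?addr0// => f /negbNE /eqP ->.
Qed.

(** [G] is made of members of the [K_j], whereas the functionals to be coded come from the [L_i]. A
    tail may annihilate some terms of an average, and 0 belongs to no [K_j]; the zero terms are
    therefore dropped, which changes neither the average nor its admissibility. *)
Lemma Ln_K n i f t : Ln n i f -> tail t f <> z0 -> K i (tail t f).
Proof.
elim: n i f t => [|n IH] i f t.
  move=> Hf; have [|] := restr_unit [set p | (t <= p)%N] Hf; rewrite -/(tail t f) => ->//.
  by move=> _; exact: K_unit.
move=> /Ln_inv[u [x [-> H]]]; rewrite tail_tail.
move: (maxn t u) => {}t; case: H => [[/IH H /H//|[y /IH Hy <-]]|[fs [ok ->]]].
  rewrite tail_opp => ne; apply/K_opp/Hy => ty; apply: ne.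
  by apply/funext => p; rewrite ty oppr0.
rewrite /tail avg_restr -avg_filter => ne.
set gs := [seq restr _ _ | _ <- _] in ne *.
have [h1 h2 _] := ok.
have ex : exists v, (v < size gs)%N /\ nth z0 gs v <> z0.
  apply: contrapT => H; apply: ne; apply/funext => p; rewrite /avg.
  rewrite big1_seq ?mulr0// => g /andP[_]; rewrite mem_filter => /andP[/eqP g0].
  by move=> /(nthP z0)[v vg gE]; exfalso; apply: H; exists v; rewrite gE.
apply: K_avg.
- have [v [vg gv]] := ex; rewrite size_filter -has_count; apply/hasP.
  by exists (nth z0 gs v); [exact: mem_nth|exact/eqP].
- by apply: admissible_filter ex; exact: admissible_map_restr.
- move=> v vg; have := mem_nth z0 vg; rewrite mem_filter => /andP[/eqP + ].
  move=> + /(nthP z0)[w wg gE]; rewrite -gE.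
  move: wg; rewrite size_map => wf; rewrite (nth_map z0)// => ne'.
  by have [i' /IH] := okavg_mem ok wf => /(_ _ ne'); exists i'.
Qed.

Lemma Li_K i f : Li i f -> f <> z0 -> K i f.
Proof. by case=> n Hf; rewrite -(tail0 f); exact: Ln_K Hf. Qed.

(** What survives restrictions: an average of weight [m i] with terms in [L], its coding forgotten.
    The condition on terms is asked for all [t], the default 0 beyond the end of [fs] being
    harmless. *)
Definition weighted i f := exists fs k, [/\ f = avg i fs,
  forall t, exists i', Li i' (nth z0 fs t),
  M i [set` k] & interlaced k [seq supp f | f <- fs]].

Lemma weighted_opp i f : weighted i f -> weighted i (fun p => - f p).
Proof.
case=> fs [k [-> H Mk il]]; exists [seq (fun p => - f p) | f <- fs], k.
split=> //; first by rewrite avg_opp.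
  move=> t; have [tf|tf] := ltnP t (size fs); last first.
    by exists 0%N; rewrite nth_default ?size_map//; exact: Li_zero.
  by have [i' ?] := H t; exists i'; rewrite (nth_map z0)//; exact: Li_opp.
by rewrite -map_comp (eq_map (g := fun f => supp f))// => g /=; exact: supp_opp.
Qed.

Lemma weighted_tail i t f : weighted i f -> weighted i (tail t f).
Proof.
case=> fs [k [-> H Mk il]]; exists [seq tail t f | f <- fs], k.
split=> //; first by rewrite /tail avg_restr.
  move=> u; have [uf|uf] := ltnP u (size fs); last first.
    by exists 0%N; rewrite nth_default ?size_map//; exact: Li_zero.
  by have [i' ?] := H u; exists i'; rewrite (nth_map z0)//; exact: Li_tail.
apply: (interlaced_subsets il); rewrite ?size_map// => u.
have [uf|uf] := ltnP u (size fs); last by rewrite nth_default ?size_map.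
by rewrite -map_comp !(nth_map z0)//; exact: supp_restr.
Qed.

Lemma okavg_weighted i fs : okavg m s l Phi Li i fs -> weighted i (avg i fs).
Proof.
move=> ok; have [h1 [_ [k [Mk il]]] _] := ok; exists fs, k; split=> // t.
have [/(okavg_mem ok)[i' ?]|tf] := ltnP t (size fs); first by exists i'.
by exists 0%N; rewrite nth_default//; exact: Li_zero.
Qed.

Lemma okavg_Ln_Li n i fs : okavg m s l Phi (Ln n) i fs -> okavg m s l Phi Li i fs.
Proof. by apply: okavgW => j f; exists n. Qed.

Lemma weighted_zero i : weighted i z0.
Proof.
exists [:: z0], [:: 1%N]; split.
- by apply/funext => q; rewrite /avg big_seq1 mulr0.
- by move=> t; exists 0%N; case: t => [|t]; rewrite /= ?nth_nil; exact: Li_zero.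
- by rewrite setof_seq1; exact: Mfam_one.
- by split=> // -[|t]//= q _; rewrite /supp /= eqxx.
Qed.

Lemma Ln_cases n i f t : Ln n i f -> pm_units (tail t f) \/ weighted i (tail t f).
Proof.
elim: n i f t => [|n IH] i f t.
  move=> Hf; have [|] := restr_unit [set p | (t <= p)%N] Hf; rewrite -/(tail t f) => ->.
    by left.
  by right; exact: weighted_zero.
move=> /Ln_inv[u [x [-> H]]]; rewrite tail_tail.
move: (maxn t u) => {}t; case: H => [[/IH//|[y /IH Hy <-]]|[fs [ok ->]]].
  rewrite tail_opp; case: (Hy t) => [/pm_units_opp|/weighted_opp]; by [left|right].
by right; apply: weighted_tail; apply: okavg_weighted; exact: okavg_Ln_Li ok.
Qed.

Lemma Li_cases i f : Li i f -> pm_units f \/ weighted i f.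
Proof. by case=> n /(@Ln_cases _ _ _ 0); rewrite tail0. Qed.

Lemma Li_le1 i f p : Li i f -> `|f p| <= 1.
Proof. by case=> n /(Ln_props m_gt1)[_]. Qed.

Lemma weighted_le i f p : weighted i f -> `|f p| <= (m i)%:R^-1.
Proof.
case=> fs [k [-> H Mk il]]; rewrite /average_of normrM ger0_norm ?mRV_ge0//.
rewrite ler_piMr ?mRV_ge0//.
have [[-> _]|[u [uf _ -> _]]] := interlaced_sum p il; first by rewrite normr0.
by have [i' /Li_le1] := H u.
Qed.

Lemma pairing_l1 f x B c : (forall p, (B <= p)%N -> x p = 0) ->
  (forall p, `|f p| <= c) -> `|pairing f x| <= c * \sum_(p < B) `|x p|.
Proof.
move=> H fc; rewrite (pairing_c00 _ H) mulr_sumr.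
apply: le_trans (ler_norm_sum _ _ _) _; apply: ler_sum => p _.
by rewrite normrM ler_wpM2r.
Qed.

Lemma L_Li f : L m M Phi f <-> exists i, Li i f.
Proof.
split=> [[i _ [n _ Hn]]|[i [n Hn]]]; first by exists i, n.
by exists i => //; exists n.
Qed.

Lemma has_sup_normL x : c00 x -> has_sup [set pairing f x | f in L m M Phi].
Proof.
move=> /c00_supp[B HB]; split.
  by exists (pairing (unitv R 1) x), (unitv R 1) => //; apply/L_Li; exists 0%N;
    apply: Li_unit; exists 1%N => //; left.
exists (1 * \sum_(p < B) `|x p|) => _ [f /L_Li[i Hf] <-].
by apply: le_trans (ler_norm _) _; apply: pairing_l1 => // p; exact: Li_le1 Hf.
Qed.

Lemma normL_ge x i f : c00 x -> Li i f -> `|pairing f x| <= N x.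
Proof.
move=> cx Hf; have H g : Li i g -> pairing g x <= N x.
  move=> Hg; apply: ub_le_sup; first by case: (has_sup_normL cx).
  by exists g => //; apply/L_Li; exists i.
rewrite ler_norml lerNl -pairing_opp// !H//; exact: Li_opp.
Qed.

Lemma normL_le x c : c00 x -> (forall i f, Li i f -> pairing f x <= c) -> N x <= c.
Proof.
move=> cx H; apply: ge_sup; first by case: (has_sup_normL cx).
by move=> _ [f /L_Li[i /H ?] <-].
Qed.

Lemma normL_approx x c : c00 x -> c < N x ->
  exists i f, Li i f /\ c < pairing f x.
Proof.
move=> cx cN; apply: contrapT => H; move: cN; rewrite ltNge => /negP; apply.
apply: normL_le => // i f Hf; rewrite leNgt; apply/negP => ?; apply: H.
by exists i, f.
Qed.

End Norm.

(** * The norms |.|_n and special combinations *)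

Section ImplicitNorm.
Variables (R : realType) (n : nat) (N : (nat -> R) -> R).
Hypothesis HN : is_implicit_norm n N.
Implicit Types x : nat -> R.

Lemma tnorm_ge0 x : c00 x -> 0 <= N x.
Proof. by case: HN => -[+ _ _ _] _; exact. Qed.

Lemma tnorm_tri x y : c00 x -> c00 y -> N (fun p => x p + y p) <= N x + N y.
Proof. by case: HN => -[_ _ _ +] _; exact. Qed.

Lemma tnorm_scale a x : c00 x -> N (fun p => a * x p) = `|a| * N x.
Proof. by case: HN => -[_ _ + _] _; exact. Qed.

Let unit_norm p := if (0 < p)%N then N (unitv R p) else 0.

Lemma unit_norm_ge0 p : 0 <= unit_norm p.
Proof. by rewrite /unit_norm; case: ifP => // p0; apply: tnorm_ge0; exact: c00_unitv. Qed.

(** The triangle inequality over the coordinates. It serves to bound the set whose supremum occurs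
    in the implicit equation, as [sup] is meaningful only then. *)
Lemma tnorm_l1 x B : c00 x -> (forall p, (B <= p)%N -> x p = 0) ->
  N x <= \sum_(p < B) `|x p| * unit_norm p.
Proof.
elim: B x => [|B IH] x cx H.
  rewrite big_ord0; have -> : x = (fun p => 0 * x p).
    by apply/funext => p; rewrite mul0r H.
  by rewrite tnorm_scale// normr0 mul0r.
have [B0|B0] := posnP B.
  have xz : x = (fun p => 0 * x p).
    apply/funext => -[|p]; first by rewrite (c00_0 cx) mulr0.
    by rewrite mul0r H// B0.
  rewrite {1}xz tnorm_scale// normr0 mul0r; apply: sumr_ge0 => p _.
  by rewrite mulr_ge0 ?unit_norm_ge0.
have ci : c00 (init B x) by apply: c00_restr.
have cu := c00_scale (x B) (@c00_unitv R B B0).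
have -> : x = (fun p => init B x p + x B * unitv R B p).
  apply/funext => p; rewrite initE /unitv; case: ltngtP => pB.
  - by rewrite mulr0 addr0.
  - by rewrite H// mulr0 addr0.
  - by rewrite pB mulr1 add0r.
apply: le_trans (tnorm_tri ci cu) _.
rewrite big_ord_recr /=; apply: lerD.
  apply: le_trans (IH _ ci _) _ => [p Bp|]; first by rewrite initE ltnNge Bp.
  apply: ler_sum => p _; rewrite initE ltn_ord /unitv.
  by rewrite eqn_leq [(B <= p)%N]leqNgt ltn_ord andbF mulr0 addr0.
rewrite tnorm_scale; last exact: c00_unitv.
by rewrite initE ltnn add0r /unitv eqxx mulr1 /unit_norm B0.
Qed.

Lemma tnorm_has_sup x : c00 x ->
  has_sup [set \sum_(E <- Es) N (restr E x) | Es in admissible (Ffam n)].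
Proof.
move=> cx; split.
  exists (\sum_(E <- [:: set0]) N (restr E x)), [:: set0] => //; split.
    by case=> // _; exact: finite_set0.
  exists [:: 1%N]; split; first by rewrite setof_seq1; exact: Ffam_one.
  by split=> // -[|i].
have [B HB] := c00_supp cx.
exists (\sum_(p < B) `|x p| * unit_norm p) => _ [Es [_ [k [_ il]]] <-].
have cr E : c00 (restr E x) by exact: c00_restr.
have HB' E p : (B <= p)%N -> restr E x p = 0 by move=> /HB; rewrite restrE => ->; case: ifP.
apply: le_trans (ler_sum _ (fun E _ => tnorm_l1 (cr E) (HB' E))) _.
rewrite exchange_big /=; apply: ler_sum => p _; rewrite -mulr_suml.
apply: ler_wpM2r; first exact: unit_norm_ge0.
pose fs := [seq restr E (fun p => `|x p|) | E <- Es].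
have -> : \sum_(E <- Es) `|restr E x p| = \sum_(f <- fs) f p.
  by rewrite big_map; apply: eq_bigr => E _; rewrite !restrE; case: ifP; rewrite ?normr0.
have il' : interlaced k [seq supp f | f <- fs].
  apply: (interlaced_subsets il); rewrite ?size_map// => i q.
  have [iE|iE] := ltnP i (size Es); last by rewrite nth_default ?size_map.
  rewrite -map_comp (nth_map set0)//= /supp /= restrE; case: asboolP => //.
  by rewrite eqxx.
have [[-> _]//|[t [tf _ -> _]]] := interlaced_sum p il'.
rewrite size_map in tf; rewrite (nth_map set0)// restrE; case: ifP => //.
Qed.

Lemma tnorm_sup x p : c00 x -> `|x p| <= N x.
Proof.
move=> cx; case: HN => _ /(_ x cx) ->; rewrite le_max; apply/orP; left.
apply: ub_le_sup; last by exists p.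
have [B HB] := c00_supp cx.
exists (\sum_(q < B) `|x q|) => _ [q _ <-].
have [qB|/HB ->] := ltnP q B; last by rewrite normr0 sumr_ge0.
by rewrite (bigD1 (Ordinal qB))//= lerDl sumr_ge0.
Qed.

(** The implicit equation read as a lower bound for [N]; this is the source of the factor 2 in all
    splittings. *)
Lemma tnorm_admissible x Es : c00 x -> admissible (Ffam n) Es ->
  \sum_(E <- Es) N (restr E x) <= 2 * N x.
Proof.
move=> cx adm.
have : \sum_(E <- Es) N (restr E x) <=
    sup [set \sum_(E <- Es) N (restr E x) | Es in admissible (Ffam n)].
  by apply: ub_le_sup; [case: (tnorm_has_sup cx)|exists Es].
move=> /le_trans; apply.
rewrite -ler_pdivrMl// (HN.2 x cx).
by rewrite le_max lexx orbT.
Qed.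

End ImplicitNorm.

Section Constants.
Variables (R : realType) (tnorm : nat -> (nat -> R) -> R) (m k s l : nat -> nat).
Hypothesis tnormP : forall n, is_implicit_norm n (tnorm n).
Hypothesis choiceP : valid_choice tnorm m k s l.

Lemma m0 : m 0 = 2%N. Proof. by case: choiceP => -[]. Qed.

Lemma m_pow j : (m j ^ m j < m j.+1)%N. Proof. by case: choiceP => -[]. Qed.

Lemma m_gt1 j : (1 < m j)%N.
Proof.
elim: j => [|j IH]; first by rewrite m0.
have := m_pow j; have : (2 ^ 2 <= m j ^ m j)%N; last lia.
by apply: (@leq_trans (2 ^ m j)); rewrite ?leq_exp2l ?leq_exp2r//; lia.
Qed.

Lemma m_ge5 j : (0 < j)%N -> (5 <= m j)%N.
Proof.
elim: j => // j IH _; case: j IH => [_|j /(_ isT) IH].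
  by have := m_pow 0; rewrite m0.
have := m_pow j.+1; have := m_gt1 j.+1.
have : (m j.+1 ^ 1 <= m j.+1 ^ m j.+1)%N by rewrite leq_exp2l; lia.
rewrite expn1; lia.
Qed.

Lemma m_double j : (2 * m j <= m j.+1)%N.
Proof.
apply: leq_trans (ltnW (m_pow j)); have mj := m_gt1 j.
apply: (@leq_trans (m j ^ 2)); first by rewrite expnS expn1 leq_mul2r mj orbT.
by rewrite leq_exp2l.
Qed.

Lemma m_le i j : (i <= j)%N -> (m i <= m j)%N.
Proof.
move=> /subnK <-; elim: (j - i)%N => // d IH; rewrite addSn.
by apply: leq_trans IH _; have := m_double (d + i); lia.
Qed.

Lemma m_cube j : (0 < j)%N -> (m j ^ 3 <= m j.+1)%N.
Proof.
move=> j0; apply: leq_trans (ltnW (m_pow j)); have := m_ge5 j0.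
by move=> h; rewrite leq_exp2l; lia.
Qed.

(** The factor 4 is meant for special functionals: apart from the first one, at most [n.+2] of their
    terms have index at most [n.+1], and division by [m n.+1] has to leave 1/4. *)
Lemma m_linear j : (1 < j)%N -> (4 * j.+1 <= m j)%N.
Proof.
elim: j => // j IH; rewrite ltnS => j0; have h := m_double j.
have [j1|j1] := ltnP 1 j; first by have := IH j1; lia.
have -> : j = 1%N by lia.
have h5 := @m_ge5 1 isT; have := @m_cube 1 isT; rewrite !expnS expn0; nia.
Qed.

Lemma sum_mV_iota a d : \sum_(w <- iota a d) (m w)%:R^-1 <= 2 * (m a)%:R^-1 :> R.
Proof.
elim: d a => [|d IH] a /=.
  by rewrite big_nil mulr_ge0// invr_ge0.
rewrite big_cons mulr_natl mulr2n lerD2l; apply: le_trans (IH _) _.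
have mp j : 0 < (m j)%:R :> R by rewrite ltr0n (leq_trans _ (m_gt1 j)).
rewrite ler_pdivrMr// ler_pdivlMl// -natrM ler_nat mulnC; exact: m_double.
Qed.

Lemma sum_mV (ws : seq nat) a : uniq ws -> (forall w, w \in ws -> (a <= w)%N) ->
  \sum_(w <- ws) (m w)%:R^-1 <= 2 * (m a)%:R^-1 :> R.
Proof.
move=> uw H; pose d := (\max_(w <- ws) w).+1.
apply: le_trans (sum_mV_iota a d).
have P : perm_eq ws [seq w <- iota a d | w \in ws].
  apply: uniq_perm => //; first exact/filter_uniq/iota_uniq.
  move=> w; rewrite mem_filter mem_iota; case: (boolP (w \in ws)) => //= ww.
  have h : (w <= \max_(w <- ws) w)%N by exact: leq_bigmax_seq.
  have := H w ww; rewrite /d; lia.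
rewrite (perm_big _ P) big_filter big_mkcond /=; apply: ler_sum => w _.
by case: ifP => // _; rewrite invr_ge0.
Qed.

Lemma Mfam_k i n : (i <= n)%N -> Mfam s l i `<=` Ffam (k n).
Proof.
case: choiceP => _ H _ _ _ /subnK <-; elim: (n - i)%N => [|d IH]; first by case: (H i).
rewrite addSn; apply: subset_trans IH _; have [_ h] := H (d + i)%N.
by apply: subset_trans h _; case: (H (d + i).+1).
Qed.

(** [Ffam 1] contains the empty set and [Ffam 0] does not, so M_0 = F_1 is not contained in F_0. *)
Lemma k_ge1 : (0 < k 0)%N.
Proof.
case: choiceP => _ H _ _ _; have [h _] := H 0%N.
rewrite lt0n; apply/negP => /eqP k0; have := h _ (Ffam_set0 0).
by rewrite k0 => -[p _ /seteqP[]] /(_ p) + _; apply.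
Qed.

Lemma l_gt0 n : (0 < l n.+1)%N.
Proof.
rewrite lt0n; apply/negP => /eqP l0; case: choiceP => _ _ _ _ /(_ n).
rewrite l0 expr0 invr1 ltNge => /negP; apply.
have := m_gt1 n.+1 => h.
by rewrite invf_le1 ?mulr_gt0 ?ltr0n ?(leq_trans _ h)// -natrM ler1n; lia.
Qed.

(** Since s_1 > k_0 >= 1, F_2 is contained in F_(s_1), hence in M_1. *)
Lemma Ffam2_k n : (0 < n)%N -> Ffam 2 `<=` Ffam (k n).
Proof.
move=> n0; case: choiceP => _ H ks _ _.
apply: subset_trans (@Mfam_k 1 n n0).
apply: (@subset_trans _ (Ffam (s 1))).
  by apply: Ffam_le; apply: leq_trans (ks 0%N); exact: k_ge1.
apply: (@iter_bracket_Mfam s l 1 0 isT).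
exact: l_gt0.
Qed.

End Constants.

(** * Special combinations adapted to histories *)

Section Selection.
Variables (R : realType) (tnorm : nat -> (nat -> R) -> R) (m k s l : nat -> nat).
Hypothesis choiceP : valid_choice tnorm m k s l.

(** Strict positivity makes [S] exactly the support of [beta]. The monotonicity will be used for
    alternating sums. *)
Definition convex_weights (S : seq nat) (beta : nat -> R) : Prop :=
  [/\ forall r, r \in S -> 0 < beta r, forall r, r \notin S -> beta r = 0,
      \sum_(r <- S) beta r = 1 &
      forall r r', r \in S -> r' \in S -> (r <= r')%N -> beta r' <= beta r].

Definition special_comb n S beta : Prop :=
  [/\ sorted ltn S, convex_weights S beta, Ffam (s n.+1) [set` S] &
      tnorm (k n) beta < ((m n.+2)%:R ^+ 4)^-1].

Lemma exists_special_comb n (D : set nat) : D `<=` Npos -> infinite_set D ->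
  exists S beta, special_comb n S beta /\ forall r, r \in S -> D r.
Proof.
move=> DN Dinf; case: choiceP => _ _ _ /(_ n D DN Dinf) + _.
case=> a [r]; set x := (X in let x := X in _) => /=.
case=> -[szE sr] [a0 a1] sa [xD xF] xn.
have ur := sorted_uniq ltn_trans ltnn sr.
have xr i : (i < size r)%N -> x (nth 0%N r i) = nth 0 a i.
  move=> ir; rewrite /x (bigD1 (Ordinal ir))//= big1 ?addr0.
    by rewrite /unitv eqxx mulr1.
  move=> j; rewrite -val_eqE /= => ji; rewrite /unitv nth_uniq// eq_sym (negbTE ji) mulr0//.
have xout p : p \notin r -> x p = 0.
  move=> pr; rewrite /x big1// => i _; rewrite /unitv; case: eqP => [pE|_]; last by rewrite mulr0.
  by move: pr; rewrite pE mem_nth.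
have xge p : 0 <= x p.
  have [pr|/xout ->//] := boolP (p \in r).
  by rewrite -(nth_index 0%N pr) xr ?index_mem// a0// szE index_mem.
(* The given combination may have zero coefficients; without them [S] is its support. *)
pose S := [seq p <- r | x p != 0].
have SE : supp x = [set` S].
  apply/seteqP; split=> p /=; rewrite /supp /= mem_filter; last by case/andP.
  by move=> xp; rewrite xp /=; apply/negPn/negP => /xout /eqP; rewrite (negbTE xp).
exists S, x; split; last first.
  by move=> p pS; apply: xD; rewrite SE.
split.
- by apply: sorted_filter => //; exact: ltn_trans.
- split.
  + by move=> p; rewrite mem_filter lt_def xge => /andP[->].
  + move=> p; rewrite mem_filter negb_and negbK => /orP[/eqP//|]; exact: xout.
  + rewrite big_filter -a1 szE [RHS](eq_bigr (fun i : 'I_(size r) => x (nth 0%N r i))).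
      rewrite -(big_mkord xpredT (fun i => x (nth 0%N r i))) -(big_nth 0%N xpredT x).
      rewrite [RHS](bigID (fun p => x p != 0)) /= [X in _ = _ + X]big1 ?addr0//.
      by move=> p /negbNE /eqP.
    by move=> i _; rewrite xr.
  + move=> p q; rewrite !mem_filter => /andP[_ pr] /andP[_ qr].
    rewrite -(nth_index 0%N pr) -(nth_index 0%N qr) !xr ?index_mem//.
    set i := index p r; set j := index q r.
    have ir : (i < size r)%N by rewrite index_mem.
    have jr : (j < size r)%N by rewrite index_mem.
    have [ij _|ji] := leqP i j.
      apply: (sorted_leq_nth (leT := fun b c : R => c <= b)) => //; rewrite ?inE ?szE//.
      by move=> b c d cb db; exact: le_trans db cb.
    by move=> rr; exfalso; have := @sorted_nth_ltn r j i sr; rewrite ji ir => /(_ isT); rewrite ltnNge rr.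
- by rewrite -SE.
- exact: xn.
Qed.

Section History.
Variables (T : Type) (x0 : T) (next : seq T -> nat -> T) (hi : T -> nat) (p0 : nat).

(** [next h p] is the object chosen at the starting point [p] after the history [h], and [hi] gives
    the end of its block. A history is determined by its set of starting points, so that there are
    finitely many of them below a given integer. *)
Definition hist (A : seq nat) : seq T :=
  foldl (fun h p => rcons h (next h p)) [::] A.

Lemma hist_rcons A p : hist (rcons A p) = rcons (hist A) (next (hist A) p).
Proof. by rewrite /hist -cats1 foldl_cat. Qed.

Lemma size_hist A : size (hist A) = size A.
Proof. by elim/last_ind: A => // A p IH; rewrite hist_rcons !size_rcons IH. Qed.

Lemma take_hist t A : take t (hist A) = hist (take t A).
Proof.
elim/last_ind: A => // A p IH; rewrite hist_rcons.
have [tA|tA] := leqP t (size A).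
  by rewrite -!cats1 !takel_cat ?size_hist.
by rewrite !take_oversize ?size_rcons ?size_hist// hist_rcons.
Qed.

Lemma nth_hist t A : (t < size A)%N ->
  nth x0 (hist A) t = next (take t (hist A)) (nth 0%N A t).
Proof.
move=> tA; rewrite take_hist -[nth x0 _ _](_ : nth x0 (take t.+1 (hist A)) t = _).
  by rewrite take_hist (take_nth 0%N tA) hist_rcons nth_rcons size_hist size_takel ?ltnn ?eqxx// ltnW.
by rewrite nth_take.
Qed.

(* The next marker has to lie beyond every block that any history ending at p
   can produce; there are finitely many of these. *)
Let gap p := \max_(A : {set 'I_p.+1})
  hi (last x0 (hist [seq q <- iota 0 p.+1 | inord q \in A])).

Let gapP p B : sorted ltn B -> (forall q, q \in B -> (q <= p)%N) ->
  (hi (last x0 (hist B)) <= gap p)%N.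
Proof.
move=> sB HB; pose A : {set 'I_p.+1} := [set q : 'I_p.+1 | (q : nat) \in B]%SET.
have -> : B = [seq q <- iota 0 p.+1 | inord q \in A].
  apply: (irr_sorted_eq ltn_trans ltnn) => //.
    by apply: sorted_filter; [exact: ltn_trans|exact: iota_ltn_sorted].
  move=> q; rewrite mem_filter mem_iota add0n /= inE; apply/idP/andP => [qB|[+ qp]].
    have qp : (q < p.+1)%N by rewrite ltnS HB.
    by rewrite inordK.
  by rewrite inordK.
exact: (leq_bigmax A).
Qed.

(** The start [p0 + 3] provides both lower bounds of [selection]; the maximum with the successor
    makes [d] strictly increasing whatever [gap] is. *)
Let Fixpoint d i := if i is i'.+1 then maxn (d i').+1 (gap (d i')) else (p0 + 3)%N.

Lemma selection n : exists S beta h, [/\ special_comb n S beta,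
  size h = size S, forall r, r \in S -> (p0 <= r)%N /\ (3 <= r)%N,
  forall t, (t < size S)%N -> nth x0 h t = next (take t h) (nth 0%N S t) &
  forall t, (t.+1 < size S)%N -> (hi (nth x0 h t) <= nth 0%N S t.+1)%N].
Proof.
have dS i : (d i < d i.+1)%N by rewrite /= leq_max leqnn.
have dlt i j : (i < j)%N -> (d i < d j)%N.
  move=> /subnK <-; elim: (j - i.+1)%N => // e IH; rewrite addSn; exact: ltn_trans (dS _).
have dle i j : (i <= j)%N -> (d i <= d j)%N.
  by rewrite leq_eqVlt => /orP[/eqP ->//|/dlt /ltnW].
have dge i : (p0 + 3 <= d i)%N by apply: (dle 0%N).
have did i : (i <= d i)%N by elim: i => // i IH; apply: leq_ltn_trans IH (dS i).
pose D := [set d i | i in [set: nat]].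
have [||S [beta [sc SD]]] := @exists_special_comb n D.
- by move=> _ [i _ <-]; rewrite /Npos /=; have := dge i; lia.
- move=> /finite_seqP[ds dsE]; pose b := (\max_(q <- ds) q).+1.
  have : D (d b) by exists b.
  rewrite dsE /= => db; have h : (d b <= \max_(q <- ds) q)%N by exact: leq_bigmax_seq.
  have := did b; rewrite {1}/b; lia.
have [sS _ _ _] := sc.
exists S, beta, (hist S); split=> //.
- by rewrite size_hist.
- by move=> r /SD[i _ <-]; have := dge i; lia.
- by move=> t tS; exact: nth_hist.
- move=> t tS; have tS' : (t < size S)%N := ltnW tS.
  have [i _ iE] := SD _ (mem_nth 0%N tS'); have [j _ jE] := SD _ (mem_nth 0%N tS).
  have ij : (i < j)%N.
    rewrite ltnNge; apply/negP => /dle; rewrite iE jE leqNgt => /negP; apply.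
    by apply: sorted_nth_ltn; rewrite // ltnSn.
  have h : (gap (nth 0%N S t) <= nth 0%N S t.+1)%N.
    rewrite -iE -jE; apply: leq_trans (dle _ _ ij); rewrite /= leq_maxr//.
  apply: leq_trans h; have -> : nth x0 (hist S) t = last x0 (hist (take t.+1 S)).
    by rewrite -take_hist (take_nth x0) ?size_hist// last_rcons.
  apply: gapP; first exact: take_sorted.
  move=> q /(nthP 0%N)[u]; rewrite size_takel// => ut <-; rewrite nth_take//.
  move: ut; rewrite ltnS leq_eqVlt => /orP[/eqP ->//|ut].
  by apply/ltnW/sorted_nth_ltn => //; rewrite ut.
Qed.

End History.
End Selection.

(** * The basic inequality *)

Lemma sum_at_most_one (R : realType) (S : seq nat) (P : pred nat) (F : nat -> R) c :
  uniq S -> 0 <= c -> (forall r, r \in S -> P r -> F r <= c) ->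
  (forall r r', r \in S -> r' \in S -> P r -> P r' -> (r < r')%N -> False) ->
  \sum_(r <- S | P r) F r <= c.
Proof.
move=> uS c0 Fc H.
rewrite -big_filter; have := filter_uniq P uS.
have mf r : r \in [seq r <- S | P r] -> P r /\ r \in S.
  by rewrite mem_filter => /andP[].
case: [seq r <- S | P r] mf => [|r [|r' rs]] mf; first by rewrite big_nil.
  by rewrite big_seq1 => _; have [] := mf r (mem_head _ _) => ? ?; exact: Fc.
move=> /= /andP[]; rewrite inE negb_or => /andP[rr' _] _; exfalso.
have [Pr rS] := mf r (mem_head _ _).
have [|Pr' rS'] := mf r'; first by rewrite !inE eqxx orbT.
move: rr'; rewrite neq_ltn => /orP[]; [exact: H|exact: H].
Qed.

Section Gaps.
Variables (kap : seq nat) (e : nat -> nat).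
Hypothesis skap : sorted ltn kap.
Notation kp t := (nth 0%N kap t).

(** An index [r] stands for the block [[r, e r)]. With a marker strictly inside, the block may meet
    several of the averaged functionals; an uncut block that starts in [gap t] meets at most the
    t-th one. The last gap is unbounded. *)
Definition cut : set nat := [set r | exists2 q, q \in kap & (r < q < e r)%N].
Definition gap t : set nat :=
  [set r | (kp t <= r)%N /\ ((t.+1 < size kap)%N -> (r < kp t.+1)%N)].

Lemma gap_lt t u a b : (t < u < size kap)%N -> gap t a -> gap u b -> (a < b)%N.
Proof.
move=> /andP[tu us] [_ h] [ub _]; have ts : (t.+1 < size kap)%N by exact: leq_ltn_trans us.
apply: leq_trans (h ts) (leq_trans _ ub).
move: tu; rewrite leq_eqVlt => /orP[/eqP ->//|tu].
by apply/ltnW/sorted_nth_ltn; rewrite // tu.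
Qed.

Lemma gap_exists r : (0 < size kap)%N -> (kp 0 <= r)%N ->
  exists t, (t < size kap)%N /\ gap t r.
Proof.
move=> k0 kr; pose u := find (fun q => (r < q)%N) kap.
have u0 : (0 < u)%N.
  rewrite lt0n; apply/negP => /eqP u0.
  have := @nth_find _ 0%N (fun q => (r < q)%N) kap.
  by rewrite has_find -/u u0 k0 => /(_ isT); rewrite ltnNge kr.
have us : (u <= size kap)%N by exact: find_size.
exists u.-1; split; first by rewrite prednK.
split.
  have h : (u.-1 < u)%N by rewrite prednK.
  by have := before_find 0%N h => /negbT; rewrite -leqNgt.
rewrite prednK// => h; apply: (@nth_find _ 0%N (fun q => (r < q)%N)).
by rewrite has_find.
Qed.

(* No marker separates two blocks lying in the same gap. *)
Lemma cut_gap t r r' : (t < size kap)%N -> cut r -> gap t r -> gap t r' -> (e r <= r')%N -> False.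
Proof.
move=> ts [q /nat_nthP[j [js ->]] /andP[rq qe]] [h1 h2] [h3 h4] er.
have tj : (t < j)%N.
  rewrite ltnNge; apply/negP => jt; have : (kp j <= kp t)%N; last lia.
  move: jt; rewrite leq_eqVlt => /orP[/eqP ->//|jt].
  by apply/ltnW/sorted_nth_ltn; rewrite // jt.
have ts1 : (t.+1 < size kap)%N by apply: leq_ltn_trans js.
have : (kp t.+1 <= kp j)%N.
  move: tj; rewrite leq_eqVlt => /orP[/eqP ->//|jt].
  by apply/ltnW/sorted_nth_ltn; rewrite // jt.
have := h4 ts1; lia.
Qed.

(** A block starting before the first marker belongs to no gap and has to be counted separately; two
    such blocks cannot both start there if the earlier one is cut. *)
Lemma cut_first r r' : cut r -> (e r <= r')%N -> (r' < kp 0)%N -> False.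
Proof.
move=> [q /nat_nthP[j [js ->]] /andP[rq qe]] er r0.
have : (kp 0 <= kp j)%N; last lia.
case: j js {rq qe} => // j js; by apply/ltnW/sorted_nth_ltn; rewrite // js.
Qed.

Definition piece A t : set nat := [set r | [/\ A r, ~ cut r & gap t r]].

End Gaps.

Section Blocks.
Variables (R : realType) (m s l : nat -> nat) (Phi : seq (nat -> R) -> nat).
Hypothesis m_gt1 : forall i, (1 < m i)%N.
Local Notation M := (Mfam s l).
Local Notation Ln := (@Ln R m M Phi).
Local Notation avg := (@average_of R m).
Local Notation Li := (@Li R m s l Phi).
Local Notation weighted := (@weighted R m s l Phi).
Local Notation z0 := (fun=> 0 : R).

Variables (n kn : nat) (N : (nat -> R) -> R).
Hypothesis HN : is_implicit_norm kn N.
Hypothesis M_kn : forall i, (i <= n)%N -> M i `<=` Ffam kn.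
Hypothesis F2_kn : Ffam 2 `<=` Ffam kn.

Variables (S : seq nat) (beta : nat -> R) (x : nat -> nat -> R) (e : nat -> nat).
Hypothesis sS : sorted ltn S.
Hypothesis S3 : forall r, r \in S -> (3 <= r)%N.
Hypothesis betaP : convex_weights S beta.
Hypothesis x_c00 : forall r, c00 (x r).
Hypothesis x_block : forall r, r \in S -> forall p, x r p != 0 -> (r <= p < e r)%N.
Hypothesis e_le : forall r r', r \in S -> r' \in S -> (r < r')%N -> (e r <= r')%N.
Implicit Types (f g : nat -> R) (A : set nat).

Definition ev f A : R := \sum_(r <- S | r \in A) beta r * pairing f (x r).

Let uS : uniq S. Proof. exact: (sorted_uniq ltn_trans ltnn sS). Qed.

Let beta_ge0 r : 0 <= beta r.
Proof.
case: betaP => b1 b2 _ _; have [/b1/ltW//|/b2 ->//] := boolP (r \in S).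
Qed.

Lemma beta_c00 : c00 beta.
Proof.
case: betaP => b1 b2 _ _; split.
  apply: (sub_finite_set (B := [set` S])); last exact: finite_seq.
  by move=> p /= bp; apply/negPn/negP => /b2 /eqP; rewrite (negbTE bp).
move=> p bp; have /S3 : p \in S by apply/negPn/negP => /b2 /eqP; rewrite (negbTE bp).
by rewrite /Npos /=; exact: leq_trans.
Qed.

Let cr A : c00 (restr A beta).
Proof. exact: c00_restr beta_c00. Qed.

Lemma N_ge0 A : 0 <= N (restr A beta).
Proof. exact: (tnorm_ge0 HN). Qed.

Lemma N_ge A r : A r -> beta r <= N (restr A beta).
Proof.
move=> Ar; have := tnorm_sup HN r (cr A); rewrite restr_in//.
exact: le_trans (ler_norm _).
Qed.

Lemma N_le3 A (P : pred nat) :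
  (forall r, r \in S -> P r -> A r) ->
  (forall r r', r \in S -> r' \in S -> P r -> P r' -> (r < r')%N -> False) ->
  \sum_(r <- S | P r) beta r <= N (restr A beta).
Proof.
by move=> PA H; apply: sum_at_most_one => // [|r rS Pr]; [exact: N_ge0|apply/N_ge/PA].
Qed.

Lemma restr_restr A B : B `<=` A -> restr B (restr A beta) = restr B beta.
Proof.
move=> BA; apply/funext => p; rewrite !restrE.
by case: asboolP => // /BA Ap; rewrite asboolT.
Qed.

Lemma restr_S A : restr (A `&` [set` S]) beta = restr A beta.
Proof.
case: betaP => _ b2 _ _; apply/funext => p; rewrite !restrE.
case: asboolP => [[Ap _]|nA]; first by rewrite asboolT.
case: asboolP => // Ap; rewrite b2//; apply/negP => pS; exact: nA.
Qed.

Lemma ev_opp f A : ev (fun p => - f p) A = - ev f A.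
Proof. by rewrite /ev -sumrN; apply: eq_bigr => r _; rewrite pairing_opp// mulrN. Qed.

Lemma ev_unit C f A : 0 <= C -> pm_units f ->
  (forall r, r \in S -> `|pairing f (x r)| <= C) -> `|ev f A| <= C * N (restr A beta).
Proof.
move=> C0 [p p0 fE] fC; apply: le_trans (ler_norm_sum _ _ _) _.
have fp q : q <> p -> f q = 0.
  by case: fE => ->; rewrite /unitv; case: eqP => //; rewrite oppr0.
rewrite (bigID (fun r => x r p != 0)) /= [X in _ + X]big1 ?addr0.
  apply: sum_at_most_one => //; first by rewrite mulr_ge0// N_ge0.
    move=> r rS /andP[/set_mem rA _]; rewrite normrM ger0_norm// mulrC.
    by apply: ler_pM => //; [exact: fC|exact: N_ge].
  move=> r r' rS rS' /andP[_ h] /andP[_ h'] rr'.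
  by have := e_le rS rS' rr'; have := x_block rS h; have := x_block rS' h'; lia.
move=> r /andP[_ /negPn /eqP xr]; rewrite pairing_eq0 ?mulr0 ?normr0// => q xq.
by apply: fp => qp; move: xq; rewrite qp xr eqxx.
Qed.

Lemma ev_le_const f A c : (forall r, r \in S -> `|pairing f (x r)| <= c) ->
  `|ev f A| <= c * \sum_(r <- S | r \in A) beta r.
Proof.
move=> fc; apply: le_trans (ler_norm_sum _ _ _) _.
rewrite mulr_sumr big_seq_cond [leRHS]big_seq_cond; apply: ler_sum => r /andP[rS _].
by rewrite normrM ger0_norm// mulrC; apply: ler_wpM2r => //; exact: fc.
Qed.

(** Meant for functionals of large weight: among rapidly increasing blocks, such a weight can match
    that of a single block. The exceptional block is charged to the norm of [beta], the others to
    its sum. *)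
Lemma ev_one_exception f A c C : 0 <= c ->
  (forall r, r \in S -> `|pairing f (x r)| <= C) ->
  (forall r r', r \in S -> r' \in S -> (r < r')%N ->
    `|pairing f (x r)| <= c \/ `|pairing f (x r')| <= c) ->
  `|ev f A| <= C * N (restr A beta) + c * \sum_(r <- S | r \in A) beta r.
Proof.
move=> c0 fC H; apply: le_trans (ler_norm_sum _ _ _) _.
rewrite (bigID (fun r => c < `|pairing f (x r)|)) /=; apply: lerD.
  (* A negative [C] is absurd, because [S] is nonempty: the weights have sum 1. *)
  have [C0|C0] := ltP C 0.
    rewrite big1_seq ?le_eqVlt//; last first.
      by move=> r /andP[_ /fC h]; have := le_lt_trans h C0; rewrite normr_lt0.
    exfalso; have : S <> [::].
      by move=> S0; case: betaP => _ _ + _; rewrite S0 big_nil => /eqP; rewrite eq_sym oner_eq0.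
    case: (S) fC => // r0 S' fC _; have := fC r0 (mem_head _ _).
    by move=> h; have := le_lt_trans h C0; rewrite normr_lt0.
  apply: sum_at_most_one => //; first by rewrite mulr_ge0// N_ge0.
    move=> r rS /andP[/set_mem rA _]; rewrite normrM ger0_norm// mulrC.
    by apply: ler_pM => //; [exact: fC|exact: N_ge].
  move=> r r' rS r'S /andP[_ h] /andP[_ h'] rr'.
  by case: (H r r' rS r'S rr'); rewrite leNgt ?h ?h'.
rewrite mulr_sumr [leRHS](bigID (fun r => c < `|pairing f (x r)|)) /=.
rewrite -[leLHS]add0r; apply: lerD; first by rewrite sumr_ge0// => r _; rewrite mulr_ge0.
apply: ler_sum => r /andP[_]; rewrite -leNgt => h.
by rewrite normrM ger0_norm// mulrC ler_wpM2r.
Qed.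

(** [A] is an interval relative to [S]. Pieces of intervals are intervals, and alternating sums of
    [beta] are small over intervals only. *)
Definition convexS A := forall a b c, a \in S -> b \in S -> c \in S ->
  (a < b < c)%N -> A a -> A c -> A b.

Section Split.
Variables (kap : seq nat) (A : set nat).
Hypothesis skap : sorted ltn kap.
Local Notation piece := (piece kap e A).
Local Notation cut := (cut kap e).
Local Notation gap := (gap kap).

Lemma piece_convex t : convexS A -> (t < size kap)%N -> convexS (piece t).
Proof.
move=> cA ts a b c aS bS cS abc [Aa na ga] [Ac nc gc]; have /andP[ab bc] := abc.
have gb : gap t b.
  case: ga gc => [h1 h2] [h3 h4]; split=> [|h]; first lia.
  by have := h4 h; lia.
split=> //; first exact: cA abc Aa Ac.
by move=> cb; apply: (cut_gap skap ts cb gb gc); exact: e_le.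
Qed.

Lemma sum_pieces (F : nat -> R) : (forall r, 0 <= F r) ->
  \sum_(t < size kap) \sum_(r <- S | r \in piece t) F r <= \sum_(r <- S | r \in A) F r.
Proof.
move=> F0; rewrite (eq_bigr (fun t : 'I_(size kap) =>
  \sum_(r <- S) if r \in piece t then F r else 0)); last by move=> t _; rewrite big_mkcond.
rewrite exchange_big /= [leRHS]big_mkcond /=; apply: ler_sum => r _.
have [/set_mem rA|rA] := boolP (r \in A); last first.
  rewrite big1// => t _; case: ifPn => // /set_mem[Ar _ _].
  by move: rA; rewrite (mem_set Ar).
have [[t rt]|nt] := pselect (exists t : 'I_(size kap), piece t r).
  rewrite (bigD1 t)//= (mem_set rt) big1 ?addr0// => u ut.
  case: ifPn => // /set_mem[_ _ gu]; case: rt => _ _ gt.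
  move: ut; rewrite -val_eqE neq_ltn => /orP[h|h].
    by have := gap_lt skap _ gu gt; rewrite h ltn_ord => /(_ isT); rewrite ltnn.
  by have := gap_lt skap _ gt gu; rewrite h ltn_ord => /(_ isT); rewrite ltnn.
by rewrite big1// => t _; case: ifPn => // /set_mem rt; exfalso; apply: nt; exists t.
Qed.

(** On an uncut block of the t-th gap only the t-th functional acts; the cut blocks are left to the
    whole average. *)
Lemma ev_split i fs : interlaced kap [seq supp f | f <- fs] ->
  ev (avg i fs) A = (m i)%:R^-1 * \sum_(t < size kap) ev (nth z0 fs t) (piece t) +
    \sum_(r <- S | (r \in A) && (r \in cut)) beta r * pairing (avg i fs) (x r).
Proof.
move=> /interlacedP[szk _ H1 H2]; rewrite size_map in szk H1 H2.
have nE v : (v < size fs)%N -> nth set0 [seq supp f | f <- fs] v =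
  supp (nth z0 fs v) by move=> vf; rewrite (nth_map z0).
rewrite /ev (bigID (fun r => r \in cut)) /= addrC; congr (_ + _).
rewrite (eq_bigr (fun r => (m i)%:R^-1 * \sum_(t < size kap)
    beta r * pairing (nth z0 fs t) (x r))); last first.
  move=> r _; rewrite /average_of pairing_avg// (big_nth z0) big_mkord szk -mulr_sumr; ring.
rewrite -mulr_sumr exchange_big /=; congr (_ * _); apply: eq_bigr => t _.
rewrite big_seq_cond [RHS]big_seq_cond big_mkcond [RHS]big_mkcond /=.
apply: eq_bigr => r _; case: (boolP (r \in S)) => //= rS.
case: (boolP (r \in A)) => /= [/set_mem rA|rA]; last first.
  by case: ifPn => // /set_mem[Ar _ _]; move: rA; rewrite (mem_set Ar).
case: (boolP (r \in cut)) => /= [/set_mem rc|rc].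
  by case: ifPn => // /set_mem[_ ? _].
have {}rc : ~ cut r by move=> ?; move: rc; rewrite (mem_set _).
case: ifPn => // rp; rewrite pairing_eq0 ?mulr0// => p xp.
apply/eqP/negP => /negP fp; move: rp => /negP; apply; apply: mem_set; split=> //.
have /andP[rp pe] := x_block rS xp.
have tf : (t < size fs)%N by rewrite -szk.
have tp : (nth 0%N kap t <= p)%N by apply: H1; rewrite // nE.
split; first by rewrite leqNgt; apply/negP => rt; apply: rc;
  exists (nth 0%N kap t); [exact: mem_nth|rewrite rt (leq_ltn_trans tp)].
move=> t1; rewrite ltnNge; apply/negP => tr.
have : (p < nth 0%N kap t.+1)%N; last lia.
by apply: (H2 t); rewrite ?nE// ltnSn -szk.
Qed.

Lemma interlaced_gaps (E : nat -> set nat) :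
  (forall t, (t < size kap)%N -> E t `<=` gap t) ->
  interlaced kap [seq E t | t <- iota 0 (size kap)].
Proof.
move=> EG; split=> //; first by rewrite size_map size_iota.
move=> t p; rewrite size_map size_iota => tk; rewrite (nth_map 0%N) ?size_iota//.
by rewrite nth_iota// add0n => /(EG t tk)[].
Qed.

Lemma sum_gaps_le (E : nat -> set nat) : Ffam kn [set` kap] ->
  (forall t, (t < size kap)%N -> E t `<=` gap t) -> (forall t, E t `<=` A) ->
  \sum_(t < size kap) N (restr (E t) beta) <= 2 * N (restr A beta).
Proof.
move=> Fk EG EA.
have := @tnorm_admissible _ _ _ HN (restr A beta)
  [seq E t `&` [set` S] | t <- iota 0 (size kap)] (cr A).
rewrite big_map.
(* Intersecting with [S] makes the sets finite, as admissibility demands, without changing the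
   restriction of [beta]. *)
have -> : \sum_(t <- iota 0 (size kap)) N (restr (E t `&` [set` S]) (restr A beta)) =
    \sum_(t < size kap) N (restr (E t) beta).
  rewrite -[in LHS](subn0 (size kap)) big_mkord; apply: eq_bigr => t _.
  rewrite restr_restr ?restr_S//; apply: subset_trans (EA t); exact: subIsetl.
apply; split.
  move=> t; rewrite size_map size_iota => tk; rewrite (nth_map 0%N) ?size_iota//.
  by apply: sub_finite_set (@finite_seq _ S); exact: subIsetr.
exists kap; split=> //; apply: interlaced_gaps => t tk.
by apply: subset_trans (EG t tk); exact: subIsetl.
Qed.

Lemma piece_gap t : piece t `<=` gap t. Proof. by move=> r []. Qed.
Lemma piece_sub t : piece t `<=` A. Proof. by move=> r []. Qed.

Lemma cut_cover : \sum_(r <- S | (r \in A) && (r \in cut)) beta r <=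
  \sum_(r <- S | [&& r \in A, r \in cut & (r < nth 0%N kap 0)%N]) beta r +
  \sum_(t < size kap) \sum_(r <- S | r \in A `&` cut `&` gap t) beta r.
Proof.
rewrite [X in _ + X](eq_bigr (fun t : 'I_(size kap) =>
  \sum_(r <- S) if r \in A `&` cut `&` gap t then beta r else 0)); last first.
  by move=> t _; rewrite big_mkcond.
rewrite exchange_big /= big_mkcond [X in X + _]big_mkcond -big_split /=.
apply: ler_sum => r _.
case: (boolP (r \in A)) => /= [/set_mem rA|_]; last first.
  by rewrite add0r sumr_ge0// => t _; case: ifP.
case: (boolP (r \in cut)) => /= [/set_mem rc|_]; last first.
  by rewrite add0r sumr_ge0// => t _; case: ifP.
case: ltnP => r0; first by rewrite lerDl sumr_ge0// => t _; case: ifP.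
rewrite add0r; have k0 : (0 < size kap)%N.
  by case: rc => q + _; case: (kap).
have [t [tk gt]] := gap_exists k0 r0.
rewrite (bigD1 (Ordinal tk))//= mem_set// lerDl sumr_ge0// => u _; case: ifP => //.
Qed.

Lemma cut_gap_le t : (t < size kap)%N ->
  \sum_(r <- S | r \in A `&` cut `&` gap t) beta r <=
  N (restr (A `&` cut `&` gap t) beta).
Proof.
move=> tk; apply: N_le3 => [r rS /set_mem//|r r' rS rS'].
move=> /set_mem[[_ rc] rg] /set_mem[[_ _] rg'] rr'.
by apply: (cut_gap skap tk rc rg rg'); exact: e_le.
Qed.

(** 3 = 1 + 2: one cut block before the first marker, and at most one in each gap, these being
    admissible along [kap]. *)
Lemma cut_le : Ffam kn [set` kap] ->
  \sum_(r <- S | (r \in A) && (r \in cut)) beta r <= 3 * N (restr A beta).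
Proof.
move=> Fk; apply: le_trans cut_cover _.
have -> : 3 * N (restr A beta) = N (restr A beta) + 2 * N (restr A beta) by ring.
apply: lerD.
  apply: N_le3 => [r rS /and3P[/set_mem//]|r r' rS rS'].
  move=> /and3P[_ /set_mem rc _] /and3P[_ _ r0] rr'.
  by apply: (cut_first skap rc _ r0); exact: e_le.
apply: le_trans (@sum_gaps_le (fun t => A `&` cut `&` gap t) Fk _ _).
- by apply: ler_sum => t _; apply: cut_gap_le.
- by move=> t _ r [].
- by move=> t r [[]].
Qed.

Lemma pieces_le : Ffam kn [set` kap] ->
  \sum_(t < size kap) N (restr (piece t) beta) <= 2 * N (restr A beta).
Proof.
by move=> Fk; apply: sum_gaps_le => // t; [move=> _; exact: piece_gap|exact: piece_sub].
Qed.


Let lst (E : set nat) := [seq r <- S | r \in E].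

Let lst_sorted E : sorted ltn (lst E).
Proof. by apply: sorted_filter => //; exact: ltn_trans. Qed.

Let lst_mem E r : r \in lst E -> r \in S /\ E r.
Proof. by rewrite mem_filter => /andP[/set_mem]. Qed.

Let lst_set E : [set` lst E] = E `&` [set` S].
Proof.
apply/seteqP; split=> r /=; first by move=> /lst_mem[].
by move=> [Er rS]; rewrite mem_filter rS mem_set.
Qed.

Lemma sorted_cat_ltn (s1 s2 : seq nat) : sorted ltn s1 -> sorted ltn s2 ->
  (forall a b, a \in s1 -> b \in s2 -> (a < b)%N) -> sorted ltn (s1 ++ s2).
Proof.
rewrite !(sorted_pairwise ltn_trans) pairwise_cat => -> -> H.
by rewrite !andbT; apply/allrelP.
Qed.

Lemma sorted_flatten_iota (f : nat -> seq nat) a d :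
  (forall t, (a <= t < a + d)%N -> sorted ltn (f t)) ->
  (forall t u b c, (a <= t)%N -> (t < u < a + d)%N -> b \in f t -> c \in f u -> (b < c)%N) ->
  sorted ltn (flatten [seq f t | t <- iota a d]).
Proof.
elim: d a => [//|d IH] a H1 H2 /=; apply: sorted_cat_ltn.
- by apply: H1; rewrite leqnn; lia.
- apply: IH => [t ht|t u b c ha hu]; first by apply: H1; lia.
  by apply: H2; lia.
- move=> b c bf /flattenP[_ /mapP[u + ->]]; rewrite mem_iota => hu cf.
  by apply: (H2 a u) => //; lia.
Qed.

(* For a Schreier node of weight 1/2 the triangle inequality is too lossy; but
   the pieces and the cut blocks together are still Ffam 2-admissible. *)
Lemma pieces_cut_le_schreier : Ffam 1 [set` kap] ->
  \sum_(t < size kap) N (restr (piece t) beta) +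
    \sum_(r <- S | (r \in A) && (r \in cut)) beta r <= 2 * N (restr A beta).
Proof.
move=> F1; pose J t := A `&` cut `&` gap t.
pose J0 := [set r | [/\ A r, cut r & (r < nth 0%N kap 0)%N]].
pose d := size kap.
pose ll t := [:: lst (piece t); lst (J t)].
pose L' := flatten [seq ll t | t <- iota 0 d].
pose L0 := lst J0 :: L'.
pose L := [seq t <- L0 | t != [::]].
have gapd t r : (t < d)%N -> gap t r -> (d <= r)%N.
  move=> td [h _]; apply: leq_trans h; apply: (Ffam1_seq_size skap F1); exact: mem_nth.
(* A cut block is the last one of its gap, so each gap lists its piece first and its cut block
   afterwards. *)
have pJ t a b : (t < d)%N -> a \in lst (piece t) -> b \in lst (J t) -> (a < b)%N.
  move=> td /lst_mem[aS [_ nc ga]] /lst_mem[bS [[_ cb] gb]].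
  have [//|ba|ab] := ltngtP a b; last by case: nc; rewrite ab.
  exfalso; apply: (cut_gap skap td cb gb ga); exact: e_le.
have flE (LL : seq (seq nat)) : flatten [seq t <- LL | t != [::]] = flatten LL.
  by elim: LL => //= -[|a t] LL IH /=; rewrite IH.
have flL' : flatten L' = flatten [seq lst (piece t) ++ lst (J t) | t <- iota 0 d].
  by rewrite /L'; elim: (iota 0 d) => //= a t IH; rewrite IH catA.
have memL' b : b \in flatten L' -> b \in S /\ exists2 t, (t < d)%N & gap t b.
  rewrite flL' => /flattenP[_ /mapP[t + ->]]; rewrite mem_iota /= add0n => td.
  by rewrite mem_cat => /orP[] /lst_mem[bS]; [case=> _ _ g|case=> _ g]; split=> //; exists t.
have sL' : sorted ltn (flatten L').
  rewrite flL'; apply: sorted_flatten_iota => [t td|t u b c _].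
    apply: sorted_cat_ltn; [exact: lst_sorted|exact: lst_sorted|].
    by move=> a b; apply: pJ; lia.
  move=> tu bt cu; have gb : gap t b.
    by move: bt; rewrite mem_cat => /orP[] /lst_mem[_ []].
  have gc : gap u c.
    by move: cu; rewrite mem_cat => /orP[] /lst_mem[_ []].
  by apply: (gap_lt skap _ gb gc); rewrite -/d; lia.
have sL0 : sorted ltn (flatten L0).
  apply: sorted_cat_ltn => //.
  move=> a b /lst_mem[_ [_ _ a0]] /memL'[_ [t td [+ _]]].
  move=> h; apply: leq_trans a0 (leq_trans _ h).
  by case: (t) td => // u ud; apply/ltnW/sorted_nth_ltn; rewrite // ud.
have ilL : interlaced (map (head 0%N) L) (map (fun t => [set` t]) L).
  apply: interlaced_heads; last by rewrite flE.
  by move=> t; rewrite mem_filter => /andP[/eqP].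
(* The new markers form three members of F_1: at most one before the first element of [kap], and at
   most 2d others, divided into two groups of at most d. The latter are all at least d, as the set
   [kap] of size d is in F_1. *)
pose mu0 := map (head 0%N) [seq t <- [:: lst J0] | t != [::]].
pose mu' := map (head 0%N) [seq t <- L' | t != [::]].
have muE : map (head 0%N) L = mu0 ++ take d mu' ++ drop d mu'.
  by rewrite cat_take_drop /mu0 /mu' -map_cat -filter_cat.
have smu : sorted ltn (mu0 ++ take d mu' ++ drop d mu') by rewrite -muE; case: ilL.
have headmem (LL : seq (seq nat)) r :
    r \in map (head 0%N) [seq t <- LL | t != [::]] -> r \in flatten LL.
  move=> /mapP[[|a t]]; rewrite mem_filter //= => aL ->.
  by apply/flattenP; exists (a :: t) => //; rewrite mem_head.
have mu'd r : r \in mu' -> (d <= r)%N.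
  by move=> /headmem /memL'[_ [t td]]; exact: gapd.
have mu3 r : r \in map (head 0%N) L -> (3 <= r)%N.
  move=> /headmem; rewrite /L0 /= mem_cat => /orP[/lst_mem[rS _]|/memL'[rS _]]; exact: S3.
have szmu' : (size mu' <= d + d)%N.
  rewrite size_map; apply: leq_trans (_ : (size L' <= _)%N).
    by rewrite size_filter; exact: count_size.
  have -> : size L' = (size (iota 0 d) + size (iota 0 d))%N.
    by rewrite /L'; elim: (iota 0 d) => //= a t ->; lia.
  by rewrite size_iota.
have F2 : Ffam 2 [set` map (head 0%N) L].
  rewrite muE; have [smu0 smu'] := cat_sorted2 smu; have [s1 s2] := cat_sorted2 smu'.
  apply: Ffam2_cat3 => //; last by rewrite -muE.
  - apply: Ffam1_seq => // r rm; apply: (@leq_trans 1).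
      by rewrite size_map; case: (lst J0).
    by apply: ltn_trans (mu3 r _); rewrite // muE mem_cat rm.
  - apply: Ffam1_seq => // r /mem_take /mu'd; apply: leq_trans.
    by rewrite size_take; case: ltnP => //.
  - apply: Ffam1_seq => // r /mem_drop /mu'd; apply: leq_trans.
    by rewrite size_drop; lia.
have adm : admissible (Ffam kn) (map (fun t => [set` t]) L).
  split.
    by move=> t; rewrite size_map => tL; rewrite (nth_map [::])//; exact: finite_seq.
  by exists (map (head 0%N) L); split=> //; exact: F2_kn.
have := tnorm_admissible HN (cr A) adm; apply: le_trans.
rewrite big_map big_filter.
have -> : \sum_(t <- L0 | t != [::]) N (restr [set` t] (restr A beta)) =
    \sum_(t <- L0) N (restr [set` t] (restr A beta)).
  rewrite [RHS](bigID (fun t => t != [::])) /= [X in _ + X]big1 ?addr0// => t /negbNE /eqP ->.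
  have -> : restr [set` [::]] (restr A beta) = (fun p => 0 * beta p).
    by apply/funext => p; rewrite restrE mul0r; case: asboolP.
  by rewrite (tnorm_scale HN) ?normr0 ?mul0r//; exact: beta_c00.
have NE E : E `<=` A -> N (restr [set` lst E] (restr A beta)) = N (restr E beta).
  move=> EA; rewrite lst_set restr_restr ?restr_S//.
  by apply: subset_trans EA; exact: subIsetl.
rewrite /L0 big_cons NE; last by move=> r [].
have -> : \sum_(j <- L') N (restr [set` j] (restr A beta)) =
    \sum_(t < d) (N (restr (piece t) beta) + N (restr (J t) beta)).
  rewrite /L' big_flatten big_map -[in LHS](subn0 d) big_mkord.
  apply: eq_bigr => t _; rewrite /ll big_cons big_seq1 !NE//; last exact: piece_sub.
  by move=> r [[]].
rewrite big_split /= addrCA lerD2l; apply: le_trans cut_cover _; apply: lerD.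
  apply: N_le3 => [r rS /and3P[/set_mem ? /set_mem ? ?]//|r r' rS rS'].
  move=> /and3P[_ /set_mem rc _] /and3P[_ _ r0] rr'.
  by apply: (cut_first skap rc _ r0); exact: e_le.
by apply: ler_sum => t _; exact: cut_gap_le.
Qed.

End Split.

Lemma ev_split_le i kap fs A c : sorted ltn kap ->
  interlaced kap [seq supp f | f <- fs] ->
  (forall r, r \in S -> `|pairing (avg i fs) (x r)| <= c / (m i)%:R) ->
  `|ev (avg i fs) A| <= (m i)%:R^-1 *
    (\sum_(t < size kap) `|ev (nth z0 fs t) (piece kap e A t)| +
     c * \sum_(r <- S | (r \in A) && (r \in cut kap e)) beta r).
Proof.
move=> skap il H; rewrite (ev_split A skap i il).
apply: le_trans (ler_normD _ _) _; rewrite mulrDr; apply: lerD.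
  rewrite normrM ger0_norm ?mRV_ge0//; apply: ler_wpM2l; first exact: mRV_ge0.
  exact: ler_norm_sum.
apply: le_trans (ler_norm_sum _ _ _) _.
rewrite mulrA mulr_sumr big_seq_cond [leRHS]big_seq_cond; apply: ler_sum => r /and3P[rS _ _].
rewrite normrM ger0_norm// mulrC; apply: ler_wpM2r => //.
by rewrite mulrC; exact: H.
Qed.

Section BasicInequality.
Hypothesis m0 : m 0 = 2%N.
Hypothesis m_ge5 : forall i, (0 < i)%N -> (5 <= m i)%N.
Variables (C theta : R).
Hypothesis C0 : 0 <= C.
Hypothesis theta0 : 0 <= theta.

Definition mass A : R := N (restr A beta) + theta * \sum_(r <- S | r \in A) beta r.

Lemma mass_ge0 A : 0 <= mass A.
Proof. by rewrite addr_ge0 ?N_ge0// mulr_ge0// sumr_ge0. Qed.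

(** All tails at once, because members of [Ln] of odd index are tails of averages. *)
Definition ev_bounded n' := forall i g t A, Ln n' i g -> convexS A ->
  `|ev (tail t g) A| <= C * mass A.

Lemma pieces_mass kap A : sorted ltn kap ->
  \sum_(t < size kap) mass (piece kap e A t) <=
  \sum_(t < size kap) N (restr (piece kap e A t) beta) +
    theta * \sum_(r <- S | r \in A) beta r.
Proof.
move=> skap; rewrite big_split /= lerD2l -mulr_sumr; apply: ler_wpM2l => //.
exact: sum_pieces.
Qed.

Hypothesis H1 : forall r i f, r \in S -> Li i f -> `|pairing f (x r)| <= C.
Hypothesis H2 : forall r i f, (i <= n)%N -> r \in S -> Li i f -> weighted i f ->
  `|pairing f (x r)| <= C / (m i)%:R.

(** The pieces cost 2 and the cut blocks 3 norms of [beta], which [m i >= 5] absorbs; for [m 0 = 2]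
    both together cost 2 by [pieces_cut_le_schreier]. The first conclusion keeps the factor 1/m_i,
    which the estimates on exact pairs require. *)
Lemma ev_low_weight i fs kap A : (i <= n)%N -> sorted ltn kap ->
  interlaced kap [seq supp f | f <- fs] -> M i [set` kap] ->
  Li i (avg i fs) -> weighted i (avg i fs) ->
  (forall t, (t < size kap)%N ->
    `|ev (nth z0 fs t) (piece kap e A t)| <= C * mass (piece kap e A t)) ->
  `|ev (avg i fs) A| <= C / (m i)%:R *
     (5 * N (restr A beta) + theta * \sum_(r <- S | r \in A) beta r) /\
  `|ev (avg i fs) A| <= C * mass A.
Proof.
move=> iN skap il Mk Lf Wf H.
have Fk := M_kn iN Mk.
have key : `|ev (avg i fs) A| <= C / (m i)%:R *
   (\sum_(t < size kap) N (restr (piece kap e A t) beta) +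
    theta * \sum_(r <- S | r \in A) beta r +
     \sum_(r <- S | (r \in A) && (r \in cut kap e)) beta r).
  apply: le_trans (ev_split_le (c := C) A skap il _) _.
    by move=> r rS; exact: H2.
  rewrite [C / _]mulrC -mulrA; apply: ler_wpM2l; first exact: mRV_ge0.
  rewrite [leRHS]mulrDr; apply: lerD => //.
  apply: (@le_trans _ _ (\sum_(t < size kap) C * mass (piece kap e A t))).
    by apply: ler_sum => t _; apply: H.
  by rewrite -mulr_sumr; apply: ler_wpM2l => //; exact: pieces_mass.
have Cm : 0 <= C / (m i)%:R by rewrite mulr_ge0 ?mRV_ge0.
have p5 := pieces_le A skap Fk; have c5 := cut_le A skap Fk.
have first_bound : `|ev (avg i fs) A| <= C / (m i)%:R *
     (5 * N (restr A beta) + theta * \sum_(r <- S | r \in A) beta r).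
  by apply: le_trans key _; apply: ler_wpM2l => //; lra.
split=> //; rewrite /mass.
have Sg : 0 <= theta * \sum_(r <- S | r \in A) beta r by rewrite mulr_ge0// sumr_ge0.
have Ng := N_ge0 A.
have mi : 0 < (m i)%:R :> R by exact: mR_gt0.
have [i0|i0] := posnP i.
  have := pieces_cut_le_schreier A skap; rewrite -[Ffam 1]/(M 0) -[in M _]i0 => /(_ Mk) h.
  apply: le_trans key _; rewrite -mulrA; apply: ler_wpM2l => //.
  rewrite ler_pdivrMl// i0 m0; lra.
apply: le_trans first_bound _; rewrite -mulrA; apply: ler_wpM2l => //.
have h5 : 5 <= (m i)%:R :> R by rewrite (ler_nat _ 5) m_ge5.
rewrite ler_pdivrMl// mulrDr; apply: lerD; first exact: ler_wpM2r.
by rewrite ler_peMl//; apply: le_trans h5; lra.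
Qed.

Hypothesis H3 : forall n' i fs t A, (n < i)%N -> okavg m s l Phi (Ln n') i fs ->
  ev_bounded n' -> convexS A -> `|ev (tail t (avg i fs)) A| <= C * mass A.

Lemma N_mass A : C * N (restr A beta) <= C * mass A.
Proof. by apply: ler_wpM2l => //; rewrite lerDl mulr_ge0// sumr_ge0. Qed.

(** Averages of index at most [n] are split. The remaining ones are the task of [H3], which receives
    the induction hypothesis because a special functional of index n+1 may contain terms of small
    index. *)
Theorem basic_inequality n' : ev_bounded n'.
Proof.
elim: n' => [|n' IH] i g t A.
  move=> Hg cA; have Lg : Li i g by exists 0%N.
  have [|] := restr_unit [set p | (t <= p)%N] Hg; rewrite -/(tail t g) => ->.
    apply: le_trans (N_mass A); apply: ev_unit => // r rS; exact: H1 Lg.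
  rewrite /ev big1 ?normr0 ?mulr_ge0 ?mass_ge0// => r _.
  by rewrite pairing_eq0 ?mulr0.
move=> /Ln_inv[u [y [-> H]]] cA; rewrite tail_tail.
move: (maxn t u) => {}t; case: H => [[Hy|[z Hz <-]]|[fs [ok ->]]].
- exact: IH Hy cA.
- by rewrite tail_opp ev_opp normrN; exact: IH Hz cA.
have [iN|iN] := leqP i n; last exact: H3 ok IH cA.
have ok' := okavg_Ln_Li ok.
have Lf := Li_tail m_gt1 t (Li_avg m_gt1 ok').
have Wf := weighted_tail m_gt1 t (okavg_weighted m_gt1 ok').
have [_ h2 _] := ok; have /admissible_interlaced[kap [Mk il]] := admissible_map_restr [set p | (t <= p)%N] h2.
have skap : sorted ltn kap by case: il.
move: Lf Wf; rewrite /tail avg_restr => Lf Wf.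
have tsz v : (v < size kap)%N -> (v < size fs)%N.
  by case: il => ->; rewrite !size_map.
apply: (ev_low_weight iN skap il Mk Lf Wf _).2 => v vk.
rewrite (nth_map z0) ?tsz//; have [i' Hv] := okavg_mem ok (tsz v vk).
by apply: IH Hv _; apply: piece_convex.
Qed.

End BasicInequality.
End Blocks.

(** * Averages and exact pairs *)

Section James.
Variables (R : realType) (tnorm : nat -> (nat -> R) -> R) (m k s l : nat -> nat).
Variable Phi : seq (nat -> R) -> nat.
Hypothesis tnormP : forall n, is_implicit_norm n (tnorm n).
Hypothesis choiceP : valid_choice tnorm m k s l.
Local Notation M := (Mfam s l).
Local Notation avg := (@average_of R m).
Local Notation Li := (@Li R m s l Phi).
Local Notation weighted := (@weighted R m s l Phi).
Local Notation N := (@normL R m M Phi).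
Local Notation z0 := (fun=> 0 : R).
Implicit Types (f g v : nat -> R).

Let mgt1 := m_gt1 choiceP.
Let mge5 := m_ge5 choiceP.
Let mz := m0 choiceP.

Definition in_block p (x : nat -> R) hi := forall q, x q != 0 -> (p <= q < hi)%N.

Definition comb (S : seq nat) (beta : nat -> R) (x : nat -> nat -> R) : nat -> R :=
  fun p => \sum_(r <- S) beta r * x r p.

Lemma pairing_comb S beta x f : (forall r, c00 (x r)) ->
  pairing f (comb S beta x) = ev S beta x f setT.
Proof.
move=> cx; rewrite /comb pairing_sum// /ev; apply: eq_bigl => r.
by rewrite in_setT.
Qed.

Lemma comb_c00 S beta x : (forall r, c00 (x r)) -> c00 (comb S beta x).
Proof. by move=> cx; exact: c00_sum. Qed.

Lemma comb_block p S beta x e hi : (forall r, r \in S -> (p <= r)%N /\ (e r <= hi)%N) ->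
  (forall r, r \in S -> in_block r (x r) (e r)) -> in_block p (comb S beta x) hi.
Proof.
move=> H B q; rewrite /comb => ne; apply: contrapT => nq; move: ne => /eqP; apply.
rewrite big1_seq// => r /andP[_ rS]; have [->|/(B r rS) h] := eqVneq (x r q) 0.
  by rewrite mulr0.
by exfalso; apply: nq; have := H r rS; lia.
Qed.

(* [near d x]: x is within d of the subspace under consideration. *)
Variable near : R -> (nat -> R) -> Prop.
Hypothesis near_c00 : forall d x, near d x -> c00 x.
Hypothesis near_lin : forall d d' a x y, near d x -> near d' y ->
  near (`|a| * d + d') (fun p => a * x p + y p).
Hypothesis near_zero : near 0 z0.
Hypothesis near_le : forall d d' x, d <= d' -> near d x -> near d' x.

Lemma near_scale d a x : near d x -> near (`|a| * d) (fun p => a * x p).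
Proof.
move=> /near_lin /(_ near_zero)-/(_ a); rewrite addr0; congr near.
by apply/funext => p; rewrite addr0.
Qed.

Lemma near_comb (S : seq nat) (c : nat -> R) d x :
  (forall r, r \in S -> near d (x r)) -> near ((\sum_(r <- S) `|c r|) * d) (comb S c x).
Proof.
elim: S => [|r S IH] H.
  rewrite big_nil mul0r; have := near_zero; congr near.
  by apply/funext => p; rewrite /comb big_nil.
rewrite big_cons mulrDl; have h := H r (mem_head _ _).
have IH' : near ((\sum_(r <- S) `|c r|) * d) (comb S c x).
  by apply: IH => r' r'S; apply: H; rewrite inE r'S orbT.
have := near_lin (c r) h IH'; congr near.
by apply/funext => p; rewrite /comb big_cons.
Qed.

Hypothesis rich : forall p d, 0 < d -> exists u, [/\ near d u,
  forall q, (q < p)%N -> u q = 0, N u <= 1 &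
  exists i f, Li i f /\ 2^-1 <= pairing f u].

Lemma functional_in_block i f p hi x : Li i f -> in_block p x hi -> c00 x ->
  exists g, [/\ Li i g, pairing g x = pairing f x &
    forall q, supp g q -> (p <= q < hi)%N].
Proof.
move=> Hf B cx; exists (init hi (tail p f)); split.
- by apply: Li_init => //; apply: Li_tail.
- by apply: pairing_eq => q /B /andP[h1 h2]; rewrite initE tailE h1 h2.
- move=> q; rewrite /supp /= initE tailE.
  by case: ltnP => // h1; case: leqP => //; rewrite eqxx.
Qed.

Lemma weights_ge0 S (beta : nat -> R) r : convex_weights S beta -> 0 <= beta r.
Proof. by case=> b1 b2 _ _; have [/b1/ltW//|/b2 ->//] := boolP (r \in S). Qed.

Lemma weights_sum_norm S (beta : nat -> R) : convex_weights S beta ->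
  \sum_(r <- S) `|beta r| = 1.
Proof.
move=> w; have [_ _ <- _] := w; apply: eq_bigr => r _.
by rewrite ger0_norm// (weights_ge0 _ w).
Qed.

Lemma weights_sum_le1 S (beta : nat -> R) (P : pred nat) : convex_weights S beta ->
  \sum_(r <- S | P r) beta r <= 1.
Proof.
move=> w; have [_ _ <- _] := w; rewrite [leRHS](bigID P) /= lerDl sumr_ge0// => r _.
exact: weights_ge0 w.
Qed.

Lemma comb_near S (beta : nat -> R) d x : convex_weights S beta ->
  (forall r, r \in S -> near d (x r)) -> near d (comb S beta x).
Proof. by move=> /weights_sum_norm E /(@near_comb S beta); rewrite E mul1r. Qed.

(** The pieces contribute at most the sum 1 of [beta], divided by [m i]. The cut blocks are charged
    to the norm of [beta], which is below 1/(3 m_i) by the choice of s_(n+1). *)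
Lemma james_average n S beta x e i f :
  special_comb tnorm m k s n S beta -> (forall r, r \in S -> (3 <= r)%N) ->
  (forall r, c00 (x r)) -> (forall r, r \in S -> in_block r (x r) (e r)) ->
  (forall r r', r \in S -> r' \in S -> (r < r')%N -> (e r <= r')%N) ->
  (forall r, r \in S -> N (x r) <= 1) ->
  (i <= n)%N -> Li i f -> weighted i f ->
  `|pairing f (comb S beta x)| <= 2 / (m i)%:R.
Proof.
move=> [sS w _ tn] S3 cx Bx ee Nx iN Hf [fs [kap [fE Hfs Mk il]]].
have skap : sorted ltn kap by case: il.
have Fk := Mfam_k choiceP iN Mk.
have mi : 0 < (m i)%:R :> R by exact: mR_gt0.
have HN := tnormP (k n).
rewrite pairing_comb// fE.
(* On a single block nothing is gained from the weight: the constant is [m i], to be compensated by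
   the smallness of [beta]. *)
have h1 r : r \in S -> `|pairing (avg i fs) (x r)| <= (m i)%:R / (m i)%:R.
  move=> rS; rewrite divff ?gt_eqF//; rewrite -fE; apply: le_trans (Nx r rS).
  exact: normL_ge Hf.
apply: le_trans (ev_split_le mgt1 sS w cx Bx setT skap il h1) _.
rewrite mulrDr mulrA mulVf ?gt_eqF// mul1r.
have c3 := cut_le HN sS S3 w ee setT skap Fk.
have rT : restr setT beta = beta by apply/funext => p; rewrite restr_in.
rewrite rT in c3.
have p1 : \sum_(t < size kap) `|ev S beta x (nth z0 fs t) (piece kap e setT t)| <= 1.
  apply: le_trans (_ : \sum_(r <- S | r \in setT) beta r <= 1); last first.
    exact: weights_sum_le1.
  apply: (@le_trans _ _ (\sum_(t < size kap)
      \sum_(r <- S | r \in piece kap e setT t) beta r)); last first.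
    by apply: sum_pieces => // r; exact: weights_ge0 w.
  apply: ler_sum => t _; apply: le_trans (ler_norm_sum _ _ _) _.
  rewrite big_seq_cond [leRHS]big_seq_cond; apply: ler_sum => r /andP[rS _].
  rewrite normrM ger0_norm ?(weights_ge0 _ w)// ler_piMr ?(weights_ge0 _ w)//.
  have [i' Hi'] := Hfs t; apply: le_trans (Nx r rS); exact: normL_ge Hi'.
have b4 : 3 * tnorm (k n) beta <= (m i)%:R^-1.
  apply: le_trans (_ : 3 * ((m n.+2)%:R ^+ 4)^-1 <= _); first by rewrite ler_pM2l// ltW.
  have h := m_le choiceP (leq_trans iN (leq_trans (leqnSn n) (leqnSn n.+1))).
  have hR : (m i)%:R <= (m n.+2)%:R :> R by rewrite ler_nat.
  have h2 : 2 <= (m n.+2)%:R :> R by rewrite (ler_nat _ 2) mgt1.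
  rewrite ler_pdivrMr ?exprn_gt0 ?mR_gt0// ler_pdivlMl//.
  set a := (m i)%:R in mi hR *; set b := (m n.+2)%:R in hR h2 *.
  rewrite !exprS expr0 mulr1; have : 4 <= b * b by nra.
  move=> h4; have : a * 3 <= b * 4 by nra.
  move=> h5; apply: le_trans h5 _; apply: ler_pM => //; nra.
have c3' := le_trans c3 b4.
have : (m i)%:R^-1 * \sum_(t < size kap) `|ev S beta x (nth z0 fs t) (piece kap e setT t)|
    <= (m i)%:R^-1 by rewrite ler_piMr// invr_ge0 ltW.
move: c3'; set P1 := (X in _ -> X <= _ -> _) => h h'.
by rewrite mulr_natl mulr2n; exact: lerD.
Qed.

Lemma flatten_ilc S (kap : nat -> seq nat) (E : nat -> seq (set nat)) e lo :
  sorted ltn S -> (forall r, r \in S -> ilc r (kap r) (E r) (e r)) ->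
  (forall r r', r \in S -> r' \in S -> (r < r')%N -> (e r <= r')%N) ->
  (forall r, r \in S -> (lo <= r)%N) ->
  exists hi, (forall r, r \in S -> (e r <= hi)%N) /\
    ilc lo (flatten (map kap S)) (flatten (map E S)) hi.
Proof.
elim: S lo => [|r S IH] lo sS H ee loS; first by exists lo => /=.
have rS := mem_head r S.
have sub q : q \in S -> q \in r :: S by move=> qS; rewrite inE qS orbT.
have rlt q : q \in S -> (r < q)%N.
  by move: sS; rewrite /= path_sortedE; [move=> /andP[/allP h _] /h|exact: ltn_trans].
have [||||hi [H1 H2]] := IH (e r).
- exact: path_sorted sS.
- by move=> q /sub; exact: H.
- by move=> q q' /sub qS /sub q'S; exact: ee.
- by move=> q qS; apply: ee (rlt q qS) => //; exact: sub.
exists hi; split=> /=.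
  move=> q; rewrite inE => /orP[/eqP ->|/H1//]; exact: ilc_le H2.
apply: ilc_cat H2; apply: ilcW (H r rS); exact: loS.
Qed.

(* Shape of the marker set of a t-fold iterated average starting at p. *)
Definition marker_family n t p (kap : seq nat) : Prop :=
  if t is t'.+1 then iter t' (bracket (Ffam (s n.+1))) (Ffam (s n.+1)) [set` kap]
  else kap = [:: p].

Lemma marker_family_step n t S (kap : nat -> seq nat) e :
  sorted ltn S -> Ffam (s n.+1) [set` S] ->
  (forall r r', r \in S -> r' \in S -> (r < r')%N -> (e r <= r')%N) ->
  (forall r, r \in S -> marker_family n t r (kap r)) ->
  (forall r q, r \in S -> q \in kap r -> (r <= q < e r)%N) ->
  iter t (bracket (Ffam (s n.+1))) (Ffam (s n.+1)) [set` flatten (map kap S)].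
Proof.
move=> sS FS ee; case: t => [|t] H B /=.
  have -> : flatten (map kap S) = S; last by [].
  elim: S {sS FS ee B} H => //= r S IH H; rewrite (H r (mem_head _ _)) IH//.
  by move=> q qS; apply: H; rewrite inE qS orbT.
exists S, [seq [set` kap r] | r <- S]; split=> //.
- apply: interlaced_intro; rewrite ?size_map//.
    by move=> i p iS; rewrite (nth_map 0%N)//= => /(B _ _ (mem_nth 0%N iS)) /andP[].
  move=> i j p /andP[ij jS]; have iS := ltn_trans ij jS.
  rewrite (nth_map 0%N)//= => /(B _ _ (mem_nth 0%N iS)) /andP[_ h].
  apply: leq_trans h (ee _ _ (mem_nth 0%N iS) (mem_nth 0%N jS) _).
  by apply: sorted_nth_ltn; rewrite // ij.
- move=> i; rewrite size_map => iS; rewrite (nth_map 0%N)//.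
  exact: H (mem_nth 0%N iS).
- apply/seteqP; split=> [p /= /flattenP[_ /mapP[r rS ->] pr]|p [i /=]].
    exists (index r S); first by rewrite /= size_map index_mem.
    by rewrite (nth_map 0%N) ?index_mem// nth_index.
  rewrite size_map => iS; rewrite (nth_map 0%N)//= => pr.
  by apply/flattenP; exists (kap (nth 0%N S i)) => //; apply: map_f; exact: mem_nth.
Qed.

Lemma weights_neq0 S (beta : nat -> R) : convex_weights S beta -> S <> [::].
Proof.
by move=> [_ _ h _] S0; move: h; rewrite S0 big_nil => /eqP; rewrite eq_sym oner_eq0.
Qed.

Lemma ev_block S beta x e f r : sorted ltn S -> r \in S ->
  (forall r, r \in S -> in_block r (x r) (e r)) ->
  (forall r r', r \in S -> r' \in S -> (r < r')%N -> (e r <= r')%N) ->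
  (forall q, supp f q -> (r <= q < e r)%N) ->
  ev S beta x f setT = beta r * pairing f (x r).
Proof.
move=> sS rS B ee fr; have uS := sorted_uniq ltn_trans ltnn sS.
rewrite /ev (eq_bigl xpredT); last by move=> q; rewrite in_setT.
rewrite (bigD1_seq r)//= big1_seq ?addr0// => r' /andP[ne r'S].
rewrite pairing_eq0 ?mulr0// => q xq; apply/eqP/negP => /negP fq.
have /andP[h1 h2] := B _ r'S _ xq; have /andP[h3 h4] := fr q fq.
move: ne; rewrite neq_ltn => /orP[/(ee _ _ r'S rS) h|/(ee _ _ rS r'S) h].
  by have := leq_trans h2 (leq_trans h h3); rewrite ltnn.
by have := leq_trans h4 (leq_trans h h1); rewrite ltnn.
Qed.

(* If all averages had norm below 1/2, l-fold iterated averages of normalized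
   vectors would have norm below 2^-l, although the average over M_j of the
   corresponding functionals is at least 1/(2 m_j) there. *)
Lemma james n p0 d0 : odd n -> 0 < d0 -> exists v hi,
  [/\ near d0 v, in_block p0 v hi, N v <= 1, 2^-1 <= N v &
   forall i f, (i <= n)%N -> Li i f -> weighted i f ->
     `|pairing f v| <= 2 / (m i)%:R].
Proof.
move=> on d00; apply: contrapT => Hno.
(* The vector that will contradict [Hno] is scaled by 2^t with t < l_(n+1), and so is its distance
   to the subspace. *)
pose d := d0 / 2 ^+ l n.+1.
have d_gt0 : 0 < d by rewrite divr_gt0// exprn_gt0.
(* [v] is a t-fold average starting at [p], [hi] the end of its block; the functionals [fs], with
   markers [kap], sum to at least 1/2 on it however small its norm. *)
have claim t : (t <= l n.+1)%N -> forall p, exists z : (nat -> R) * nat * seq (nat -> R) * seq nat,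
    (p0 <= p)%N -> let: (v, hi, fs, kap) := z in
    [/\ near d v /\ in_block p v hi, N v <= (2 ^+ t)^-1,
      ilc p kap [seq supp f | f <- fs] hi /\ (forall f, f \in fs -> exists i, Li i f),
      2^-1 <= \sum_(f <- fs) pairing f v & marker_family n t p kap].
  elim: t => [|t IH] tl p.
    have [u [nu up Nu [i [f [Hf fu]]]]] := rich p d_gt0.
    have cu := near_c00 nu; have [B HB] := c00_supp cu.
    pose hi := maxn B p.+1.
    have bu : in_block p u hi.
      move=> q uq; apply/andP; split.
        by rewrite leqNgt; apply/negP => /up /eqP; rewrite (negbTE uq).
      rewrite ltnNge; apply/negP; rewrite /hi geq_max => /andP[/HB /eqP].
      by rewrite (negbTE uq).
    have [g [Hg gu gs]] := functional_in_block Hf bu cu.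
    exists (u, hi, [:: g], [:: p]) => _; split=> //.
    - by rewrite expr0 invr1.
    - split=> [|f']; last by rewrite inE => /eqP ->; exists i.
      by split=> //; exists hi; split=> //=; rewrite /hi leq_maxr.
    - by rewrite big_seq1 gu.
  have [nx nxP] := choice (IH (ltnW tl)).
  pose p1 := maxn p0 p.
  have [S [beta [h [sc szh Sge hE hhi]]]] := selection choiceP (nx 0%N)
    (fun _ : seq ((nat -> R) * nat * seq (nat -> R) * seq nat) => nx) (fun z => z.1.1.2) p1 n.
  have [sS w FS tn] := sc.
  pose x r := if r \in S then (nx r).1.1.1 else z0.
  pose e r := (nx r).1.1.2.
  have Sp r : r \in S -> (p0 <= r)%N /\ (p <= r)%N by move=> /Sge; rewrite /p1 geq_max; lia.
  have nxS r : r \in S -> [/\ near d (x r) /\ in_block r (x r) (e r), N (x r) <= (2 ^+ t)^-1,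
      ilc r (nx r).2 [seq supp f | f <- (nx r).1.2] (e r) /\
        (forall f, f \in (nx r).1.2 -> exists i, Li i f),
      2^-1 <= \sum_(f <- (nx r).1.2) pairing f (x r) & marker_family n t r (nx r).2].
    move=> rS; have [/(nxP r)] := Sp r rS; rewrite /x rS /e.
    by case: (nx r) => [[[v hi] fs] kap].
  have nE i : (i < size S)%N -> nth (nx 0%N) h i = nx (nth 0%N S i) by exact: hE.
  have ee r r' : r \in S -> r' \in S -> (r < r')%N -> (e r <= r')%N.
    move=> /nat_nthP[i [iS ->]] /nat_nthP[j [jS ->]] rr'.
    have ij : (i < j)%N.
      rewrite ltnNge; apply/negP; rewrite leq_eqVlt => /orP[/eqP ji|ji].
        by move: rr'; rewrite ji ltnn.
      by have := sorted_nth_ltn sS (i := j) (j := i); rewrite ji iS => /(_ isT); lia.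
    have := hhi i (leq_ltn_trans ij jS); rewrite nE// -/(e _) => h1.
    apply: leq_trans h1 _; move: ij; rewrite leq_eqVlt => /orP[/eqP ->//|ij].
    by apply/ltnW/sorted_nth_ltn; rewrite // ij.
  have cx r : c00 (x r).
    case: (boolP (r \in S)) => [rS|rS]; first by have [[/near_c00]] := nxS r rS.
    by rewrite /x (negbTE rS); exact: c00_zero.
  have Bx r : r \in S -> in_block r (x r) (e r) by move=> /nxS[[]].
  have nil r : r \in S -> ilc r (nx r).2 [seq supp f | f <- (nx r).1.2] (e r).
    by move=> /nxS[_ _ []].
  have [hi [ehi il]] := flatten_ilc sS nil ee (fun r rS => (Sp r rS).2).
  pose v := comb S beta x.
  have Bv q : (forall r, r \in S -> (q <= r)%N) -> in_block q v hi.
    by move=> qS; apply: (comb_block (e := e)) => // r rS; split; [exact: qS|exact: ehi].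
  have nv : near d v by apply: comb_near => // r /nxS[[]].
  exists (v, hi, flatten [seq (nx r).1.2 | r <- S], flatten [seq (nx r).2 | r <- S]) => _.
  split.
  - by split=> //; apply: Bv => r /Sp[].
  (* Rescaled by 2^t, the blocks have norm at most 1 and their average has all the required
     properties except possibly a norm of at least 1/2. So [Hno] forces its norm below 1/2: this is
     the halving. *)
  - pose y r : nat -> R := fun q => 2 ^+ t * x r q.
    pose w' := comb S beta y.
    have w'E : w' = (fun q => 2 ^+ t * v q).
      apply/funext => q; rewrite /w' /v /comb mulr_sumr; apply: eq_bigr => r _.
      by rewrite /y mulrCA.
    have cy r : c00 (y r) by exact: c00_scale.
    have t2 : 0 < 2 ^+ t :> R by rewrite exprn_gt0.
    have NE z : c00 z -> N (fun q => 2 ^+ t * z q) <= 2 ^+ t * N z.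
      move=> cz; apply: normL_le => //; first exact: c00_scale.
      move=> i f Hf; rewrite pairing_scale// ler_pM2l//.
      by apply: le_trans (ler_norm _) (normL_ge _ cz Hf).
    have NE' : 2 ^+ t * N v <= N w'.
      rewrite -ler_pdivlMl//; apply: normL_le => //; first exact: near_c00 nv.
      move=> i f Hf; rewrite ler_pdivlMl// -pairing_scale; last exact: near_c00 nv.
      rewrite -w'E; apply: le_trans (ler_norm _) (normL_ge _ _ Hf) => //.
      exact: comb_c00.
    have Ny r : r \in S -> N (y r) <= 1.
      move=> rS; apply: le_trans (NE _ (cx r)) _; have [_ h1 _ _ _] := nxS r rS.
      by rewrite -ler_pdivlMl// mulr1.
    have By r : r \in S -> in_block r (y r) (e r).
      by move=> rS q; rewrite /y mulf_eq0 negb_or => /andP[_]; exact: Bx.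
    have : N w' < 2^-1.
      rewrite ltNge; apply/negP => Nw'; apply: Hno; exists w', hi; split=> //.
      + rewrite w'E; have := near_scale (2 ^+ t) nv; apply: near_le.
        rewrite ger0_norm; last exact: ltW.
        rewrite /d mulrCA; apply: ler_piMr; first exact: ltW.
        by rewrite ler_pdivrMr ?exprn_gt0// mul1r ler_eXn2l// ?ltr1n// ltnW.
      + rewrite w'E => q; rewrite mulf_eq0 negb_or => /andP[_].
        by apply: Bv => r /Sp[].
      + apply: normL_le => //; first exact: comb_c00.
        move=> i f Hf; rewrite pairing_comb//; have [_ _ <- _] := w.
        rewrite /ev (eq_bigl xpredT); last by move=> q; rewrite in_setT.
        rewrite big_seq [leRHS]big_seq; apply: ler_sum => r rS.
        rewrite ler_piMr ?(weights_ge0 _ w)//; apply: le_trans (ler_norm _) _.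
        by apply: le_trans (Ny r rS); exact: normL_ge Hf.
      + move=> i f iN Hf Wf; apply: (james_average (e := e)) iN Hf Wf => //.
        by move=> r /Sge[].
    move=> Nw'; rewrite exprS invfM mulrC ler_pdivlMl//.
    by apply: le_trans NE' (ltW Nw').
  - split=> // [|f /flattenP[_ /mapP[r rS ->]]]; last by have [_ _ [_ +] _ _] := nxS r rS; apply.
    by rewrite map_flatten -map_comp.
  - rewrite big_flatten big_map; have [_ _ b1 _] := w.
    rewrite -[leLHS]mul1r -[X in X * _ <= _]b1 mulr_suml big_seq [leRHS]big_seq; apply: ler_sum => r rS.
    have [_ _ [il' _] h2 _] := nxS r rS.
    rewrite (eq_big_seq (fun f => beta r * pairing f (x r))).
      by rewrite -mulr_sumr; apply: ler_wpM2l => //; exact: (weights_ge0 r w).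
    move=> f ff; rewrite /v pairing_comb//; apply: (ev_block _ sS rS Bx ee).
    move=> q fq; have [_ M2] := ilc_mem il'.
    apply: (M2 (index f (nx r).1.2)); rewrite (nth_map z0) ?index_mem//.
    by rewrite nth_index.
  - apply: (marker_family_step (e := e)) => //; first by move=> r /nxS[].
    by move=> r q rS qk; have [_ _ [il' _] _ _] := nxS r rS; have [M1 _] := ilc_mem il'; apply: M1.
have lgt := l_gt0 choiceP n.
have [[[[v hi] fs] kap] /(_ (leqnn p0))] := claim _ (leqnn (l n.+1)) p0.
case=> -[nv bv] Nv [il Hfs] fv mf.
have cv := near_c00 nv.
have fs0 : (0 < size fs)%N.
  by case: fs {il Hfs mf} fv => //; rewrite big_nil leNgt invr_gt0 ltr0n.
(* After l_(n+1) steps the markers are in M_(n+1), and since n+1 is even no coding condition arises.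
   The average gives the norm 1/(2 m_(n+1)) at least, which exceeds 2^-l_(n+1). *)
have Lf : Li n.+1 (avg n.+1 fs).
  apply: Li_avg => //; split=> //.
    split=> [t|].
      rewrite size_map => tf; rewrite (nth_map z0)//.
      by have [i /Li_c00[]] := Hfs _ (mem_nth z0 tf).
    exists kap; split; last exact: ilc_interlaced il.
    move: mf; case: (l n.+1) lgt (@iter_bracket_Mfam s l n.+1 (l n.+1).-1 isT) => // l' _ h mf.
    by apply: h => //=.
  by rewrite /ok_list /= on /= => t tf; have [i Hi] := Hfs _ (mem_nth z0 tf); exists i.
have := normL_ge mgt1 cv Lf; rewrite /average_of pairing_avg// => h.
have {}h := le_trans (ler_norm _) h.
have mp : 0 < (m n.+1)%:R :> R by exact: mR_gt0.
have h1 : (2 * (m n.+1)%:R)^-1 <= N v.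
  apply: le_trans h; rewrite invfM mulrC; apply: ler_wpM2l => //; exact: ltW.
have h2 := le_trans h1 Nv.
case: choiceP => _ _ _ _ /(_ n); rewrite ltNge => /negP; apply; exact: h2.
Qed.

Lemma history_le (T : Type) (x0 : T) (hi : T -> nat) (S : seq nat) (h : seq T) r r' :
  sorted ltn S ->
  (forall t, (t.+1 < size S)%N -> (hi (nth x0 h t) <= nth 0%N S t.+1)%N) ->
  r \in S -> r' \in S -> (r < r')%N ->
  (index r S < index r' S)%N /\ (hi (nth x0 h (index r S)) <= r')%N.
Proof.
move=> sS H rS r'S rr'.
have jS : (index r' S < size S)%N by rewrite index_mem.
have iS : (index r S < size S)%N by rewrite index_mem.
have ij : (index r S < index r' S)%N.
  rewrite ltnNge; apply/negP; rewrite leq_eqVlt => /orP[/eqP ji|ji].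
    by move: rr'; rewrite -(nth_index 0%N rS) -ji nth_index// ltnn.
  have := sorted_nth_ltn sS (i := index r' S) (j := index r S).
  by rewrite ji iS !nth_index// => /(_ isT); rewrite ltnNge ltnW.
split=> //; apply: leq_trans (H _ (leq_ltn_trans ij jS)) _.
rewrite -[leqRHS](nth_index 0%N r'S); move: ij; rewrite leq_eqVlt => /orP[/eqP ->//|ij].
by apply/ltnW/sorted_nth_ltn; rewrite // ij.
Qed.

(** Unit vectors are included: each meets a single block, so the norm of [beta] alone controls
    them. *)
Definition high_weight j f : Prop := (exists i, Li i f) /\
  (pm_units f \/ exists w, [/\ (j < w)%N, Li w f & weighted w f]).

Lemma m_arith n (eps : R) : (0 < n)%N -> 0 <= eps -> eps <= ((m n.+1)%:R ^+ 4)^-1 ->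
  let a := (m n)%:R : R in let b := (m n.+1)%:R : R in
  [/\ 5 <= a, a * eps <= a^-1 / 100, a * b^-1 <= a^-1 / 5, b^-1 <= a^-1 & a^-1 <= 5^-1].
Proof.
move=> n0 e0 ee a b; have a5 : 5 <= a by rewrite (ler_nat _ 5) mge5.
have ab : a ^+ 3 <= b by rewrite -natrX ler_nat (m_cube choiceP).
have ap : 0 < a by apply: lt_le_trans a5.
have bp : 0 < b by apply: lt_le_trans ab; rewrite exprn_gt0.
have ia5 : a^-1 <= 5^-1 by rewrite lef_pV2 ?posrE.
have iap : 0 < a^-1 by rewrite invr_gt0.
have ibp : 0 < b^-1 by rewrite invr_gt0.
have h1 : a * b^-1 <= a^-1 ^+ 2.
  rewrite ler_pdivrMr// exprVn ler_pdivlMl ?exprn_gt0//.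
  by rewrite -exprSr.
have h2 : a * b^-1 <= a^-1 / 5.
  apply: le_trans h1 _; rewrite expr2 ler_pM2l//.
have ib : b^-1 <= a^-1 by nra.
have ib5 : b^-1 <= 5^-1 by exact: le_trans ib ia5.
split=> //.
have e1 : eps <= b^-1 * (b^-1 * (b^-1 * b^-1)).
  by apply: le_trans ee _; rewrite -exprVn !exprS expr0 mulr1.
have e2 : eps <= b^-1 / 25.
  apply: le_trans e1 _; rewrite ler_pM2l//; nra.
apply: (@le_trans _ _ (a * (b^-1 / 25))); first by rewrite ler_pM2l.
rewrite mulrA; nra.
Qed.

(* [y] behaves like a multiple of a basis vector averaged over M_(n+1), and
   [ystar] is a functional of weight m_(n+1) normalized on it. *)
Definition exact n p0 (y ystar : nat -> R) hi : Prop :=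
  [/\ c00 y /\ in_block p0 y hi,
      [/\ Li n.+1 ystar, forall q, supp ystar q -> (p0 <= q < hi)%N,
          pairing ystar y = 1 & forall q, `|ystar q| <= (m n.+1)%:R^-1],
      forall i f, Li i f -> `|pairing f y| <= 16,
      forall i f, (i <= n)%N -> Li i f -> weighted i f ->
        `|pairing f y| <= 16 / (m i)%:R &
      forall i fs kap, (i <= n)%N -> ~~ odd i -> (0 < size fs)%N ->
        M i [set` kap] -> interlaced kap [seq supp f | f <- fs] ->
        (forall t, high_weight n.+1 (nth z0 fs t)) ->
        `|\sum_(f <- fs) pairing f y| <= 16 / (m n.+1)%:R].

(* y is m_(n+1) times a special average of a rapidly increasing sequence of
   averages as in [james], normalized by ystar. *)
Lemma exact_pair n p0 d0 : odd n -> 0 < d0 -> exists y ystar hi,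
  near d0 y /\ exact n p0 y ystar hi.
Proof.
move=> on d00; have n0 : (0 < n)%N by case: (n) on.
set a : R := (m n.+1)%:R; have ap : 0 < a by exact: mR_gt0.
pose b : R := (m n.+2)%:R; have bp : 0 < b by exact: mR_gt0.
pose d := d0 / (4 * a); have d_gt0 : 0 < d by rewrite divr_gt0// mulr_gt0.
pose T := ((nat -> R) * nat * nat)%type.
pose tau0 : T := (z0, 0%N, 0%N).
pose l1 (z : T) := \sum_(q < z.1.2) `|z.1.1 q|.
(* [z.2] is the index below which weights act on the vector as on an average. The last clause is the
   rapid increase: functionals of index at least [z.2] are at most 1/b on all earlier vectors,
   through their l1-norms. *)
pose P (h : seq T) r (z : T) := [/\ near d z.1.1 /\ in_block r z.1.1 z.1.2,
  N z.1.1 <= 1, 2^-1 <= N z.1.1,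
  (n.+1 < z.2)%N /\ forall i f, (i < z.2)%N -> Li i f -> weighted i f ->
     `|pairing f z.1.1| <= 2 / (m i)%:R &
  forall t, (t < size h)%N -> b * l1 (nth tau0 h t) <= (m z.2)%:R].
have exP (hr : seq T * nat) : exists z, P hr.1 hr.2 z.
  case: hr => h r /=; pose tot := \sum_(t < size h) b * l1 (nth tau0 h t).
  have l1_ge0 z : 0 <= b * l1 z by rewrite mulr_ge0 ?(ltW bp)// sumr_ge0.
  have tot0 : 0 <= tot by rewrite sumr_ge0.
  pose B := Num.bound tot.
  (* Even, because [james] is applied to the odd number [j.-1], and so large that [m j] exceeds
     [tot]. *)
  pose j := (2 * (n + B + 2))%N.
  have [|v [hi [nv bv Nv Nv2 Hv]]] := @james j.-1 r d _ d_gt0; first by rewrite /j; lia.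
  exists (v, hi, j); split=> //=.
    split=> [|i f ij]; first by rewrite /j; lia.
    by apply: Hv; lia.
  move=> t th; apply: (@le_trans _ _ tot).
    by rewrite /tot (bigD1 (Ordinal th))//= lerDl sumr_ge0.
  apply: ltW; apply: lt_le_trans (archi_boundP tot0) _.
  rewrite ler_nat -/B; have := m_linear choiceP (j := j); rewrite /j; lia.
have [nx nxP] := choice exP.
have [S [beta [h [sc szh Sge hE hhi]]]] := selection choiceP tau0
  (fun h r => nx (h, r)) (fun z => z.1.2) p0 n.
have [sS w FS tn] := sc.
have S3 r : r \in S -> (3 <= r)%N by move=> /Sge[].
pose z r := nth tau0 h (index r S).
pose x r := if r \in S then (z r).1.1 else z0.
pose e r := (z r).1.2.
have zP r : r \in S -> P (take (index r S) h) r (z r).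
  by move=> rS; rewrite /z hE ?index_mem// nth_index//; exact: nxP (_, _).
have hist2 r r' rS r'S rr' := @history_le T tau0 (fun z => z.1.2) S h r r' sS hhi rS r'S rr'.
have xE r : r \in S -> x r = (z r).1.1 by rewrite /x => ->.
have ee r r' : r \in S -> r' \in S -> (r < r')%N -> (e r <= r')%N.
  by move=> rS r'S rr'; have [_] := hist2 _ _ rS r'S rr'.
have cx r : c00 (x r).
  rewrite /x; case: ifPn => [/zP[[/near_c00]]//|_]; exact: c00_zero.
have Bx r : r \in S -> in_block r (x r) (e r).
  by move=> rS; rewrite xE//; have [[]] := zP r rS.
have Nx r : r \in S -> N (x r) <= 1 by move=> rS; rewrite xE//; have [] := zP r rS.
have f1 r i f : r \in S -> Li i f -> `|pairing f (x r)| <= 1.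
  by move=> rS Hf; apply: le_trans (Nx r rS); exact: normL_ge Hf.
have low r i f : (i <= n.+1)%N -> r \in S -> Li i f -> weighted i f ->
    `|pairing f (x r)| <= 2 / (m i)%:R.
  move=> iN rS; rewrite xE//; have [_ _ _ [h1 h2] _] := zP r rS.
  by apply: h2; exact: leq_ltn_trans h1.
(* If [i] is below the index of the later block, the average property makes f small there; otherwise
   the rapid increase makes f small on the earlier one. *)
have high i f r r' : (n.+1 < i)%N -> Li i f -> weighted i f -> r \in S -> r' \in S ->
    (r < r')%N -> `|pairing f (x r)| <= 2 / b \/ `|pairing f (x r')| <= 2 / b.
  move=> ni Lf Wf rS r'S rr'; have [ij _] := hist2 _ _ rS r'S rr'.
  have [_ _ _ [h1 h2] h3] := zP r' r'S.
  have [ij'|ij'] := ltnP i (z r').2; [right|left].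
    rewrite xE//; apply: le_trans (h2 _ _ ij' Lf Wf) _; rewrite ler_pM2l//.
    by rewrite lef_pV2 ?posrE ?mR_gt0// ler_nat (m_le choiceP).
  have szt : size (take (index r' S) h) = index r' S.
    by rewrite size_takel// szh index_size.
  have := h3 (index r S); rewrite szt => /(_ ij).
  rewrite nth_take// -/(z r) => h4.
  have : `|pairing f (x r)| <= (m i)%:R^-1 * \sum_(q < e r) `|x r q|.
    apply: pairing_l1 => [q eq|q]; last exact: weighted_le Wf.
    by apply/eqP/negP => /negP /(Bx r rS) /andP[_]; rewrite ltnNge eq.
  rewrite xE//; rewrite -/(l1 (z r)) => h5; apply: le_trans h5 _.
  have h6 : b * l1 (z r) <= (m i)%:R by apply: le_trans h4 _; rewrite ler_nat (m_le choiceP).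
  rewrite ler_pdivrMl ?mR_gt0// mulrA ler_pdivlMr// mulrC; apply: le_trans h6 _.
  by rewrite ler_peMr ?ler1n// ler0n.
have HN := tnormP (k n).
have rT : restr setT beta = beta by apply/funext => p; rewrite restr_in.
have eps0 : 0 <= tnorm (k n) beta.
  by rewrite -rT; apply: (N_ge0 HN (S := S)).
have [a5 ae ab iba ia5] := m_arith (ltn0Sn n) eps0 (ltW tn).
rewrite -/a -/b in a5 ae ab iba ia5.
set eps := tnorm (k n) beta in eps0 ae.
have iap : 0 < a^-1 by rewrite invr_gt0.
have ibp : 0 < b^-1 by rewrite invr_gt0.
have Mk i := @Mfam_k _ _ _ _ _ _ choiceP i n.
have F2 := Ffam2_k choiceP n0.
have high_ev f A : high_weight n.+1 f ->
    `|ev S beta x f A| <= 2 * mass (tnorm (k n)) S beta b^-1 A.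
  case=> -[i0 Hi0] H; have fC r : r \in S -> `|pairing f (x r)| <= 2.
    by move=> rS; apply: le_trans (f1 r _ _ rS Hi0) _; rewrite ler1n.
  rewrite /mass mulrDr; case: H => [uf|[i [ni Lf Wf]]].
    apply: le_trans (ev_unit HN sS S3 w Bx ee A _ uf fC) _ => //.
    by rewrite lerDl !mulr_ge0 ?(ltW ibp)// sumr_ge0// => r _; exact: (weights_ge0 r w).
  rewrite mulrA; apply: (ev_one_exception HN sS S3 w) => //.
    by rewrite divr_ge0// ltW.
  by move=> r r'; exact: high Wf.
(* Index n+1 gives 2/a on every block, hence theta = 1/a; larger indices satisfy the better bound
   with 1/b. *)
have H3 n' i fs t A : (n < i)%N -> okavg m s l Phi (Ln m M Phi n') i fs ->
  ev_bounded m s l Phi (tnorm (k n)) S beta x 2 a^-1 n' -> convexS S A ->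
  `|ev S beta x (tail t (avg i fs)) A| <= 2 * mass (tnorm (k n)) S beta a^-1 A.
  move=> ni /okavg_Ln_Li ok _ _.
  have Lf := Li_tail mgt1 t (Li_avg mgt1 ok).
  have Wf := weighted_tail mgt1 t (okavg_weighted mgt1 ok).
  move: ni; rewrite leq_eqVlt => /orP[/eqP ni|ni].
    apply: (@le_trans _ _ (2 / a * \sum_(r <- S | r \in A) beta r)).
      apply: ev_le_const => // r rS; rewrite /a ni; apply: low Lf Wf => //.
      by rewrite -ni.
    rewrite -mulrA /mass; apply: ler_wpM2l => //; rewrite lerDr.
    exact: (N_ge0 HN (S := S)).
  apply: le_trans (high_ev _ A _) _; first by split; [exists i|right; exists i].
  apply: ler_wpM2l => //; rewrite /mass lerD2l; apply: ler_wpM2r => //.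
  by rewrite sumr_ge0// => r _; exact: (weights_ge0 r w).
have h1C r i f : r \in S -> Li i f -> `|pairing f (x r)| <= 2.
  by move=> rS Hf; apply: le_trans (f1 r _ _ rS Hf) _; rewrite ler1n.
have h2C r i f : (i <= n)%N -> r \in S -> Li i f -> weighted i f ->
    `|pairing f (x r)| <= 2 / (m i)%:R by move=> iN; apply: low; exact: leqW.
have BI n' := @basic_inequality _ _ _ _ _ mgt1 _ _ _ HN Mk F2 _ _ _ _ sS S3 w cx Bx ee
  mz mge5 2 a^-1 (ler0n _ 2) (ltW iap) h1C h2C H3 n'.
have cT : convexS S setT by [].
have sumT : \sum_(r <- S | r \in [set: nat]) beta r = 1.
  by have [_ _ <- _] := w; apply: eq_bigl => r; rewrite in_setT.
pose X := comb S beta x.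
have cX : c00 X by exact: comb_c00.
have pX f : pairing f X = ev S beta x f setT by exact: pairing_comb.
have BI' i f A : Li i f -> convexS S A ->
    `|ev S beta x f A| <= 2 * mass (tnorm (k n)) S beta a^-1 A.
  by case=> n' Hn cA; have := BI n' i f 0%N A Hn cA; rewrite tail0.
have totX i f : Li i f -> `|pairing f X| <= 2 * (eps + a^-1).
  by move=> Hf; rewrite pX; have := BI' i f _ Hf cT; rewrite /mass rT sumT mulr1.
have lowX i f : (i <= n)%N -> Li i f -> weighted i f ->
    `|pairing f X| <= 2 / (m i)%:R * (5 * eps + a^-1).
  move=> iN Lf Wf; rewrite pX; have [fs [kap [fE Hfs Mkap il]]] := Wf.
  have skap : sorted ltn kap by case: il.
  rewrite fE in Lf Wf *.
  have := @ev_low_weight _ _ _ _ _ mgt1 _ _ _ HN Mk F2 _ _ _ _ sS S3 w cx Bx ee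
    mz mge5 2 a^-1 (ler0n _ 2) (ltW iap) h2C i fs kap setT iN skap il Mkap Lf Wf.
  rewrite rT sumT mulr1; case=> // t tk; have [i' Hi'] := Hfs t.
  by apply: BI' Hi' _; apply: piece_convex.
(* The sum is [m i] times an average, which belongs to [L_i] because [i] is even; thus the factor
   1/m_i on the cut blocks cancels [m i]. On the pieces theta = 1/b is available, so that the bound
   remains small after normalization by 4a. *)
have highX i fs kap : (i <= n)%N -> ~~ odd i -> (0 < size fs)%N ->
    M i [set` kap] -> interlaced kap [seq supp f | f <- fs] ->
    (forall t, high_weight n.+1 (nth z0 fs t)) ->
    `|\sum_(f <- fs) pairing f X| <= 10 * eps + 2 * b^-1.
  move=> iN oi fs0 Mkap il Hfs.
  have skap : sorted ltn kap by case: il.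
  have mi : 0 < (m i)%:R :> R by exact: mR_gt0.
  have ok : okavg m s l Phi Li i fs.
    split=> //; last first.
      by rewrite /ok_list (negbTE oi) => t _; have [] := Hfs t.
    split; last by exists kap.
    move=> t; rewrite size_map => tf; rewrite (nth_map z0)//.
    by have [[i' /Li_c00[]]] := Hfs t.
  have Lf := Li_avg mgt1 ok; have Wf := okavg_weighted mgt1 ok.
  have E : \sum_(f <- fs) pairing f X = (m i)%:R * pairing (avg i fs) X.
    by rewrite /average_of pairing_avg// mulrA divff ?gt_eqF// mul1r.
  rewrite E normrM ger0_norm ?(ltW mi)// -ler_pdivlMl// pX.
  have := ev_split_le mgt1 sS w cx Bx setT skap il (c := 2)
    (fun r rS => h2C r i _ iN rS Lf Wf).
  move=> /le_trans; apply; rewrite ler_pM2l ?invr_gt0//.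
  have c3 := cut_le HN sS S3 w ee setT skap (Mk _ iN _ Mkap).
  have p2 := pieces_le HN e S3 w setT skap (Mk _ iN _ Mkap).
  have pm := pieces_mass (tnorm (k n)) e w (ltW ibp) setT skap.
  rewrite rT -/eps in c3 p2; rewrite sumT mulr1 in pm.
  apply: (@le_trans _ _ (\sum_(t < size kap)
     2 * mass (tnorm (k n)) S beta b^-1 (piece kap e setT t) + 2 * (3 * eps))).
    apply: lerD; first by apply: ler_sum => t _; apply: high_ev.
    by rewrite ler_pM2l.
  by rewrite -mulr_sumr; lra.
(* The norm is a supremum, so 1/2 is relaxed to 1/4. *)
have exg r : exists g, r \in S -> [/\ exists i, Li i g, 4^-1 <= pairing g (x r) &
    forall q, supp g q -> (r <= q < e r)%N].
  case: (boolP (r \in S)) => [rS|_]; last by exists z0.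
  have [_ _ Nz _ _] := zP r rS; rewrite -xE// in Nz.
  have lt4 : 4^-1 < N (x r) by apply: lt_le_trans Nz; lra.
  have [i [f [Hf fx]]] := normL_approx mgt1 (cx r) lt4.
  have [g [Hg gE gs]] := functional_in_block Hf (Bx r rS) (cx r).
  by exists g => _; split=> //; [exists i|rewrite gE ltW].
have [g gP] := choice exg.
pose ystar := avg n.+1 [seq g r | r <- S].
have S0 := weights_neq0 w.
have ok : okavg m s l Phi Li n.+1 [seq g r | r <- S].
  split.
  - by rewrite size_map; case: (S) S0.
  - rewrite -map_comp; split.
      move=> t; rewrite size_map => tS; rewrite (nth_map 0%N)//=.
      by have [[i /Li_c00[]]] := gP _ (mem_nth 0%N tS).
    exists S; split.
      by apply: (@iter_bracket_Mfam s l n.+1 0 isT) FS; exact: l_gt0 choiceP n.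
    apply: interlaced_intro; rewrite ?size_map//.
      move=> t q tS; rewrite (nth_map 0%N)//= => gq.
      by have [_ _ /(_ q gq) /andP[]] := gP _ (mem_nth 0%N tS).
    move=> t u q /andP[tu uS]; have tS := ltn_trans tu uS.
    rewrite (nth_map 0%N)//= => gq; have [_ _ /(_ q gq) /andP[_ h1]] := gP _ (mem_nth 0%N tS).
    apply: leq_trans h1 (ee _ _ (mem_nth 0%N tS) (mem_nth 0%N uS) _).
    by apply: sorted_nth_ltn; rewrite // tu.
  - rewrite /ok_list /= on /= => t; rewrite size_map => tS; rewrite (nth_map 0%N)//.
    by have [] := gP _ (mem_nth 0%N tS).
have Ly := Li_avg mgt1 ok; have Wy := okavg_weighted mgt1 ok.
rewrite -/ystar in Ly Wy.
pose sig := \sum_(r <- S) beta r * pairing (g r) (x r).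
have ysX : pairing ystar X = a^-1 * sig.
  rewrite /ystar /average_of pairing_avg// big_map; congr (_ * _).
  apply: eq_big_seq => r rS; have [_ _ gs] := gP r rS.
  by rewrite pX (ev_block beta sS rS Bx ee gs).
have sig4 : 4^-1 <= sig.
  have [_ _ b1 _] := w.
  rewrite -[leLHS]mul1r -[X in X * _ <= _]b1 mulr_suml /sig big_seq [leRHS]big_seq.
  apply: ler_sum => r rS; have [_ h4 _] := gP r rS.
  by apply: ler_wpM2l => //; exact: (weights_ge0 r w).
have sig0 : 0 < sig by apply: lt_le_trans sig4.
(* This normalizes [ystar] at [y]. As [sig >= 1/4], the factor is at most 4a, which the choice of
   [d] has anticipated. *)
pose c := a / sig.
have c0 : 0 < c by rewrite divr_gt0.
have c4 : c <= 4 * a.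
  by rewrite /c ler_pdivrMr// mulrAC ler_peMl ?(ltW ap)//; lra.
pose hi := \max_(r <- S) e r.
have ehi r : r \in S -> (e r <= hi)%N by move=> rS; exact: leq_bigmax_seq.
have bX : in_block p0 X hi.
  by apply: comb_block Bx => r rS; split; [have [] := Sge r rS|exact: ehi].
have nX : near d X.
  by apply: comb_near => // r rS; rewrite xE//; have [[]] := zP r rS.
pose y q := c * X q.
have py f : pairing f y = c * pairing f X by rewrite /y pairing_scale.
have pyn f B : `|pairing f X| <= B -> `|pairing f y| <= 4 * a * B.
  by move=> fB; rewrite py normrM ger0_norm ?(ltW c0)//; apply: ler_pM => //; exact: ltW.
exists y, ystar, hi; split.
  have := near_scale c nX; apply: near_le; rewrite ger0_norm ?(ltW c0)//.
  apply: (@le_trans _ _ (4 * a * d)); first by rewrite ler_pM2r.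
  by rewrite /d mulrC divfK// gt_eqF// mulr_gt0.
split.
- split; first exact: c00_scale.
  by move=> q; rewrite /y mulf_eq0 negb_or => /andP[_]; exact: bX.
- split=> //.
  + move=> q; rewrite /supp /= => yq.
    have [r [rS gr]] : exists r, r \in S /\ g r q != 0.
      apply: contrapT => H; move: yq => /eqP; apply.
      rewrite /ystar /average_of big_map big1_seq ?mulr0// => r /andP[_ rS].
      by apply/eqP/negP => /negP ?; apply: H; exists r.
    have [_ _ /(_ q gr) /andP[q1 q2]] := gP r rS; have [p0r _] := Sge r rS.
    by rewrite (leq_trans p0r q1) (leq_trans q2 (ehi r rS)).
  + by rewrite py ysX /c -[a / sig * _]mulrA mulrA; field; rewrite !gt_eqF.
  + by move=> q; exact: weighted_le Wy.
- move=> i f Hf; apply: le_trans (pyn _ _ (totX i f Hf)) _.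
  have -> : 4 * a * (2 * (eps + a^-1)) = 8 * (a * eps) + 8 * (a * a^-1) by ring.
  by rewrite divff ?gt_eqF//; lra.
- move=> i f iN Lf Wf; apply: le_trans (pyn _ _ (lowX i f iN Lf Wf)) _.
  have -> : 4 * a * (2 / (m i)%:R * (5 * eps + a^-1)) =
     (40 * (a * eps) + 8 * (a * a^-1)) * (m i)%:R^-1 by ring.
  by apply: ler_wpM2r; [exact: mRV_ge0|rewrite divff ?gt_eqF//; lra].
- move=> i fs kap iN oi fs0 Mkap il Hfs.
  have := highX i fs kap iN oi fs0 Mkap il Hfs => h1.
  rewrite (eq_bigr (fun f => c * pairing f X)) => [|f _]; last exact: py.
  rewrite -mulr_sumr normrM ger0_norm ?(ltW c0)//.
  apply: (@le_trans _ _ (4 * a * (10 * eps + 2 * b^-1))).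
    by apply: ler_pM => //; exact: ltW.
  have -> : 4 * a * (10 * eps + 2 * b^-1) = 40 * (a * eps) + 8 * (a * b^-1) by ring.
  lra.
Qed.

End James.

(** * Dependent sequences *)

Lemma filter_convex_iota (P : pred nat) D :
  (forall a b c, (a < b < c)%N -> (c < D)%N -> P a -> P c -> P b) ->
  exists a d, [seq q <- iota 0 D | P q] = iota a d /\ ((0 < d)%N -> (a + d <= D)%N).
Proof.
elim: D => [|D IH] H; first by exists 0%N, 0%N.
have [|a [d [E ad]]] := IH; first by move=> a b c abc cD; apply: H abc (ltnW cD).
rewrite -addn1 iotaD filter_cat E add0n /=; case: ifP => PD; last first.
  by exists a, d; rewrite cats0; split=> // d0; rewrite addn1 leqW// ad.
case: d E ad => [|d] E ad; first by exists D, 1%N; split=> //; rewrite addn1.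
exists a, d.+2; split; last first.
  by move=> _; rewrite addn1 addnS ltnS; exact: ad.
have -> : D = (a + d.+1)%N; last by rewrite -[d.+2]addn1 iotaD.
have aD := ad isT; apply/eqP; rewrite eqn_leq aD andbT leqNgt; apply/negP => lt.
have memP q : q \in iota a d.+1 -> P q by rewrite -E mem_filter => /andP[].
have Pa : P a by apply: memP; rewrite mem_iota leqnn addnS ltnS leq_addr.
have Pb : P (a + d.+1)%N.
  by apply: (H a _ D) => //; rewrite lt andbT addnS ltnS leq_addr.
have : (a + d.+1)%N \in iota a d.+1 by rewrite -E mem_filter Pb mem_iota.
by rewrite mem_iota ltnn andbF.
Qed.

(** Leibniz's estimate, obtained by removing the first term: the remaining sum has the opposite sign
    and at most the size of its own first term. *)
Lemma alt_sum_iota (R : realType) (c : nat -> R) a d :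
  (forall q, (a <= q < a + d)%N -> 0 <= c q) ->
  (forall q, (a <= q)%N -> (q.+1 < a + d)%N -> c q.+1 <= c q) ->
  exists V, \sum_(q <- iota a d) (-1) ^+ q * c q = (-1) ^+ a * V /\
    0 <= V /\ ((0 < d)%N -> V <= c a).
Proof.
elim: d a => [|d IH] a c0 cd; first by exists 0; rewrite big_nil mulr0.
have [||V [E [V0 Vc]]] := IH a.+1.
- by move=> q /andP[aq qd]; apply: c0; rewrite (ltnW aq) addnS.
- by move=> q aq qd; apply: cd; rewrite ?(ltnW aq)// addnS.
exists (c a - V); rewrite /= big_cons E exprS; split; first by ring.
have ca : 0 <= c a by apply: c0; rewrite leqnn addnS ltnS leq_addr.
suff : V <= c a by move=> h; split; [rewrite subr_ge0|move=> _; rewrite gerBl].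
case: d E Vc cd {IH c0} => [|d] E Vc cd; last first.
  by apply: le_trans (Vc isT) _; apply: cd => //; rewrite !addnS !ltnS leq_addr.
move: E; rewrite big_nil => /esym/eqP.
by rewrite mulf_eq0 expf_eq0 oppr_eq0 oner_eq0 andbF /= => /eqP ->.
Qed.

(** This is what decreasing coefficients and intervals of blocks are for: cancellation leaves at
    most the first coefficient of the interval. *)
Lemma alt_sum_convex (R : realType) (S : seq nat) (beta : nat -> R) (P : pred nat) B :
  sorted ltn S -> convex_weights S beta -> 0 <= B ->
  (forall a b c, a \in S -> b \in S -> c \in S -> (a < b < c)%N -> P a -> P c -> P b) ->
  (forall r, r \in S -> P r -> beta r <= B) ->
  `|\sum_(r <- S | P r) (-1) ^+ index r S * beta r| <= B.
Proof.
move=> sS w B0 cP PB; have uS := sorted_uniq ltn_trans ltnn sS.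
rewrite (big_nth 0%N) /index_iota subn0 -big_filter.
have [|a [d [E ad]]] := @filter_convex_iota (fun q => P (nth 0%N S q)) (size S).
  move=> a b c /andP[ab bc] cS; have bS := ltn_trans bc cS.
  apply: cP; rewrite ?mem_nth// ?(ltn_trans ab)//.
  by rewrite !sorted_nth_ltn// ?ab ?bc.
rewrite E; have sub q : q \in iota a d -> (q < size S)%N /\ P (nth 0%N S q).
  by rewrite -E mem_filter mem_iota => /andP[].
rewrite (eq_big_seq (fun q => (-1) ^+ q * beta (nth 0%N S q))); last first.
  by move=> q /sub[qS _]; rewrite index_uniq.
case: d E ad sub => [|d] E ad sub; first by rewrite big_nil normr0.
have [||V [-> [V0 /(_ isT) VB]]] := @alt_sum_iota _ (fun q => beta (nth 0%N S q)) a d.+1.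
- by move=> q _; exact: weights_ge0 w.
- move=> q aq qd; have qS : (q.+1 < size S)%N := leq_trans qd (ad isT).
  have [_ _ _ dec] := w; apply: dec; rewrite ?mem_nth// ?(ltnW qS)//.
  by apply/ltnW/sorted_nth_ltn; rewrite // ltnSn.
have [aS Pa] : (a < size S)%N /\ P (nth 0%N S a).
  by apply: sub; rewrite mem_iota leqnn addnS ltnS leq_addr.
rewrite normrM normrX normrN1 expr1n mul1r ger0_norm//.
by apply: le_trans VB _; apply: PB => //; exact: mem_nth.
Qed.

Lemma sum_le_size (R : realType) (I : eqType) (L : seq I) (F : I -> R) B :
  (forall t, t \in L -> F t <= B) -> \sum_(t <- L) F t <= (size L)%:R * B.
Proof.
elim: L => [|t L IH] H; first by rewrite big_nil mul0r.
rewrite big_cons /= -natr1 mulrDl mul1r addrC; apply: lerD; last exact: H (mem_head _ _).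
by apply: IH => t' t'L; apply: H; rewrite inE t'L orbT.
Qed.

Lemma index_sorted_ltn (S : seq nat) r r' : sorted ltn S ->
  r \in S -> r' \in S -> (r < r')%N -> (index r S < index r' S)%N.
Proof.
move=> sS rS r'S rr'; rewrite ltnNge; apply/negP.
rewrite leq_eqVlt => /orP[/eqP ji|ji].
  by move: rr'; rewrite -(nth_index 0%N rS) -ji nth_index// ltnn.
have := sorted_nth_ltn sS (i := index r' S) (j := index r S).
by rewrite ji index_mem rS !nth_index// => /(_ isT); rewrite ltnNge ltnW.
Qed.

Lemma or5_le (R : realType) (e1 e2 e3 e4 e5 : bool) (c : R) : 0 <= c ->
  (if [|| e1, e2, e3, e4 | e5] then c else 0) <= (if e1 then c else 0) +
  ((if e2 then c else 0) + ((if e3 then c else 0) + ((if e4 then c else 0) +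
   (if e5 then c else 0)))).
Proof. by case: e1; case: e2; case: e3; case: e4; case: e5 => /=; lra. Qed.

Lemma special_arith (R : realType) (p q : R) : 0 <= p -> 0 <= q ->
  64 * (q + p) + (q + (100 * q + 64 * p)) <= 256 * (q + p).
Proof. lra. Qed.

Lemma index_cases q u : q != 0%N -> q != u.-1 -> q != u -> ~~ (q.+1 < u)%N -> (u < q)%N.
Proof. lia. Qed.

Section Special.
Variables (R : realType) (tnorm : nat -> (nat -> R) -> R) (m k s l : nat -> nat).
Variable Phi : seq (nat -> R) -> nat.
Hypothesis tnormP : forall n, is_implicit_norm n (tnorm n).
Hypothesis choiceP : valid_choice tnorm m k s l.
Hypothesis codingP : is_coding m (Mfam s l) Phi.
Local Notation M := (Mfam s l).
Local Notation Ln := (@Ln R m M Phi).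
Local Notation avg := (@average_of R m).
Local Notation Li := (@Li R m s l Phi).
Local Notation weighted := (@weighted R m s l Phi).
Local Notation G := (@G R m M).
Local Notation N := (@normL R m M Phi).
Local Notation z0 := (fun=> 0 : R).
Implicit Types (f g v : nat -> R).

Let mgt1 := m_gt1 choiceP.
Let mge5 := m_ge5 choiceP.
Let mz := m0 choiceP.

Variable n : nat.
Hypothesis n_even : ~~ odd n.
Hypothesis n_gt0 : (0 < n)%N.

Variables (S : seq nat) (beta : nat -> R) (y : nat -> nat -> R) (e w : nat -> nat).
Variable ys : seq (nat -> R).
Hypothesis sc : special_comb tnorm m k s n S beta.
Hypothesis S3 : forall r, r \in S -> (3 <= r)%N.
Hypothesis szys : size ys = size S.
Hypothesis y_c00 : forall r, c00 (y r).
Hypothesis y_exact : forall r, r \in S ->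
  exact m s l Phi (w r).-1 r (y r) (nth z0 ys (index r S)) (e r).
Hypothesis e_le : forall r r', r \in S -> r' \in S -> (r < r')%N -> (e r <= r')%N.
Hypothesis w_gt : forall r, r \in S -> (n.+2 < w r)%N.
Hypothesis w_inj : forall r r', r \in S -> r' \in S -> w r = w r' -> r = r'.
Hypothesis w_first : forall r, r \in S -> index r S = 0%N -> w r = (n.+2).*2.
Hypothesis w_Phi : forall r, r \in S -> (0 < index r S)%N ->
  w r = Phi (take (index r S) ys).
Hypothesis G_ys : forall q, (0 < q <= size S)%N -> G (take q ys).

Let sS : sorted ltn S. Proof. by case: sc. Qed.
Let bw : convex_weights S beta. Proof. by case: sc. Qed.
Let uS : uniq S. Proof. exact: (sorted_uniq ltn_trans ltnn sS). Qed.
Let beta_ge0 r : 0 <= beta r. Proof. exact: weights_ge0 bw. Qed.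

Definition alt_vec r : nat -> R := fun p => (-1) ^+ index r S * y r p.
Local Notation x := alt_vec.
Local Notation a := ((m n.+1)%:R : R).
Local Notation b := ((m n.+2)%:R : R).
Local Notation tn := (tnorm (k n)).

Let ap : 0 < a. Proof. exact: mR_gt0. Qed.
Let bp : 0 < b. Proof. exact: mR_gt0. Qed.

Let w_pred r : r \in S -> (w r).-1.+1 = w r.
Proof. by move=> /w_gt h; rewrite prednK// (leq_trans _ h). Qed.

Lemma alt_vec_c00 r : c00 (x r). Proof. exact: c00_scale. Qed.

Lemma pairing_alt_vec f r : pairing f (x r) = (-1) ^+ index r S * pairing f (y r).
Proof. exact: pairing_scale. Qed.

Lemma norm_pairing_alt_vec f r : `|pairing f (x r)| = `|pairing f (y r)|.
Proof. by rewrite pairing_alt_vec normrM normrX normrN1 expr1n mul1r. Qed.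

Lemma y_block r : r \in S -> in_block r (y r) (e r).
Proof. by move=> /y_exact[[]]. Qed.

Lemma alt_vec_block r : r \in S -> in_block r (x r) (e r).
Proof. by move=> rS p; rewrite mulf_eq0 negb_or => /andP[_]; exact: y_block. Qed.

Lemma y_bound r i f : r \in S -> Li i f -> `|pairing f (y r)| <= 16.
Proof. by move=> /y_exact[_ _ + _ _] => h /h. Qed.

Lemma y_low r i f : r \in S -> (i < w r)%N -> Li i f -> weighted i f ->
  `|pairing f (y r)| <= 16 / (m i)%:R.
Proof.
move=> rS iw; have [_ _ _ h _] := y_exact rS; apply: h.
by rewrite -ltnS w_pred.
Qed.

Lemma y_high r fs kap i : r \in S -> (i < w r)%N -> ~~ odd i -> (0 < size fs)%N ->
  M i [set` kap] -> interlaced kap [seq supp f | f <- fs] ->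
  (forall t, high_weight m s l Phi (w r) (nth z0 fs t)) ->
  `|\sum_(f <- fs) pairing f (y r)| <= 16 / b.
Proof.
move=> rS iw oi fs0 Mk il H; have [_ _ _ _ h] := y_exact rS.
have {h} := h i fs kap; rewrite w_pred// -ltnS w_pred// => h.
apply: le_trans (h iw oi fs0 Mk il H) _.
rewrite ler_pM2l// lef_pV2 ?posrE ?mR_gt0// ler_nat (m_le choiceP)//.
exact: ltnW (w_gt rS).
Qed.

(** The case of a one-term list, with marker 1 in M_0. *)
Lemma y_high1 r i f : r \in S -> (w r < i)%N -> Li i f -> weighted i f ->
  `|pairing f (y r)| <= 16 / b.
Proof.
move=> rS wi Lf Wf; have := @y_high r [:: f] [:: 1%N] 0%N rS.
rewrite big_seq1; apply=> //.
- by apply: leq_ltn_trans (w_gt rS).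
- by rewrite setof_seq1; exact: (Mfam_one s l 0).
- split=> // -[|t]//= p _ fp; split=> //.
  by have [_] := Li_c00 mgt1 Lf; apply.
- case=> [|t] /=; first by split; [exists i|right; exists i].
  split; first by exists 0%N; rewrite nth_nil; exact: Li_zero.
  right; exists (w r).+1; rewrite nth_nil; split=> //; first exact: Li_zero.
  exact: weighted_zero.
Qed.

Lemma ystar_supp r q : r \in S -> supp (nth z0 ys (index r S)) q -> (r <= q < e r)%N.
Proof. by move=> /y_exact[_ [_ + _ _] _ _ _]; apply. Qed.

Lemma ystar_nth t q : (t < size S)%N -> supp (nth z0 ys t) q ->
  (nth 0%N S t <= q < e (nth 0%N S t))%N.
Proof.
by move=> tS; have := @ystar_supp (nth 0%N S t) q (mem_nth 0%N tS); rewrite index_uniq.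
Qed.

Lemma ystar_y r : r \in S -> pairing (nth z0 ys (index r S)) (y r) = 1.
Proof. by move=> /y_exact[_ [_ _ + _] _ _ _]. Qed.

Lemma disjoint_pairing f r r' : r \in S -> r' \in S -> r != r' ->
  (forall q, supp f q -> (r' <= q < e r')%N) -> pairing f (y r) = 0.
Proof.
move=> rS r'S ne fr'; apply: pairing_eq0 => p xp.
have /andP[h1 h2] := y_block rS xp.
apply/eqP/negP => /negP /fr' /andP[h3 h4]; move: ne; rewrite neq_ltn => /orP[h|h].
  by have := leq_trans h2 (leq_trans (e_le rS r'S h) h3); rewrite ltnn.
by have := leq_trans h4 (leq_trans (e_le r'S rS h) h1); rewrite ltnn.
Qed.

Lemma ystar_y0 t r : (t < size S)%N -> r \in S -> t != index r S ->
  pairing (nth z0 ys t) (y r) = 0.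
Proof.
move=> tS rS ne; apply: (@disjoint_pairing _ r (nth 0%N S t)) => //.
- exact: mem_nth.
- by apply/eqP => rE; move: ne; rewrite rE index_uniq// eqxx.
- by move=> q; exact: ystar_nth.
Qed.

Lemma special_functional : Li n.+1 (avg n.+1 ys).
Proof.
have [_ _ FS _] := sc.
have S0 : (0 < size S)%N by case: (S) (weights_neq0 bw).
have Lys t : (t < size S)%N -> Li (w (nth 0%N S t)) (nth z0 ys t).
  move=> tS; have tm := mem_nth 0%N tS; have [_ [+ _ _ _] _ _ _] := y_exact tm.
  by rewrite w_pred// index_uniq.
apply: Li_avg => //; split; first by rewrite szys.
  split=> [t|].
    rewrite size_map szys => tS; rewrite (nth_map z0) ?szys//.
    by have /(Li_c00 mgt1)[] := Lys t tS.
  exists S; split.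
    by apply: (@iter_bracket_Mfam s l n.+1 0 isT) FS; exact: l_gt0 choiceP n.
  apply: interlaced_intro; rewrite ?size_map ?szys//.
    by move=> t q tS; rewrite (nth_map z0) ?szys// => /(ystar_nth tS) /andP[].
  move=> t u q /andP[tu uS']; have tS := ltn_trans tu uS'.
  rewrite (nth_map z0) ?szys// => /(ystar_nth tS) /andP[_ h1].
  apply: leq_trans h1 (e_le (mem_nth 0%N tS) (mem_nth 0%N uS') _).
  by apply: sorted_nth_ltn; rewrite // tu.
rewrite /ok_list /= n_even /=; split.
  (* The first index is 2k with k = n+2, the least k beyond n+1. *)
  exists n.+2 => //; have := Lys 0%N S0; rewrite w_first ?mem_nth//.
  by rewrite index_uniq.
move=> t /andP[t0]; rewrite szys => tS; split; first by apply: G_ys; rewrite t0 ltnW.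
by have := Lys t tS; rewrite w_Phi ?mem_nth// index_uniq.
Qed.

Lemma special_value : pairing (avg n.+1 ys) (comb S beta y) = a^-1.
Proof.
have [_ _ b1 _] := bw.
rewrite /average_of pairing_avg; last exact: comb_c00.
rewrite -[RHS]mulr1; congr (_ * _); rewrite -b1 (big_nth z0) [RHS](big_nth 0%N) szys.
apply: eq_big_nat => t /andP[_ tS]; rewrite pairing_comb//.
rewrite (ev_block beta sS (mem_nth 0%N tS) y_block e_le); last by move=> q; exact: ystar_nth.
by rewrite -{2}(index_uniq 0%N tS uS) ystar_y ?mulr1// mem_nth.
Qed.

Section SpecialEstimate.
Variables (n' : nat) (fs : seq (nat -> R)).
Hypothesis fs_ok : okavg m s l Phi (Ln n') n.+1 fs.
Local Notation d := (size fs).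
Variable kap : seq nat.
Hypothesis kapM : M n.+1 [set` kap].
Hypothesis kap_il : interlaced kap [seq supp f | f <- fs].
Variable u : nat.
Hypothesis match_u : forall t, (t < u)%N ->
  [/\ (t < d)%N, (t < size S)%N & nth z0 fs t = nth z0 ys t].
Hypothesis mismatch_u : ~ [/\ (u < d)%N, (u < size S)%N & nth z0 fs u = nth z0 ys u].
Variable k0 : nat.
Hypothesis k0_gt : (n.+1 < k0)%N.
Hypothesis k0_first : Ln n' k0.*2 (nth z0 fs 0).
Hypothesis fs_special : forall t, (0 < t < d)%N ->
  G (take t fs) /\ Ln n' (Phi (take t fs)) (nth z0 fs t).

(** The index under which the t-th term enters the special functional. Only the first one is not a
    value of [Phi], hence the separate treatment of t = 0 below. *)
Definition fw t := if t == 0%N then k0.*2 else Phi (take t fs).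

Lemma fw_Ln t : (t < d)%N -> Ln n' (fw t) (nth z0 fs t).
Proof.
rewrite /fw; case: t => [|t] td //=; by have [] := fs_special (t := t.+1) td.
Qed.

Lemma fw_Li t : Li (if (t < d)%N then fw t else 0%N) (nth z0 fs t).
Proof.
case: ltnP => td; first by exists n'; exact: fw_Ln.
by rewrite nth_default//; exact: Li_zero.
Qed.

Lemma Phi_inj fs1 fs2 : G fs1 -> G fs2 -> Phi fs1 = Phi fs2 -> fs1 = fs2.
Proof. by move=> G1 G2; case: codingP => inj _ _; apply: inj; rewrite in_setE. Qed.

Lemma fw_inj t t' : (0 < t < d)%N -> (0 < t' < d)%N -> fw t = fw t' -> t = t'.
Proof.
move=> h h'; have [g _] := fs_special h; have [g' _] := fs_special h'.
move: h h' => /andP[t0 td] /andP[t'0 t'd].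
rewrite /fw !gtn_eqF// => /(Phi_inj g g') /(congr1 size).
by rewrite !size_takel// ltnW.
Qed.

Lemma fw0_gt : (n.+1 < fw 0)%N.
Proof. by rewrite /fw /= -addnn (leq_trans k0_gt)// leq_addl. Qed.

Let ftm p : seq nat := [seq t <- iota 0 d | p t].

Lemma fw_uniq (p : pred nat) : uniq [seq fw t | t <- ftm (fun t => (0 < t)%N && p t)].
Proof.
rewrite map_inj_in_uniq; first exact/filter_uniq/iota_uniq.
move=> t t'; rewrite !mem_filter !mem_iota /= !add0n.
move=> /andP[/andP[t0 _] td] /andP[/andP[t'0 _] t'd].
by apply: fw_inj; rewrite ?t0 ?t'0.
Qed.

(** Past the first term, indices are codes of prefixes of different lengths, hence distinct, and 0,
    ..., n+1 are [n.+2] values. *)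
Lemma low_count (p : pred nat) :
  (size (ftm (fun t => (0 < t)%N && (p t && (fw t <= n.+1)%N))) <= n.+2)%N.
Proof.
rewrite -(size_map fw) -[leqRHS](size_iota 0); apply: uniq_leq_size; first exact: fw_uniq.
move=> _ /mapP[t + ->]; rewrite mem_filter => /andP[/and3P[_ _ h] _].
by rewrite mem_iota leq0n add0n ltnS.
Qed.

(** The distinct codes give a geometric sum 2/b, and the uncoded first index accounts for another
    1/b. *)
Lemma middle_sum (p : pred nat) :
  \sum_(t <- iota 0 d | p t && (n.+1 < fw t)%N) (m (fw t))%:R^-1 <= 3 * b^-1 :> R.
Proof.
have mV0 j : 0 <= (m j)%:R^-1 :> R by exact: mRV_ge0.
rewrite (bigID (fun t => (0 < t)%N)) /= addrC.
have -> : 3 * b^-1 = b^-1 + 2 * b^-1 by ring.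
apply: lerD.
  apply: sum_at_most_one; [exact: iota_uniq|exact: mV0| |].
    move=> t _ /andP[/andP[_ h] _]; rewrite lef_pV2 ?posrE ?mR_gt0// ler_nat.
    exact: (m_le choiceP).
  by move=> t t' _ _ _ /andP[_]; rewrite -leqNgt leqn0 => /eqP ->; rewrite ltn0.
rewrite (eq_bigl (fun t => (0 < t)%N && (p t && (n.+1 < fw t)%N))); last first.
  by move=> t; rewrite andbC.
rewrite -big_filter -/(ftm _) -(big_map fw xpredT (fun j => (m j)%:R^-1)).
apply: (sum_mV choiceP); first exact: fw_uniq.
by move=> _ /mapP[t + ->]; rewrite mem_filter => /andP[/and3P[]].
Qed.

(* Past the first mismatch the indices of f_t and of y_r are different, since
   Phi is injective. *)
Lemma fw_neq r t : r \in S -> (u < index r S)%N -> (u <= t < d)%N ->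
  (u = 0%N -> w r <> fw 0) -> fw t <> w r.
Proof.
move=> rS ur /andP[ut td] w0; case: (posnP t) => [t0|t0].
  by rewrite t0 => /esym; apply: w0; apply/eqP; rewrite -leqn0 -t0.
have [g _] : G (take t fs) /\ Ln n' (Phi (take t fs)) (nth z0 fs t).
  by apply: fs_special; rewrite t0.
have q0 : (0 < index r S)%N by apply: leq_ltn_trans ur.
have qS : (index r S < size S)%N by rewrite index_mem.
rewrite w_Phi// /fw gtn_eqF// => /(Phi_inj g (G_ys _)) E.
have {}E := E; have qle : (0 < index r S <= size S)%N by rewrite q0 ltnW.
have {}E := E qle; have tq : t = index r S.
  by have := congr1 size E; rewrite !size_takel ?szys// ltnW.
apply: mismatch_u; split; [exact: leq_ltn_trans ut td|exact: ltn_trans qS|].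
by rewrite -(nth_take z0 ur ys) -E nth_take// tq.
Qed.

(** For t >= u the term f_t lies beyond a point of the support of f_(u-1), which is a functional of
    the dependent sequence and nonzero; so it lies beyond the block of [r] if the rank of [r] is
    less than u-1. The block of rank u-1 may extend past the support of its functional, which is why
    it is excluded. *)
Lemma matched_value r t : r \in S -> ((index r S).+1 < u)%N -> t != index r S ->
  pairing (nth z0 fs t) (y r) = 0.
Proof.
move=> rS qu tq; have [tu|ut] := ltnP t u.
  by have [_ tS ->] := match_u tu; exact: ystar_y0.
have [td|td] := ltnP t d; last first.
  by rewrite nth_default//; apply: pairing_eq0.
have u0 : (0 < u)%N by apply: leq_ltn_trans qu.
have uu : (u.-1 < u)%N by rewrite prednK.
have [u1d u1S u1E] := match_u uu.
have r1S := mem_nth 0%N u1S.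
have [p fp] : supp (nth z0 fs u.-1) !=set0.
  rewrite u1E; apply: supp_neq0 => y0; have := ystar_y r1S.
  rewrite index_uniq// y0 pairing_eq0// => /eqP.
  by rewrite eq_sym oner_eq0.
have /andP[p1 _] : (nth 0%N S u.-1 <= p < e (nth 0%N S u.-1))%N.
  by apply: ystar_nth => //; rewrite -u1E.
have qu1 : (index r S < u.-1)%N by rewrite -ltnS prednK.
have rr1 : (r < nth 0%N S u.-1)%N.
  by rewrite -{1}(nth_index 0%N rS); apply: sorted_nth_ltn; rewrite // qu1.
have ep : (e r <= p)%N by apply: leq_trans p1; exact: e_le.
have [_ _ H1 H2] := interlacedP kap_il; rewrite size_map in H1 H2.
have pk : (p < nth 0%N kap t)%N.
  apply: (H2 u.-1); first by rewrite td andbT; exact: leq_trans uu ut.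
  by rewrite (nth_map z0).
apply: pairing_eq0 => q yq; apply/eqP/negP => /negP fq.
have /andP[_ qe] := y_block rS yq.
have kq : (nth 0%N kap t <= q)%N by apply: H1 => //; rewrite (nth_map z0).
by have := leq_trans qe (leq_trans ep (leq_trans (ltnW pk) kq)); rewrite ltnn.
Qed.

Lemma before_value r t : r \in S -> (u <= index r S)%N -> (t < u)%N ->
  pairing (nth z0 fs t) (y r) = 0.
Proof.
move=> rS uq tu; have [_ tS ->] := match_u tu; apply: ystar_y0 => //.
by rewrite neq_ltn (leq_trans tu uq).
Qed.

(** Unit vectors and indices above [w r] are bounded together by exactness; indices between n+1 and
    [w r] one by one, with a geometric sum; the index [w r] itself is ruled out by [fw_neq]. *)
Lemma after_value r : r \in S -> (u < index r S)%N -> (u = 0%N -> w r <> fw 0) ->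
  `|\sum_(t <- iota 0 d | (u <= t)%N && (n.+1 < fw t)%N) pairing (nth z0 fs t) (y r)|
    <= 64 * b^-1.
Proof.
move=> rS ur w0; have d0 : (0 < d)%N by case: fs_ok.
pose hb t := `[< pm_units (nth z0 fs t) >] || (w r < fw t)%N.
rewrite (bigID hb) /=; apply: le_trans (ler_normD _ _) _.
have -> : 64 * b^-1 = 16 * b^-1 + 16 * (3 * b^-1) by ring.
apply: lerD.
  pose P t := ((u <= t)%N && (n.+1 < fw t)%N) && hb t.
  (* The other terms are replaced by 0 and not removed, so that the markers [kap] still fit. *)
  pose gs := [seq if P t then nth z0 fs t else z0 | t <- iota 0 d].
  have nthgs t : (t < d)%N -> nth z0 gs t = if P t then nth z0 fs t else z0.
    by move=> td; rewrite (nth_map 0%N) ?size_iota// nth_iota.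
  have -> : \sum_(t <- iota 0 d | P t) pairing (nth z0 fs t) (y r) =
      \sum_(g <- gs) pairing g (y r).
    rewrite /gs big_map big_mkcond; apply: eq_bigr => t _; case: ifP => // _.
    by rewrite pairing_eq0.
  (* Exactness is stated for even indices, and n+1 is odd; the markers are therefore viewed in the
     larger family M_(n+2). *)
  apply: (@y_high r gs kap n.+2) => //.
  - exact: w_gt.
  - by rewrite /= negbK.
  - by rewrite size_map size_iota.
  - by case: choiceP => _ H _ _ _; have [_ h] := H n.+1; apply: h; have [h' _] := H n.+1; exact: h'.
  - apply: (interlaced_subsets kap_il); first by rewrite !size_map size_iota.
    move=> t; have [td|td] := ltnP t d; last by rewrite nth_default// !size_map size_iota.
    rewrite !(nth_map z0) ?size_map ?size_iota//; rewrite nthgs//; case: ifP => // _ q.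
      by [].
    by rewrite /supp /= eqxx.
  - have hz : high_weight m s l Phi (w r) z0.
      split; first by exists 0%N; exact: Li_zero.
      by right; exists (w r).+1; split=> //; [exact: Li_zero|exact: weighted_zero].
    move=> t; have [td|td] := ltnP t d; last by rewrite nth_default// size_map size_iota.
    rewrite nthgs//; case: ifP => // /andP[_ ht].
    have Lf := fw_Li t; rewrite td in Lf.
    split; first by exists (fw t).
    have [uf|Wf] := Li_cases mgt1 Lf; first by left.
    case/orP: ht => [/asboolP|ht]; first by left.
    by right; exists (fw t).
apply: le_trans (ler_norm_sum _ _ _) _.
apply: (@le_trans _ _ (16 * \sum_(t <- iota 0 d |
    ((u <= t)%N && ~~ hb t) && (n.+1 < fw t)%N) (m (fw t))%:R^-1)); last first.
  by rewrite ler_pM2l//; exact: middle_sum.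
rewrite mulr_sumr (eq_bigl (fun t => ((u <= t)%N && ~~ hb t) && (n.+1 < fw t)%N)); last first.
  by move=> t; rewrite andbAC.
rewrite big_seq_cond [leRHS]big_seq_cond; apply: ler_sum => t.
rewrite mem_iota add0n /= => /andP[td /andP[/andP[ut]]].
rewrite negb_or -leqNgt => /andP[/asboolPn nu fwle] _.
have Lf := fw_Li t; rewrite td in Lf.
have [//|Wf] := Li_cases mgt1 Lf; apply: y_low Lf Wf => //.
rewrite ltn_neqAle fwle andbT; apply/eqP; apply: fw_neq => //.
by rewrite ut.
Qed.

Lemma tail_pairing tt f r : (tt <= r)%N -> r \in S ->
  pairing (tail tt f) (y r) = pairing f (y r).
Proof.
move=> tr rS; apply: pairing_eq => q /(y_block rS) /andP[rq _].
by rewrite tailE (leq_trans tr rq).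
Qed.

Lemma tail_pairing0 tt f r : (e r <= tt)%N -> r \in S -> pairing (tail tt f) (y r) = 0.
Proof.
move=> tr rS; apply: pairing_eq0 => q /(y_block rS) /andP[_ qe].
by rewrite tailE leqNgt (leq_trans qe tr).
Qed.

(** 256 reproduces itself. The unmatched terms of index at most n+1 are fewer than m_(n+1)/4 up to
    equality, so the induction hypothesis gives 64 for them ([U]). In the rest ([V]) the matched
    blocks cancel up to one norm of [beta]; five kinds of exceptional blocks, at 20 = 16 + 16/4
    each, cost 100 norms; all others cost 64 theta. *)
Lemma special_bound tt A : convexS S A ->
  ev_bounded m s l Phi tn S beta x 256 b^-1 n' ->
  `|ev S beta x (tail tt (avg n.+1 fs)) A| <= 256 * mass tn S beta b^-1 A.
Proof.
move=> cA IH.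
pose T0 t := (0 < t)%N && ((u <= t)%N && (fw t <= n.+1)%N).
pose T1 t := (u <= t)%N && (n.+1 < fw t)%N.
pose pf t r := pairing (tail tt (nth z0 fs t)) (x r).
pose U r := a^-1 * \sum_(t <- iota 0 d | T0 t) pf t r.
pose V r := a^-1 * \sum_(t <- iota 0 d | ~~ T0 t) pf t r.
have Lfs : Li n.+1 (tail tt (avg n.+1 fs)).
  by apply/Li_tail/Li_avg => //; exact: okavg_Ln_Li fs_ok.
have UV r : pairing (tail tt (avg n.+1 fs)) (x r) = U r + V r.
  rewrite /tail avg_restr /average_of pairing_avg; last exact: alt_vec_c00.
  rewrite -mulrDr -(bigID T0 xpredT (fun t => pf t r)) big_map (big_nth z0) /=.
  by rewrite /index_iota subn0.
have Lt t : exists i, Li i (nth z0 fs t) by eexists; exact: fw_Li.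
have pf16 t r : r \in S -> `|pf t r| <= 16.
  move=> rS; rewrite /pf norm_pairing_alt_vec; have [i Hi] := Lt t.
  by apply: y_bound rS (Li_tail mgt1 tt Hi).
have cnt : a^-1 * (size [seq t <- iota 0 d | T0 t])%:R <= 4^-1.
  rewrite ler_pdivrMl// mulrC ler_pdivlMl// -natrM ler_nat.
  apply: leq_trans (m_linear choiceP (j := n.+1) _); last by [].
  by rewrite leq_mul2l /=; exact: low_count.
have sumT0 (F : nat -> R) B : 0 <= B -> (forall t, (t < d)%N -> T0 t -> `|F t| <= B) ->
    a^-1 * \sum_(t <- iota 0 d | T0 t) `|F t| <= 4^-1 * B.
  move=> B0 FB; apply: (@le_trans _ _ (a^-1 * (size [seq t <- iota 0 d | T0 t])%:R * B)).
    rewrite -mulrA ler_pM2l ?invr_gt0// -big_filter; apply: sum_le_size => t.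
    by rewrite mem_filter mem_iota add0n /= => /andP[Tt td]; exact: FB.
  by apply: ler_wpM2r.
have NA0 : 0 <= tn (restr A beta) by exact: (N_ge0 (tnormP (k n)) S3 bw).
have sg0 : 0 <= \sum_(r <- S | r \in A) beta r by rewrite sumr_ge0.
have ibp : 0 < b^-1 by rewrite invr_gt0.
have mass0 : 0 <= mass tn S beta b^-1 A by rewrite addr_ge0// mulr_ge0// ltW.
have boundU : `|\sum_(r <- S | r \in A) beta r * U r| <= 64 * mass tn S beta b^-1 A.
  have -> : \sum_(r <- S | r \in A) beta r * U r =
      a^-1 * \sum_(t <- iota 0 d | T0 t) ev S beta x (tail tt (nth z0 fs t)) A.
    rewrite /U /ev exchange_big mulr_sumr /=; apply: eq_bigr => r _.
    by rewrite mulrCA mulr_sumr.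
  rewrite normrM ger0_norm ?mRV_ge0//.
  apply: (@le_trans _ _ (a^-1 *
      \sum_(t <- iota 0 d | T0 t) `|ev S beta x (tail tt (nth z0 fs t)) A|)).
    by rewrite ler_pM2l ?invr_gt0//; exact: ler_norm_sum.
  have := @sumT0 (fun t => ev S beta x (tail tt (nth z0 fs t)) A)
    (256 * mass tn S beta b^-1 A) _ _.
  have -> : 64 * mass tn S beta b^-1 A = 4^-1 * (256 * mass tn S beta b^-1 A).
    by rewrite mulrA; congr (_ * _); lra.
  apply; first by rewrite mulr_ge0.
  by move=> t td _; apply: IH (fw_Ln td) cA.
have V20 r : r \in S -> `|V r| <= 20.
  move=> rS; have -> : V r = pairing (tail tt (avg n.+1 fs)) (x r) - U r.
    by rewrite UV addrC addKr.
  apply: le_trans (ler_normB _ _) _; have -> : 20 = 16 + 4^-1 * 16 :> R by lra.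
  apply: lerD.
    by rewrite norm_pairing_alt_vec; apply: y_bound rS Lfs.
  rewrite /U normrM ger0_norm ?mRV_ge0//.
  apply: (@le_trans _ _ (a^-1 * \sum_(t <- iota 0 d | T0 t) `|pf t r|)).
    by rewrite ler_pM2l ?invr_gt0//; exact: ler_norm_sum.
  by apply: sumT0 => // t _ _; exact: pf16.
have notT0 t : T1 t -> ~~ T0 t.
  by move=> /andP[_ h]; rewrite /T0 [(fw t <= _)%N]leqNgt h !andbF.
have notT0' t : (u <= t)%N -> ~~ T0 t -> T1 t.
  move=> ut; rewrite /T0 /T1 ut /=; case: (posnP t) => [->|t0] /=; first by rewrite fw0_gt.
  by rewrite -ltnNge.
(* [Mt] holds for blocks beyond the truncation on which f follows the dependent sequence. Each
   exception occurs at most once: [E1], [E2], [E3] fix the rank; [E4] fixes [w r], the uncoded index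
   [fw 0] possibly being one of the [w r]; [E5] is the block around the truncation point. *)
pose Mt r := [&& (tt <= r)%N, (0 < index r S)%N & ((index r S).+1 < u)%N].
pose E1 r := index r S == 0%N.
pose E2 r := index r S == u.-1.
pose E3 r := index r S == u.
pose E4 r := (u == 0%N) && (w r == fw 0).
pose E5 r := (r < tt < e r)%N.
pose Ex r := [|| E1 r, E2 r, E3 r, E4 r | E5 r].
have VMt r : r \in S -> Mt r -> V r = a^-1 * (-1) ^+ index r S.
  move=> rS /and3P[tr q0 qu]; rewrite /V; congr (_ * _).
  have qu' : (index r S < u)%N := ltnW qu.
  have [qd qS qE] := match_u qu'.
  rewrite big_mkcond (bigD1_seq (index r S)) ?mem_iota ?iota_uniq//=.
  have -> : T0 (index r S) = false by rewrite /T0 [(u <= _)%N]leqNgt qu' andbF.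
  rewrite /= big1 ?addr0.
    by rewrite /pf pairing_alt_vec tail_pairing// qE ystar_y// mulr1.
  move=> t tq; case: ifP => // _; rewrite /pf pairing_alt_vec tail_pairing//.
  by rewrite matched_value// mulr0.
have Vrest r : r \in S -> ~~ Mt r -> ~~ Ex r -> `|V r| <= 64 * b^-1.
  move=> rS nM; rewrite /Ex !negb_or => /and5P[n1 n2 n3 n4 n5].
  have b64 : 0 <= 64 * b^-1 by rewrite mulr_ge0// ltW.
  have [er|er] := leqP (e r) tt.
    rewrite /V big1 ?mulr0 ?normr0// => t _.
    by rewrite /pf pairing_alt_vec tail_pairing0// mulr0.
  have tr : (tt <= r)%N by rewrite leqNgt; apply/negP => rt; move: n5; rewrite /E5 rt er.
  have ur : (u < index r S)%N.
    apply: index_cases => //; apply/negP => qu; move: nM; rewrite /Mt tr qu andbT /=.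
    by rewrite lt0n n1.
  have w0 : u = 0%N -> w r <> fw 0.
    by move=> u0 wE; move: n4; rewrite /E4 u0 wE !eqxx.
  have -> : V r = a^-1 * ((-1) ^+ index r S *
      \sum_(t <- iota 0 d | T1 t) pairing (nth z0 fs t) (y r)).
    rewrite /V; congr (_ * _); rewrite mulr_sumr.
    rewrite big_mkcond [RHS]big_mkcond; apply: eq_bigr => t _.
    have pfE : pf t r = (-1) ^+ index r S * pairing (nth z0 fs t) (y r).
      by rewrite /pf pairing_alt_vec tail_pairing.
    have [ut|tu] := leqP u t.
      case: (boolP (T1 t)) => [/notT0 -> //|nT1].
      by case: ifP => // /(notT0' _ ut) T1t; rewrite T1t in nT1.
    have -> : T1 t = false by rewrite /T1 [(u <= t)%N]leqNgt tu.
    by case: ifP => // _; rewrite pfE before_value ?mulr0// ltnW.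
  rewrite !normrM normrX normrN1 expr1n mul1r ger0_norm ?mRV_ge0//.
  apply: le_trans (after_value rS ur w0); rewrite ler_piMl//; exact: mRV_le1.
have BNA r : A r -> beta r <= tn (restr A beta).
  exact: (N_ge (tnormP (k n)) S3 bw).
have boundMt : `|\sum_(r <- S | (r \in A) && Mt r) beta r * V r| <= tn (restr A beta).
  have -> : \sum_(r <- S | (r \in A) && Mt r) beta r * V r =
      a^-1 * \sum_(r <- S | (r \in A) && Mt r) (-1) ^+ index r S * beta r.
    rewrite mulr_sumr big_seq_cond [RHS]big_seq_cond.
    by apply: eq_bigr => r /and3P[rS _ Mr]; rewrite VMt//; ring.
  rewrite normrM ger0_norm ?mRV_ge0//.
  apply: (@le_trans _ _ (a^-1 * tn (restr A beta))); last by rewrite ler_piMl// mRV_le1.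
  rewrite ler_pM2l ?invr_gt0//; apply: alt_sum_convex => //.
    move=> r1 r2 r3 S1 S2' S3' r123 /andP[/set_mem A1 M1] /andP[/set_mem A3 M3].
    rewrite (mem_set (cA _ _ _ S1 S2' S3' r123 A1 A3)) /=.
    move: r123 M1 M3 => /andP[r12 r23] /and3P[t1 _ _] /and3P[_ _ u3].
    apply/and3P; split; first exact: leq_trans t1 (ltnW r12).
      by apply: leq_ltn_trans (index_sorted_ltn sS S1 S2' r12).
    apply: leq_ltn_trans u3; apply: ltnW.
    by rewrite ltnS; apply: index_sorted_ltn.
  by move=> r rS /andP[/set_mem rA _]; exact: BNA.
have one (E : pred nat) :
    (forall r r', r \in S -> r' \in S -> E r -> E r' -> (r < r')%N -> False) ->
    \sum_(r <- S | (r \in A) && E r) beta r <= tn (restr A beta).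
  move=> HE; apply: (N_le3 (tnormP (k n)) sS S3 bw) => [r _ /andP[/set_mem//]|].
  by move=> r r' rS r'S /andP[_ Er] /andP[_ Er']; exact: HE.
have idx c : \sum_(r <- S | (r \in A) && (index r S == c)) beta r <= tn (restr A beta).
  apply: one => r r' rS r'S /eqP r1 /eqP r2 rr'.
  by have := index_sorted_ltn sS rS r'S rr'; rewrite r1 r2 ltnn.
have b1 : \sum_(r <- S | (r \in A) && E1 r) beta r <= tn (restr A beta) by exact: idx.
have b2 : \sum_(r <- S | (r \in A) && E2 r) beta r <= tn (restr A beta) by exact: idx.
have b3 : \sum_(r <- S | (r \in A) && E3 r) beta r <= tn (restr A beta) by exact: idx.
have b4 : \sum_(r <- S | (r \in A) && E4 r) beta r <= tn (restr A beta).
  apply: one => r r' rS r'S /andP[_ /eqP r1] /andP[_ /eqP r2] rr'.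
  by have := w_inj rS r'S (etrans r1 (esym r2)) => rE; move: rr'; rewrite rE ltnn.
have b5 : \sum_(r <- S | (r \in A) && E5 r) beta r <= tn (restr A beta).
  apply: one => r r' rS r'S /andP[_ h1] /andP[h2 _] rr'.
  by have := leq_trans h1 (leq_trans (e_le rS r'S rr') (ltnW h2)); rewrite ltnn.
have boundEx : \sum_(r <- S | (r \in A) && Ex r) beta r <= 5 * tn (restr A beta).
  apply: (@le_trans _ _ (\sum_(r <- S | (r \in A) && E1 r) beta r +
    (\sum_(r <- S | (r \in A) && E2 r) beta r + (\sum_(r <- S | (r \in A) && E3 r) beta r +
    (\sum_(r <- S | (r \in A) && E4 r) beta r + \sum_(r <- S | (r \in A) && E5 r) beta r))))).
    rewrite !(big_mkcond (fun r => _ && _)) -!big_split /=; apply: ler_sum => r _.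
    by rewrite /Ex; case: (r \in A) => //=; exact: or5_le.
  have -> : 5 * tn (restr A beta) = tn (restr A beta) + (tn (restr A beta) +
      (tn (restr A beta) + (tn (restr A beta) + tn (restr A beta)))) by ring.
  by do 4 apply: lerD => //.
have boundV : `|\sum_(r <- S | (r \in A) && ~~ Mt r) beta r * V r| <=
    100 * tn (restr A beta) + 64 * b^-1 * \sum_(r <- S | r \in A) beta r.
  apply: le_trans (ler_norm_sum _ _ _) _.
  apply: (@le_trans _ _ (\sum_(r <- S | (r \in A) && Ex r) 20 * beta r +
      \sum_(r <- S | r \in A) 64 * b^-1 * beta r)).
    rewrite [leLHS]big_mkcond [X in _ <= X + _]big_mkcond [X in _ <= _ + X]big_mkcond -big_split /=.
    rewrite big_seq [leRHS]big_seq; apply: ler_sum => r rS.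
    have b64 : 0 <= 64 * b^-1 * beta r by rewrite !mulr_ge0// ltW.
    have b20 : 0 <= 20 * beta r by rewrite mulr_ge0.
    case: (r \in A) => //=.
    case: (boolP (Mt r)) => /= [_|nM].
      by case: ifP => _; [rewrite addr_ge0|rewrite add0r].
    rewrite normrM ger0_norm// [beta r * _]mulrC.
    case: (boolP (Ex r)) => [_|nE].
      by rewrite -[leLHS]addr0; apply: lerD => //; apply: ler_wpM2r => //; exact: V20.
    by rewrite add0r; apply: ler_wpM2r => //; exact: Vrest.
  rewrite -!mulr_sumr; apply: lerD => //.
  have -> : 100 = 20 * 5 :> R by lra.
  by rewrite -mulrA ler_pM2l.
have -> : ev S beta x (tail tt (avg n.+1 fs)) A =
    \sum_(r <- S | r \in A) beta r * U r +
    (\sum_(r <- S | (r \in A) && Mt r) beta r * V r +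
     \sum_(r <- S | (r \in A) && ~~ Mt r) beta r * V r).
  by rewrite -bigID -big_split /=; apply: eq_bigr => r _; rewrite UV mulrDr.
apply: le_trans (ler_normD _ _) _.
apply: (@le_trans _ _ (64 * mass tn S beta b^-1 A + (tn (restr A beta) +
  (100 * tn (restr A beta) + 64 * b^-1 * \sum_(r <- S | r \in A) beta r)))).
  apply: lerD => //; apply: le_trans (ler_normD _ _) _; exact: lerD.
have bs0 : 0 <= b^-1 * \sum_(r <- S | r \in A) beta r by rewrite mulr_ge0// ltW.
by rewrite /mass -mulrA; exact: special_arith.
Qed.

End SpecialEstimate.
Lemma special_bound_okavg n' fs tt A : okavg m s l Phi (Ln n') n.+1 fs ->
  convexS S A -> ev_bounded m s l Phi tn S beta x 256 b^-1 n' ->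
  `|ev S beta x (tail tt (avg n.+1 fs)) A| <= 256 * mass tn S beta b^-1 A.
Proof.
move=> ok cA IH; have [_ /admissible_interlaced[kap [kapM il]] ol] := ok.
move: ol; rewrite /ok_list /= n_even => -[[k0 k0n Hk0] Hsp].
pose mism t := `[< ~ [/\ (t < size fs)%N, (t < size S)%N & nth z0 fs t = nth z0 ys t] >].
have exm : exists t, mism t by exists (size fs); apply/asboolP; rewrite ltnn => -[].
case: (ex_minnP exm) => u /asboolP mu minu.
apply: (special_bound ok kapM il (u := u) _ mu k0n Hk0 Hsp) => // t tu.
by apply: contrapT => nt; have := minu t; rewrite leqNgt tu /mism asboolT// => /(_ isT).
Qed.

Lemma alternating_norm : N (comb S beta x) <= 512 / b.
Proof.
have [_ _ _ tnb] := sc; have HN := tnormP (k n).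
have ibp : 0 < b^-1 by rewrite invr_gt0.
have H1 r i f : r \in S -> Li i f -> `|pairing f (x r)| <= 16.
  by move=> rS Hf; rewrite norm_pairing_alt_vec; exact: y_bound Hf.
have c16 : 16 <= 256 :> R by lra.
have H1' r i f : r \in S -> Li i f -> `|pairing f (x r)| <= 256.
  by move=> rS Hf; apply: le_trans (H1 _ _ _ rS Hf) c16.
have low r i f : (i < w r)%N -> r \in S -> Li i f -> weighted i f ->
    `|pairing f (x r)| <= 16 / (m i)%:R.
  by move=> iw rS Lf Wf; rewrite norm_pairing_alt_vec; exact: y_low Lf Wf.
have H2 r i f : (i <= n)%N -> r \in S -> Li i f -> weighted i f ->
    `|pairing f (x r)| <= 256 / (m i)%:R.
  move=> iN rS Lf Wf; apply: le_trans (low r i f _ rS Lf Wf) _.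
    by apply: leq_ltn_trans iN _; apply: ltn_trans (w_gt rS); rewrite ltnS.
  by apply: ler_wpM2r => //; exact: mRV_ge0.
have H3 n' i fs t A : (n < i)%N -> okavg m s l Phi (Ln n') i fs ->
    ev_bounded m s l Phi tn S beta x 256 b^-1 n' -> convexS S A ->
    `|ev S beta x (tail t (avg i fs)) A| <= 256 * mass tn S beta b^-1 A.
  rewrite leq_eqVlt => /orP[/eqP <-|ni] ok IH cA; first exact: special_bound_okavg ok cA IH.
  have ok' := okavg_Ln_Li ok.
  have Lf := Li_tail mgt1 t (Li_avg mgt1 ok').
  have Wf := weighted_tail mgt1 t (okavg_weighted mgt1 ok').
  have b16 : 0 <= 16 / b by rewrite divr_ge0// ltW.
  (* An index below or above [w r] is small on the r-th vector; since [w] is injective, [i] can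
     equal [w r] for one block only. *)
  have bnd r : r \in S -> i != w r -> `|pairing (tail t (avg i fs)) (x r)| <= 16 / b.
    move=> rS; rewrite neq_ltn => /orP[iw|wi].
      apply: le_trans (low r i _ iw rS Lf Wf) _; rewrite ler_pM2l// lef_pV2 ?posrE ?mR_gt0//.
      by rewrite ler_nat (m_le choiceP).
    by rewrite norm_pairing_alt_vec; exact: y_high1 Lf Wf.
  apply: (@le_trans _ _ (16 * tn (restr A beta) + 16 / b * \sum_(r <- S | r \in A) beta r)).
    apply: (ev_one_exception HN sS S3 bw) => //.
      by move=> r rS; exact: H1 Lf.
    move=> r r' rS r'S rr'; have [iw|iw] := eqVneq i (w r); last by left; exact: bnd.
    right; apply: bnd => //; apply/eqP => iw'.
    by have rE := w_inj rS r'S (etrans (esym iw) iw'); move: rr'; rewrite rE ltnn.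
  rewrite -mulrA -mulrDr; apply: ler_wpM2r => //.
  exact: (mass_ge0 HN S3 bw (ltW ibp)).
have BI n' := @basic_inequality _ _ _ _ _ mgt1 _ _ _ HN
  (fun i => @Mfam_k _ _ _ _ _ _ choiceP i n) (Ffam2_k choiceP n_gt0) _ _ _ _ sS S3 bw
  alt_vec_c00 alt_vec_block e_le mz mge5 256 b^-1 (ler0n _ 256) (ltW ibp) H1' H2 H3 n'.
apply: (normL_le mgt1); first exact: comb_c00 alt_vec_c00.
move=> i f [n' Hn]; rewrite pairing_comb; last exact: alt_vec_c00.
apply: le_trans (ler_norm _) _.
have cT : convexS S setT by [].
have := BI n' i f 0%N setT Hn cT; rewrite tail0; move/le_trans; apply.
have sumT : \sum_(r <- S | r \in [set: nat]) beta r = 1.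
  by have [_ _ <- _] := bw; apply: eq_bigl => r; rewrite in_setT.
rewrite /mass sumT mulr1; have -> : restr setT beta = beta.
  by apply/funext => p; rewrite restr_in.
have tb : tn beta <= b^-1.
  apply: le_trans (ltW tnb) _; rewrite -exprVn exprSr ler_piMl ?(ltW ibp)//.
  by rewrite exprn_ile1 ?(ltW ibp)// mRV_le1.
have -> : 512 / b = 256 * (b^-1 + b^-1) by lra.
by rewrite ler_pM2l// lerD2r.
Qed.

End Special.

Section Dependent.
Variables (R : realType) (tnorm : nat -> (nat -> R) -> R) (m k s l : nat -> nat).
Variable Phi : seq (nat -> R) -> nat.
Hypothesis tnormP : forall n, is_implicit_norm n (tnorm n).
Hypothesis choiceP : valid_choice tnorm m k s l.
Hypothesis codingP : is_coding m (Mfam s l) Phi.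
Local Notation M := (Mfam s l).
Local Notation Li := (@Li R m s l Phi).
Local Notation G := (@G R m M).
Local Notation N := (@normL R m M Phi).
Local Notation z0 := (fun=> 0 : R).
Let mgt1 := m_gt1 choiceP.

Variable near : bool -> R -> (nat -> R) -> Prop.
Hypothesis near_c00 : forall c d x, near c d x -> c00 x.
Hypothesis near_lin : forall c d d' a x y, near c d x -> near c d' y ->
  near c (`|a| * d + d') (fun p => a * x p + y p).
Hypothesis near_zero : forall c, near c 0 z0.
Hypothesis near_le : forall c d d' x, d <= d' -> near c d x -> near c d' x.
Hypothesis near_exact : forall c n p d, odd n -> 0 < d ->
  exists y ystar hi, near c d y /\ exact m s l Phi n p y ystar hi.

(* [v] and [v'] collect the terms of even and of odd rank of one dependent
   sequence: the special functional along it is large on the sum, and the signs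
   alternate in the difference. *)
Lemma dependent_pair n d : ~~ odd n -> (0 < n)%N -> 0 < d -> exists v v',
  [/\ near false d v, near true d v',
      (m n.+1)%:R^-1 <= N (fun p => v p + v' p) &
      N (fun p => v p - v' p) <= 512 / (m n.+2)%:R].
Proof.
move=> en n0 d0.
pose T := ((nat -> R) * (nat -> R) * nat * nat)%type.
pose tau0 : T := (z0, z0, 0%N, 0%N).
(* The construction has to be total, and on arbitrary histories [Phi] may be odd or too small; 2 is
   a default value that the selected history never takes. *)
pose wt (h : seq T) := if h is [::] then (n.+2).*2 else
  let w0 := Phi [seq z.1.1.2 | z <- h] in if odd w0 || (w0 < 2)%N then 2%N else w0.
pose P (h : seq T) r (z : T) := [/\ near (odd (size h)) d z.1.1.1,
  exact m s l Phi (wt h).-1 r z.1.1.1 z.1.1.2 z.1.2 & z.2 = wt h].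
have wt2 h : ~~ odd (wt h) /\ (1 < wt h)%N.
  rewrite /wt; case: h => [|z h]; first by rewrite odd_double; split=> //; rewrite -addnn; lia.
  case: (boolP (_ || _)) => [_|/norP[hodd]]; first by [].
  by rewrite -leqNgt.
have exP (hr : seq T * nat) : exists z, P hr.1 hr.2 z.
  case: hr => h r /=; have [hodd w1] := wt2 h.
  have ow : odd (wt h).-1 by move: hodd w1; case: (wt h) => //= q; rewrite negbK.
  have [y [ystar [hi [ny ey]]]] := near_exact (odd (size h)) r ow d0.
  by exists (y, ystar, hi, wt h).
have [nx nxP] := choice exP.
have [S [beta [h [sc szh Sge hE hhi]]]] := selection choiceP tau0
  (fun h r => nx (h, r)) (fun z => z.1.2) 0 n.
have [sS bw FS tn] := sc; have uS := sorted_uniq ltn_trans ltnn sS.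
pose z r := nth tau0 h (index r S).
pose y r := if r \in S then (z r).1.1.1 else z0.
pose e r := (z r).1.2.
pose w r := (z r).2.
pose ys := [seq u.1.1.2 | u <- h].
have szys : size ys = size S by rewrite size_map.
have zP r : r \in S -> P (take (index r S) h) r (z r).
  by move=> rS; rewrite /z hE ?index_mem// nth_index//; exact: nxP (_, _).
have idxS r : r \in S -> (index r S < size S)%N by rewrite index_mem.
have ysE r : r \in S -> nth z0 ys (index r S) = (z r).1.1.2.
  by move=> rS; rewrite (nth_map tau0) ?szh ?idxS.
have wE r : r \in S -> w r = wt (take (index r S) h) by move=> /zP[].
have yex r : r \in S -> exact m s l Phi (w r).-1 r (y r) (nth z0 ys (index r S)) (e r).
  by move=> rS; rewrite ysE// wE// /y rS; have [] := zP r rS.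
have ee r r' : r \in S -> r' \in S -> (r < r')%N -> (e r <= r')%N.
  move=> rS r'S rr'.
  by have [_] := @history_le T tau0 (fun z => z.1.2) S h r r' sS hhi rS r'S rr'.
have wpos r : r \in S -> (w r).-1.+1 = w r.
  by move=> rS; rewrite wE//; have [_ h1] := wt2 (take (index r S) h); rewrite prednK// ltnW.
have ysL r : r \in S -> Li (w r) (nth z0 ys (index r S)).
  by move=> rS; have [_ [+ _ _ _] _ _ _] := yex r rS; rewrite wpos.
have ysK r : r \in S -> K m M (w r) (nth z0 ys (index r S)).
  move=> rS; apply: (Li_K (ysL r rS)) => ys0.
  have [_ [_ _ + _] _ _ _] := yex r rS; rewrite ys0 pairing_eq0// => /eqP.
  by rewrite eq_sym oner_eq0.
have Snth t : (t < size S)%N -> nth 0%N S t \in S by exact: mem_nth.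
have Gys q : (0 < q <= size S)%N -> G (take q ys).
  move=> /andP[q0 qS]; have szt : size (take q ys) = q by rewrite size_takel// szys.
  split; rewrite szt//.
    move=> t tq; have tS := leq_trans tq qS; exists (w (nth 0%N S t)).
    by rewrite nth_take//; have := ysK _ (Snth t tS); rewrite index_uniq.
  move=> t u p p' /andP[tu uq]; have uS' := leq_trans uq qS; have tS := ltn_trans tu uS'.
  rewrite !nth_take//; last exact: ltn_trans uq.
  have [_ [_ + _ _] _ _ _] := yex _ (Snth t tS); rewrite index_uniq// => h1 /h1 /andP[_ pe].
  have [_ [_ + _ _] _ _ _] := yex _ (Snth u uS'); rewrite index_uniq// => h2 /h2 /andP[rp' _].
  apply: leq_trans pe (leq_trans (ee _ _ (Snth t tS) (Snth u uS') _) rp').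
  by apply: sorted_nth_ltn; rewrite // tu.
have S0 : (0 < size S)%N by case: (S) (weights_neq0 bw).
have w_first r : r \in S -> index r S = 0%N -> w r = (n.+2).*2.
  by move=> rS r0; rewrite wE// r0 take0.
have [_ Phi_even Phi_gt] := codingP.
(* Every prefix contains the first functional, which lies in [K] of index 2(n+2) and is no unit
   vector, its coordinates being less than 1; so the growth condition on [Phi] applies. It also
   separates the first index from all codes. *)
have Phi_big q : (0 < q <= size S)%N -> ((n.+2).*2 < Phi (take q ys))%N.
  move=> hq; have /andP[q0 qS] := hq.
  have szt : size (take q ys) = q by rewrite size_takel// szys.
  have r0 := Snth 0%N S0.
  have i0 : index (nth 0%N S 0) S = 0%N by rewrite index_uniq.
  apply: (Phi_gt _ _ 0%N (Gys q hq)); first by rewrite szt.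
    by rewrite nth_take// -(w_first _ r0 i0); have := ysK _ r0; rewrite i0.
  rewrite nth_take// => -[p _ H].
  have [_ [_ _ _ h4] _ _ _] := yex _ r0; move: (h4 p); rewrite i0.
  have -> : `|nth z0 ys 0 p| = 1.
    by case: H => ->; rewrite /unitv eqxx ?normrN normr1.
  by rewrite leNgt invf_lt1 ?mR_gt0// ltr1n mgt1.
have w_Phi r : r \in S -> (0 < index r S)%N -> w r = Phi (take (index r S) ys).
  move=> rS q0; have qS := idxS r rS.
  have hq : (0 < index r S <= size S)%N by rewrite q0 ltnW.
  have big := Phi_big _ hq; have ev := Phi_even _ (Gys _ hq).
  rewrite wE// /wt; have st : size (take (index r S) h) = index r S.
    by rewrite size_takel// szh ltnW.
  have -> : take (index r S) ys = [seq u.1.1.2 | u <- take (index r S) h] by rewrite map_take.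
  rewrite -map_take in big ev.
  case: (take (index r S) h) st big ev => [|z1 h1] st big ev; first by rewrite -st in q0.
  rewrite (negbTE ev) /= ltnNge (leq_trans _ big)//.
have w_gt r : r \in S -> (n.+2 < w r)%N.
  move=> rS; case: (posnP (index r S)) => [r0|r0].
    by rewrite w_first// -addnn -[X in (X < _)%N]addn0 ltn_add2l.
  rewrite w_Phi//; apply: leq_ltn_trans (Phi_big _ _); first by rewrite -addnn leq_addr.
  by rewrite r0 ltnW// idxS.
have index_inj' r r' : r \in S -> r' \in S -> index r S = index r' S -> r = r'.
  by move=> rS r'S E; rewrite -(nth_index 0%N rS) E nth_index.
have w_inj r r' : r \in S -> r' \in S -> w r = w r' -> r = r'.
  move=> rS r'S E; apply: index_inj' => //.
  have hq q : q \in S -> (0 < index q S)%N -> (0 < index q S <= size S)%N.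
    by move=> qS q0; rewrite q0 ltnW// idxS.
  case: (posnP (index r S)) => [r0|r0]; case: (posnP (index r' S)) => [r'0|r'0].
  - by rewrite r0 r'0.
  - have := Phi_big _ (hq _ r'S r'0); rewrite -w_Phi// -E w_first// ltnn//.
  - have := Phi_big _ (hq _ rS r0); rewrite -w_Phi// E w_first// ltnn//.
  - move: E; rewrite !w_Phi// => /(Phi_inj codingP (Gys _ (hq _ rS r0)) (Gys _ (hq _ r'S r'0))).
    by move=> /(congr1 size); rewrite !size_takel ?szys// ltnW// idxS.
have ycx r : c00 (y r).
  by rewrite /y; case: ifPn => [/zP[/near_c00]//|_]; exact: c00_zero.
have S3 r : r \in S -> (3 <= r)%N by move=> /Sge[].
pose part c r := if odd (index r S) == c then y r else z0.
have ncomb c : near c d (comb S beta (part c)).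
  have := @near_comb R (near c) (near_lin (c := c)) (near_zero c) S beta d (part c).
  rewrite (weights_sum_norm bw) mul1r; apply => r rS; rewrite /part.
  case: eqP => [<-|_]; last by apply: near_le (near_zero c); exact: ltW.
  rewrite /y rS; have [+ _ _] := zP r rS.
  by rewrite size_takel// szh ltnW// idxS.
exists (comb S beta (part false)), (comb S beta (part true)); split.
- exact: ncomb.
- exact: ncomb.
- have -> : (fun p => comb S beta (part false) p + comb S beta (part true) p) = comb S beta y.
    apply/funext => p; rewrite /comb -big_split /=; apply: eq_bigr => r _.
    by rewrite /part; case: (odd _); rewrite /= ?mulr0 ?add0r ?addr0.
  have Ls := special_functional choiceP en sc szys yex ee w_gt w_first w_Phi Gys.
  have := normL_ge mgt1 (comb_c00 S beta ycx) Ls.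
  rewrite (special_value sc szys ycx yex ee) ger0_norm ?mRV_ge0//.
- have -> : (fun p => comb S beta (part false) p - comb S beta (part true) p) =
      comb S beta (alt_vec S y).
    apply/funext => p; rewrite /comb -sumrB /=; apply: eq_bigr => r _.
    rewrite /part /alt_vec -signr_odd.
    by case: (odd _); rewrite /= ?mulr0 ?subr0 ?sub0r ?expr0 ?expr1 ?mul1r ?mulN1r ?mulrN.
  exact: (alternating_norm tnormP choiceP codingP en n0 sc S3 szys ycx yex ee w_gt w_inj
    w_Phi Gys).
Qed.

End Dependent.

(** * Subspaces of the completion *)

Section Subspaces.
Variables (R : realType) (X : completeNormedModType R).
Implicit Types (Y W : set X) (x y z : X).

Lemma subspaceD Y x y : subspace_of_X Y -> Y x -> Y y -> Y (x + y).
Proof. by move=> [_ H] Yx Yy; rewrite -[x]scale1r; exact: H. Qed.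

Lemma subspaceZ Y a x : subspace_of_X Y -> Y x -> Y (a *: x).
Proof. by move=> [Y0 H] Yx; rewrite -[_ *: _]addr0; exact: H. Qed.

Lemma subspaceN Y x : subspace_of_X Y -> Y x -> Y (- x).
Proof. by move=> sY Yx; rewrite -scaleN1r; exact: subspaceZ. Qed.

(** Generators of the kernel together with one vector where [phi] does not vanish would span [Y]. *)
Lemma kernel_not_finite_dim Y (phi : X -> R) : subspace_of_X Y -> ~ finite_dim Y ->
  (forall a x y, phi (a *: x + y) = a * phi x + phi y) ->
  subspace_of_X (Y `&` [set x | phi x = 0]) /\ ~ finite_dim (Y `&` [set x | phi x = 0]).
Proof.
move=> sY nY lin; have phi0 : phi 0 = 0.
  by have := lin (-1) 0 0; rewrite scaler0 add0r mulN1r addNr.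
split.
  case: sY => Y0 H; split=> // a x y [Yx px] [Yy py]; split; first exact: H.
  by rewrite /= lin px py mulr0 addr0.
move=> [n [v E]]; apply: nY.
have [[y0 [Yy0 py0]]|H] := pselect (exists y, Y y /\ phi y <> 0); last first.
  exists n, v; rewrite -E; apply/seteqP; split=> [y Yy|y []//]; split=> //.
  by apply: contrapT => py; apply: H; exists y.
have vY i : Y (v i).
  have : [set \sum_(i < n) a i *: v i | a in [set: 'I_n -> R]] (v i).
    exists (fun j => (j == i)%:R) => //; rewrite (bigD1 i)//= eqxx scale1r.
    by rewrite big1 ?addr0// => j /negbTE ->; rewrite scale0r.
  by rewrite -E => -[].
exists n.+1, (fun i => if unlift ord0 i is Some j then v j else y0).
apply/seteqP; split=> [y Yy|_ [a _ <-]].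
  pose c := phi y / phi y0.
  have : (Y `&` [set x | phi x = 0]) (y - c *: y0).
    split; first by apply: subspaceD => //; apply: subspaceN => //; exact: subspaceZ.
    rewrite /= addrC -scaleNr lin mulNr /c divfK ?addNr//; exact/eqP.
  rewrite E => -[a _ aE].
  exists (fun i => if unlift ord0 i is Some j then a j else c) => //.
  rewrite big_ord_recl unlift_none.
  rewrite (eq_bigr (fun i => a i *: v i)) => [|i _]; last by rewrite liftK.
  by rewrite aE addrC subrK.
apply: (big_ind Y) => [|x y|i _]; first by case: sY.
  exact: subspaceD.
by apply: subspaceZ => //; case: unlift.
Qed.

Lemma kernels_nonzero Y (phi : nat -> X -> R) p : subspace_of_X Y -> ~ finite_dim Y ->
  (forall q a x y, phi q (a *: x + y) = a * phi q x + phi q y) ->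
  exists z, [/\ Y z, z != 0 & forall q, (q < p)%N -> phi q z = 0].
Proof.
move=> sY nY lin.
have [Y' [sY' nY' Y'E]] : exists Y', [/\ subspace_of_X Y', ~ finite_dim Y' &
    forall z, Y' z -> Y z /\ forall q, (q < p)%N -> phi q z = 0].
  elim: p => [|p [Y' [sY' nY' H]]]; first by exists Y.
  have [s' n'] := kernel_not_finite_dim sY' nY' (lin p).
  exists (Y' `&` [set x | phi p x = 0]); split=> // z [/H[Yz Hz] pz]; split=> // q.
  by rewrite ltnS leq_eqVlt => /orP[/eqP ->|/Hz].
apply: contrapT => H; apply: nY'; exists 0%N, (fun=> 0); apply/seteqP; split=> z.
  move=> Y'z; have [Yz Hz] := Y'E z Y'z.
  exists (fun=> 0) => //; rewrite big_ord0; apply/esym/eqP/negP => /negP z0.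
  by apply: H; exists z.
by move=> [a _ <-]; rewrite big_ord0; case: sY'.
Qed.

Lemma row_dependent n (A : 'M[R]_(n.+1, n)) : exists c : 'rV[R]_n.+1, c != 0 /\ c *m A = 0.
Proof.
have : kermx A != 0.
  rewrite -mxrank_eq0 mxrank_ker -lt0n subn_gt0.
  by apply: leq_ltn_trans (rank_leq_col A) _.
by move=> /rowV0Pn[c /sub_kermxP cA c0]; exists c.
Qed.

Lemma free_not_finite_dim Y (v : nat -> X) : (forall p, Y (v p)) ->
  (forall n (c : 'I_n -> R), \sum_(p < n) c p *: v p = 0 -> forall p, c p = 0) ->
  ~ finite_dim Y.
Proof.
move=> Yv free [n [w E]].
have exa (p : 'I_n.+1) : exists a : 'I_n -> R, \sum_(i < n) a i *: w i = v p.
  by have := Yv p; rewrite E => -[a _ aE]; exists a.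
have [f fE] := choice exa.
have [c [c0 cA]] := row_dependent (\matrix_(p < n.+1, i < n) f p i).
move: c0 => /eqP; apply; apply/rowP => p; rewrite mxE; move: p; apply: free.
rewrite (eq_bigr (fun p => \sum_(i < n) (c 0 p * f p i) *: w i)); last first.
  by move=> p _; rewrite -fE scaler_sumr; apply: eq_bigr => i _; rewrite scalerA.
rewrite exchange_big /= big1// => i _; rewrite -scaler_suml.
have := congr1 (fun B : 'rV[R]_n => B 0 i) cA; rewrite !mxE => H.
by rewrite -[RHS](scale0r (w i)) -{2}H; congr (_ *: _); apply: eq_bigr => p _; rewrite mxE.
Qed.

End Subspaces.

(** Multiplied by b, the claim is 514 < eps (b/a - 2), and b/a - 2 >= a because b/a >= a^2 >= 5a. *)
Lemma close_arith (R : realFieldType) (eps a b : R) :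
  0 < eps -> 5 <= a -> 1028 / eps < a -> a ^+ 3 <= b ->
  514 * b^-1 < eps * (a^-1 - 2 * b^-1).
Proof.
move=> e0 a5 ea ab; have a0 : 0 < a by lra.
have b0 : 0 < b by apply: lt_le_trans ab; rewrite exprn_gt0.
have {}ea : 1028 < eps * a by rewrite mulrC -ltr_pdivrMr.
have b2 : 5 * a <= a ^+ 2 by rewrite expr2; apply: ler_wpM2r => //; exact: ltW.
have -> : eps * (a^-1 - 2 * b^-1) = eps * (b / a - 2) / b.
  by field; rewrite !gt_eqF.
rewrite ltr_pM2r ?invr_gt0//.
have h : a ^+ 2 <= b / a by rewrite ler_pdivlMr// -exprSr.
have : eps * a <= eps * (b / a - 2) by apply: ler_wpM2l; [exact: ltW|lra].
by lra.
Qed.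

(** * Coordinates on the completion and closeness of its subspaces *)

Section Completion.
Variables (R : realType) (tnorm : nat -> (nat -> R) -> R) (m k s l : nat -> nat).
Variables (Phi : seq (nat -> R) -> nat) (X : completeNormedModType R).
Variable iota : (nat -> R) -> X.
Hypothesis tnormP : forall n, is_implicit_norm n (tnorm n).
Hypothesis choiceP : valid_choice tnorm m k s l.
Hypothesis codingP : is_coding m (Mfam s l) Phi.
Local Notation M := (Mfam s l).
Local Notation Li := (@Li R m s l Phi).
Local Notation N := (@normL R m M Phi).
Local Notation z0 := (fun=> 0 : R).
Hypothesis complP : is_completion N iota.
Let mgt1 := m_gt1 choiceP.

Lemma iota_lin a x y : c00 x -> c00 y ->
  iota (fun n => a * x n + y n) = a *: iota x + iota y.
Proof. by case: complP => H _ _; exact: H. Qed.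

Lemma iota_norm x : c00 x -> `|iota x| = N x.
Proof. by case: complP => _ H _; exact: H. Qed.

Lemma iota0 : iota z0 = 0.
Proof.
have := iota_lin (-1) (@c00_zero R) (@c00_zero R).
rewrite scaleN1r addNr => E; rewrite -[RHS]E; congr iota.
by apply/funext => p; rewrite mulr0 addr0.
Qed.

Lemma iota_sub x y : c00 x -> c00 y -> iota (fun n => x n - y n) = iota x - iota y.
Proof.
move=> cx cy; rewrite addrC -scaleN1r -iota_lin//; congr iota.
by apply/funext => p; rewrite mulN1r addrC.
Qed.

Lemma iota_add x y : c00 x -> c00 y -> iota (fun n => x n + y n) = iota x + iota y.
Proof.
move=> cx cy; rewrite -[iota x]scale1r -iota_lin//; congr iota.
by apply/funext => p; rewrite mul1r.
Qed.

Lemma iota_dense z (d : R) : 0 < d -> exists x, c00 x /\ `|iota x - z| < d.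
Proof.
move=> d0; have [_ _ dn] := complP.
have [||y [zd [x cx xy]]] := dn (ball z d).
- by exists z; exact: ballxx.
- exact: ball_open.
by exists x; split=> //; move: zd; rewrite -xy -ball_normE /= distrC.
Qed.

Lemma coord_le x p : c00 x -> `|x p| <= N x.
Proof.
move=> cx; have [->|p0] := posnP p; first by rewrite (c00_0 cx) normr0 -iota_norm.
rewrite -pairing_unitv//; apply: (normL_ge mgt1 cx (i := 0%N)); apply: Li_unit.
by exists p => //; left.
Qed.

(* The smallest 1-Lipschitz extension of x |-> x p; by density it is linear. *)
Definition coord p z : R := sup [set x p - `|iota x - z| | x in @c00 R].

Lemma coordP p z x : c00 x -> `|coord p z - x p| <= `|iota x - z|.
Proof.
move=> cx; have H x1 x2 : c00 x1 -> c00 x2 ->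
    x1 p - `|iota x1 - z| <= x2 p + `|iota x2 - z|.
  move=> c1 c2; have c12 : c00 (fun n => x1 n - x2 n).
    by apply: c00_add => //; exact: c00_opp.
  have h1 := coord_le p c12; rewrite -iota_norm// iota_sub// in h1.
  have h2 : `|iota x1 - iota x2| <= `|iota x1 - z| + `|iota x2 - z|.
    by rewrite [`|iota x2 - z|]distrC; exact: ler_distD.
  have := ler_norm (x1 p - x2 p); lra.
have ne : [set x p - `|iota x - z| | x in @c00 R] !=set0.
  by exists (x p - `|iota x - z|), x.
have h1 : coord p z <= x p + `|iota x - z|.
  by apply: ge_sup ne _ => _ [x1 c1 <-]; exact: H.
have h2 : x p - `|iota x - z| <= coord p z.
  apply: ub_le_sup; last by exists x.
  by exists (x p + `|iota x - z|) => _ [x1 c1 <-]; exact: H.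
by rewrite ler_norml; apply/andP; split; lra.
Qed.

Lemma coord_lin p a z z' : coord p (a *: z + z') = a * coord p z + coord p z'.
Proof.
apply/eqP; rewrite -subr_eq0 -normr_le0; apply/ler_addgt0Pr => eps e0; rewrite add0r.
pose d := eps / (2 * (`|a| + 1)).
have a1 : 0 < `|a| + 1 by rewrite ltr_wpDl.
have d0 : 0 < d by rewrite divr_gt0// mulr_gt0.
have [x [cx xz]] := iota_dense z d0; have [x' [cx' xz']] := iota_dense z' d0.
have cl := c00_lin a cx cx'.
have h1 := coordP p (a *: z + z') cl; rewrite iota_lin// in h1.
have h2 := coordP p z cx; have h3 := coordP p z' cx'.
have h4 : `|a *: iota x + iota x' - (a *: z + z')| <= `|a| * d + d.
  have -> : a *: iota x + iota x' - (a *: z + z') = a *: (iota x - z) + (iota x' - z').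
    by rewrite scalerBr opprD addrACA.
  apply: le_trans (ler_normD _ _) _; apply: lerD; last exact: ltW.
  by rewrite normrZ; apply: ler_wpM2l => //; exact: ltW.
have -> : coord p (a *: z + z') - (a * coord p z + coord p z') =
  (coord p (a *: z + z') - (a * x p + x' p)) - (a * (coord p z - x p) +
  (coord p z' - x' p)) by ring.
apply: le_trans (ler_normB _ _) _.
apply: (@le_trans _ _ ((`|a| * d + d) + (`|a| * d + d))).
  apply: lerD; first exact: le_trans h1 h4.
  apply: le_trans (ler_normD _ _) _; apply: lerD; last exact: le_trans h3 (ltW xz').
  by rewrite normrM; apply: ler_wpM2l => //; exact: le_trans h2 (ltW xz).
have -> : `|a| * d + d + (`|a| * d + d) = eps by rewrite /d; field; rewrite gt_eqF.
by [].
Qed.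

Lemma not_finite_dimT : ~ finite_dim [set: X].
Proof.
apply: (free_not_finite_dim (v := fun p => iota (unitv R p.+1))) => // n c E p.
pose w : nat -> R := fun q => \sum_(p < n) c p * unitv R p.+1 q.
have cw : c00 w by apply: c00_sum => i _; exact: c00_unitv.
have iw : iota w = 0.
  rewrite -E /w; elim: (index_enum _) => [|i r IH].
    rewrite big_nil -[RHS]iota0; congr iota; apply/funext => q; by rewrite big_nil.
  rewrite big_cons -IH -iota_lin; last 2 first.
  - exact: c00_unitv.
  - by apply: c00_sum => j _; exact: c00_unitv.
  by congr iota; apply/funext => q; rewrite big_cons.
have Nw : N w = 0 by rewrite -iota_norm// iw normr0.
have wp : w p.+1 = c p.
  rewrite /w (bigD1 p)//= {1}/unitv eqxx mulr1 big1 ?addr0// => q qp.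
  by rewrite /unitv eqSS eq_sym (inj_eq val_inj) (negbTE qp) mulr0.
by have := coord_le p.+1 cw; rewrite Nw normr_le0 wp => /eqP.
Qed.

(** The functionals of [L] act on [c00], so vectors of [Y] are replaced by approximations there. *)
Definition near_subspace (Y : set X) (d : R) (x : nat -> R) : Prop :=
  c00 x /\ exists2 y, Y y & `|iota x - y| <= d.

Section Near.
Variable Y : set X.
Hypothesis sY : subspace_of_X Y.

Lemma near_subspace_lin d d' a x y : near_subspace Y d x -> near_subspace Y d' y ->
  near_subspace Y (`|a| * d + d') (fun p => a * x p + y p).
Proof.
move=> [cx [z Yz xz]] [cy [z' Yz' yz]]; split; first exact: c00_lin.
exists (a *: z + z'); first by case: sY => _; apply.
rewrite iota_lin//.
have -> : a *: iota x + iota y - (a *: z + z') = a *: (iota x - z) + (iota y - z').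
  by rewrite scalerBr opprD addrACA.
apply: le_trans (ler_normD _ _) _; apply: lerD => //.
by rewrite normrZ; apply: ler_wpM2l.
Qed.

Lemma near_subspace_zero : near_subspace Y 0 z0.
Proof.
split; first exact: c00_zero.
by exists 0; [case: sY|rewrite iota0 subrr normr0].
Qed.

Lemma near_subspace_le d d' x : d <= d' -> near_subspace Y d x -> near_subspace Y d' x.
Proof. by move=> dd [cx [y Yy h]]; split=> //; exists y => //; exact: le_trans h dd. Qed.

Hypothesis nY : ~ finite_dim Y.

(** A vector of [Y] of norm 3/4 whose first [p] coordinates vanish is approximated in [c00] within
    [t]. Deleting the first [p] coordinates of the approximation costs at most [t * p], so the total
    error is [d1 <= 1/8] and the norm stays between 1/2 and 1. *)
Lemma near_subspace_rich p d : 0 < d -> exists u, [/\ near_subspace Y d u,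
  forall q, (q < p)%N -> u q = 0, N u <= 1 &
  exists i f, Li i f /\ 2^-1 <= pairing f u].
Proof.
move=> d0; have [z1 [Yz1 z10 Ez1]] := kernels_nonzero p sY nY coord_lin.
pose z := (3 / 4 / `|z1|) *: z1.
have nz1 : 0 < `|z1| by rewrite normr_gt0.
have Yz : Y z by exact: subspaceZ.
have nz : `|z| = 3 / 4 by rewrite /z normrZ ger0_norm ?divr_ge0// divfK// gt_eqF.
have Ez q : (q < p)%N -> coord q z = 0.
  move=> qp; have := coord_lin q (3 / 4 / `|z1|) z1 0; rewrite addr0 -/z => ->.
  rewrite Ez1// mulr0 add0r.
  have := coord_lin q (-1) 0 0; rewrite scaler0 add0r mulN1r addNr//.
pose d1 := Num.min d 8^-1.
have d10 : 0 < d1 by rewrite lt_min d0 invr_gt0 ltr0n.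
pose t := d1 / p.+1%:R.
have t0 : 0 < t by rewrite divr_gt0// ltr0n.
have [x [cx xz]] := iota_dense z t0.
have ci : c00 (init p x) by exact: c00_restr.
have ct : c00 (tail p x) by exact: c00_restr.
have tE : tail p x = (fun q => x q - init p x q).
  by apply/funext => q; rewrite tailE initE; case: leqP => _; rewrite ?subr0 ?subrr.
have Ni : N (init p x) <= t * p%:R.
  apply: (normL_le mgt1 ci) => i f Hf; apply: le_trans (ler_norm _) _.
  have hi q : (p <= q)%N -> init p x q = 0 by rewrite initE ltnNge => ->.
  apply: le_trans (pairing_l1 (c := 1) hi (fun q => Li_le1 mgt1 q Hf)) _.
  rewrite mul1r; apply: (@le_trans _ _ (\sum_(q < p) t)).
    apply: ler_sum => q _; rewrite initE ltn_ord.
    have := coordP q z cx; rewrite Ez// sub0r normrN => /le_trans; apply; exact: ltW.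
  by rewrite sumr_const card_ord mulr_natr.
have uz : `|iota (tail p x) - z| <= d1.
  rewrite tE iota_sub// addrAC; apply: le_trans (ler_normB _ _) _.
  apply: (@le_trans _ _ (t + t * p%:R)).
    by apply: lerD; [exact: ltW|rewrite iota_norm].
  by rewrite -[X in X + _]mulr1 -mulrDr addrC natr1 /t divfK// pnatr_eq0.
have d18 : d1 <= 8^-1 by rewrite ge_min lexx orbT.
have Nu : `|N (tail p x) - 3 / 4| <= 8^-1.
  rewrite -iota_norm// -nz; apply: le_trans (ler_dist_dist _ _) _.
  exact: le_trans uz d18.
move: Nu; rewrite ler_norml => /andP[Nu1 Nu2].
exists (tail p x); split.
- split=> //; exists z => //; apply: le_trans uz _; rewrite ge_min lexx//.
- by move=> q qp; rewrite tailE leqNgt qp.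
- lra.
- have h2 : 2^-1 < N (tail p x) by lra.
  have [i [f [Hf fu]]] := normL_approx mgt1 ct h2.
  by exists i, f; split=> //; exact: ltW.
Qed.

End Near.

Lemma subspaces_close (Y W : set X) (eps : R) : subspace_of_X Y -> ~ finite_dim Y ->
  subspace_of_X W -> ~ finite_dim W -> 0 < eps ->
  exists y w, [/\ Y y, W w & `|y - w| < eps * `|y + w|].
Proof.
have B_le q : (q <= 4 * (2 * q.+1).+2)%N by clear; lia.
move=> sY nY sW nW e0.
pose B := Num.bound (1028 / eps).
pose n := (2 * B.+1)%N.
set a : R := (m n.+1)%:R; set b : R := (m n.+2)%:R.
have ap : 0 < a by exact: mR_gt0.
have bp : 0 < b by exact: mR_gt0.
have a5 : 5 <= a by rewrite (ler_nat _ 5) (m_ge5 choiceP).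
have aB : 1028 / eps < a.
  have q0 : 0 <= 1028 / eps by apply: divr_ge0; [exact: ler0n|exact: ltW].
  apply: lt_le_trans (archi_boundP q0) _; rewrite ler_nat -/B.
  apply: leq_trans (m_linear choiceP (isT : (1 < n.+1)%N)).
  exact: B_le.
have ab : a ^+ 3 <= b by rewrite -natrX ler_nat (m_cube choiceP).
pose near (c : bool) := near_subspace (if c then W else Y).
have sub c : subspace_of_X (if c then W else Y) by case: c.
have nf c : ~ finite_dim (if c then W else Y) by case: c.
have near_exact c n' p d : odd n' -> 0 < d ->
    exists y ystar hi, near c d y /\ exact m s l Phi n' p y ystar hi.
  move=> on d0; apply: (exact_pair tnormP choiceP _ _ _ _ _ p on d0).
  - by move=> d1 x [].
  - by move=> d1 d1' a1 x y; exact: near_subspace_lin.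
  - exact: near_subspace_zero.
  - by move=> d1 d1' x; exact: near_subspace_le.
  - by move=> p1 d1; exact: near_subspace_rich.
have ib0 : 0 < b^-1 by rewrite invr_gt0.
have en : ~~ odd n by rewrite /n oddM.
have n0 : (0 < n)%N by [].
(* With precision 1/b, the passage to [Y] and [W] adds 2/b to the 512/b of the difference, and takes
   2/b from the 1/a of the sum. *)
have [v [v' [[cv [y Yy vy]] [cv' [w Ww vw]] h1 h2]]] :=
  @dependent_pair R tnorm m k s l Phi tnormP choiceP codingP near
    (fun c d x h => h.1)
    (fun c d d' a x y => @near_subspace_lin _ (sub c) d d' a x y)
    (fun c => near_subspace_zero (sub c))
    (fun c d d' x => @near_subspace_le (if c then W else Y) d d' x)
    near_exact n b^-1 en n0 ib0.
rewrite -iota_norm ?iota_add// in h1; last exact: c00_add.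
rewrite -iota_norm ?iota_sub// in h2; last by apply: c00_add => //; exact: c00_opp.
exists y, w; split=> //.
have g1 : `|y - w| <= 514 * b^-1.
  have -> : y - w = (iota v - iota v') - ((iota v - y) - (iota v' - w)).
    have -> (p1 p2 p3 p4 : X) : (p1 - p2) - (p3 - p4) = (p1 - p3) - (p2 - p4).
      by rewrite !opprD !opprK addrACA.
    by rewrite !subKr.
  apply: le_trans (ler_normB _ _) _.
  have -> : 514 * b^-1 = 512 / b + (b^-1 + b^-1) by ring.
  by apply: lerD => //; apply: le_trans (ler_normB _ _) _; apply: lerD.
have g2 : a^-1 - 2 * b^-1 <= `|y + w|.
  have E : iota v + iota v' = (y + w) + ((iota v - y) + (iota v' - w)).
    by rewrite [RHS]addrACA [y + _]addrC [w + _]addrC !subrK.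
  rewrite E in h1.
  have h3 := ler_normD (y + w) ((iota v - y) + (iota v' - w)).
  have h4 := ler_normD (iota v - y) (iota v' - w).
  by move: (le_trans h1 h3) h4 vy vw; clear; lra.
apply: le_lt_trans g1 _; apply: lt_le_trans (ler_wpM2l (ltW e0) g2).
exact: close_arith.
Qed.

End Completion.

(** * Sequences and series in Banach spaces *)

Section Limits.
Variables (R : realType) (X : completeNormedModType R).
Implicit Types (f g : nat -> X) (x y z : X) (e r : R).

Definition tends f x : Prop := forall e, 0 < e ->
  exists N, forall n, (N <= n)%N -> `|x - f n| < e.

Lemma tendsP f x : f @ \oo --> x <-> tends f x.
Proof.
split=> [/cvgrPdist_lt H e /H[N _ HN]|H]; first by exists N => n; exact: HN.
by apply/cvgrPdist_lt => e /H[N HN]; exists N.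
Qed.

Lemma tends_dist_le f x y r N : tends f x ->
  (forall n, (N <= n)%N -> `|f n - y| <= r) -> `|x - y| <= r.
Proof.
move=> fx H; apply/ler_addgt0Pl => e /fx[N' HN'].
have h1 := HN' _ (leq_maxr N N'); have h2 := H _ (leq_maxl N N').
apply: le_trans (ler_distD (f (maxn N N')) _ _) _.
by apply: lerD => //; exact: ltW.
Qed.

Lemma tends_lin a f g x y : tends f x -> tends g y ->
  tends (fun n => a *: f n + g n) (a *: x + y).
Proof.
move=> fx gy e e0; have a1 : 0 < `|a| + 1 by rewrite ltr_wpDl.
pose d := e / (`|a| + 1); have d0 : 0 < d by rewrite divr_gt0.
have [N HN] := fx _ d0; have [N' HN'] := gy _ d0.
exists (maxn N N') => n; rewrite geq_max => /andP[/HN h1 /HN' h2].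
have -> : a *: x + y - (a *: f n + g n) = a *: (x - f n) + (y - g n).
  by rewrite scalerBr opprD addrACA.
apply: le_lt_trans (ler_normD _ _) _; rewrite normrZ.
have -> : e = `|a| * d + d by rewrite /d; field; rewrite gt_eqF.
by apply: ler_ltD => //; apply: ler_wpM2l => //; exact: ltW.
Qed.

Lemma tends_bounded f x : tends f x -> exists B : nat, forall n, `|f n| <= B%:R.
Proof.
move=> /(_ 1 ltr01)[N HN].
have [B HB] : exists B : nat, forall n, (n < N)%N -> `|f n| <= B%:R.
  elim: {HN} N => [|N [B HB]]; first by exists 0%N.
  pose B' := Num.bound `|f N|; exists (maxn B B') => n.
  rewrite ltnS leq_eqVlt => /orP[/eqP ->|/HB h].
    by apply: le_trans (ltW (archi_boundP _)) _; rewrite ?ler_nat ?leq_maxr.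
  by apply: le_trans h _; rewrite ler_nat leq_maxl.
pose B' := Num.bound (`|x| + 1); exists (maxn B B') => n.
have [nN|Nn] := ltnP n N; first by apply: le_trans (HB _ nN) _; rewrite ler_nat leq_maxl.
apply: (@le_trans _ _ (`|x| + 1)); last first.
  by apply: le_trans (ltW (archi_boundP _)) _; rewrite ?addr_ge0// ler_nat leq_maxr.
have -> : f n = x - (x - f n) by rewrite subKr.
by apply: le_trans (ler_normB _ _) _; apply: lerD => //; apply: ltW; exact: HN.
Qed.

Lemma cauchy_tends f : (forall e, 0 < e -> exists N, forall n, (N <= n)%N -> `|f N - f n| < e) ->
  exists x, tends f x.
Proof.
move=> H; suff : cvgn f by move=> /tendsP ?; exists (limn f).
apply/cauchy_cvgP/cauchyP => e /H[N HN]; exists (f N), N => // n Nn.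
by rewrite -ball_normE /=; exact: HN.
Qed.

Lemma radius_limit f (rho : nat -> R) :
  (forall n n', (n <= n')%N -> `|f n' - f n| <= rho n) ->
  (forall e, 0 < e -> exists n, rho n < e) ->
  exists x, tends f x /\ forall n, `|x - f n| <= rho n.
Proof.
move=> H rho0; have [|x fx] := @cauchy_tends f.
  by move=> e /rho0[N HN]; exists N => n Nn; rewrite distrC; apply: le_lt_trans HN; exact: H.
exists x; split=> // n; apply: (tends_dist_le (N := n) fx) => n'; exact: H.
Qed.

Lemma telescope_dist_le f (rho : nat -> R) : (forall n, 0 <= rho n) ->
  (forall n, `|f n.+1 - f n| <= rho n - rho n.+1) ->
  forall n n', (n <= n')%N -> `|f n' - f n| <= rho n.
Proof.
move=> rho0 H n n' /subnK <-; apply: (@le_trans _ _ (rho n - rho (n' - n + n)%N)); last first.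
  by rewrite gerBl.
elim: (n' - n)%N => [|j IH]; first by rewrite !subrr normr0.
rewrite addSn; apply: le_trans (ler_distD (f (j + n)%N) _ _) _.
have -> : rho n - rho (j + n).+1 = (rho (j + n)%N - rho (j + n).+1) + (rho n - rho (j + n)%N).
  by ring.
exact: lerD.
Qed.

Lemma half_pow_lt (c e : R) : 0 < e -> exists n, c * 2^-1 ^+ n < e.
Proof.
move=> e0; have [c0|c0] := lerP c 0.
  by exists 0%N; rewrite expr0 mulr1; exact: le_lt_trans e0.
exists (Num.bound (c / e)); rewrite exprVn ltr_pdivrMr ?exprn_gt0// mulrC -ltr_pdivrMr//.
apply: lt_le_trans (archi_boundP _) _; first by rewrite divr_ge0// ltW.
by rewrite -natrX ler_nat ltnW// ltn_expl.
Qed.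

(* Baire's theorem for the complete space C: some A n is dense in a relative ball. *)
Lemma closed_cover (C : set X) (A : nat -> set X) : closed C -> C !=set0 ->
  (forall x, C x -> exists n, A n x) ->
  exists n x r, [/\ C x, 0 < r & forall y, C y -> `|y - x| < r -> forall e, 0 < e ->
    exists2 z, A n z & `|z - y| < e].
Proof.
move=> clC [x0 Cx0] cov; apply: contrapT => nH.
have step (q : nat * (X * R)) : exists q' : X * R, C q.2.1 -> 0 < q.2.2 ->
    [/\ C q'.1, 0 < q'.2, q'.2 <= q.2.2 / 2, `|q'.1 - q.2.1| <= q.2.2 - q'.2 &
      forall z, A q.1 z -> q'.2 < `|z - q'.1| ].
  case: q => n [x r] /=; have [Cx|nC] := pselect (C x); last by exists (x, r).
  have [r0|] := ltP 0 r; last by exists (x, r).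
  have r2 : 0 < r / 2 by rewrite divr_gt0.
  have [y [Cy yx [e e0 ye]]] : exists y, [/\ C y, `|y - x| < r / 2 &
      exists2 e, 0 < e & forall z, A n z -> e <= `|z - y|].
    apply: contrapT => H; apply: nH; exists n, x, (r / 2); split=> // y Cy yx e e0.
    apply: contrapT => H'; apply: H; exists y; split=> //; exists e => // z Az.
    by rewrite leNgt; apply/negP => ze; apply: H'; exists z.
  exists (y, Num.min (r / 2) (e / 2)) => _ _ /=; split=> //.
  - by rewrite lt_min r2 divr_gt0.
  - by rewrite ge_min lexx.
  - have : Num.min (r / 2) (e / 2) <= r / 2 by rewrite ge_min lexx.
    by move: yx; set t := Num.min _ _; set t' := `|_|; clear; lra.
  - move=> z /ye; apply: lt_le_trans; rewrite gt_min; apply/orP; right.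
    by rewrite ltr_pdivrMr// ltr_pMr// ltr1n.
have [g gP] := choice step.
pose F := fix F n : X * R := if n is n'.+1 then g (n', F n') else (x0, 1).
have FP n : C (F n).1 /\ 0 < (F n).2.
  by elim: n => //= n [h1 h2]; have [] := gP (n, F n) h1 h2.
have FS n : [/\ (F n.+1).2 <= (F n).2 / 2, `|(F n.+1).1 - (F n).1| <= (F n).2 - (F n.+1).2 &
    forall z, A n z -> (F n.+1).2 < `|z - (F n.+1).1| ].
  by have [] := gP (n, F n) (FP n).1 (FP n).2.
have rho0 n : 0 <= (F n).2 by apply: ltW; exact: (FP n).2.
have rho_half n : (F n).2 <= 1 * 2^-1 ^+ n.
  elim: n => [|n IH]; first by rewrite expr0 mulr1.
  have [h _ _] := FS n; apply: le_trans h _; rewrite exprSr mulrA.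
  by apply: ler_wpM2r.
have [||x [Fx xF]] := @radius_limit (fun n => (F n).1) (fun n => (F n).2).
- by apply: telescope_dist_le => // n; have [] := FS n.
- by move=> e /(half_pow_lt 1)[n nE]; exists n; exact: le_lt_trans nE.
have Cx : C x.
  rewrite ((closure_id C).1 clC) => B /nbhs_ballP[e /= e0 xB].
  have [N HN] := Fx _ e0; exists (F N).1; split; first exact: (FP N).1.
  by apply: xB; rewrite -ball_normE /=; exact: (HN N).
have [n Anx] := cov _ Cx; have [_ _ /(_ _ Anx)] := FS n.
by rewrite ltNge xF.
Qed.

End Limits.

(** * Closeness of subspaces against direct sums *)

Section Gap.
Variables (R : realType) (X : completeNormedModType R).
Implicit Types (Y W Z : set X) (x y z w : X).

Hypothesis close : forall Y W (eps : R), subspace_of_X Y -> ~ finite_dim Y ->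
  subspace_of_X W -> ~ finite_dim W -> 0 < eps ->
  exists y w, [/\ Y y, W w & `|y - w| < eps * `|y + w|].

(** As y + w = 2y - (y - w), a bound D for the projection would give
    [|y + w| <= (2 D + 1) |y - w|]. *)
Lemma unbounded_projection Y W (C : R) : subspace_of_X Y -> ~ finite_dim Y ->
  subspace_of_X W -> ~ finite_dim W ->
  ~ (forall y w, Y y -> W w -> `|y| <= C * `|y - w|).
Proof.
move=> sY nY sW nW H; pose D := Num.max C 0; have D0 : 0 <= D by rewrite le_max lexx orbT.
have D1 : 0 < 2 * D + 1 by rewrite ltr_wpDl// mulr_ge0.
have i0 : 0 < (2 * D + 1)^-1 by rewrite invr_gt0.
have [y [w [Yy Ww]]] := close sY nY sW nW i0.
have h : `|y| <= D * `|y - w|.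
  by apply: le_trans (H _ _ Yy Ww) _; apply: ler_wpM2r => //; rewrite le_max lexx.
apply/negP; rewrite -leNgt mulrC ler_pdivrMr//.
have -> : y + w = 2 *: y - (y - w) by rewrite scaler_nat mulr2n opprB addrACA subrr addr0.
apply: le_trans (ler_normB _ _) _; rewrite normrZ ger0_norm//.
have -> : `|y - w| * (2 * D + 1) = 2 * (D * `|y - w|) + `|y - w| by ring.
by apply: lerD => //; apply: ler_wpM2l.
Qed.

(** Continuity at 0 with tolerance 1 provides a radius d, and by homogeneity the projection is
    bounded by 2/d. *)
Lemma not_topological_direct_sum Z Y W : subspace_of_X Y -> ~ finite_dim Y ->
  subspace_of_X W -> ~ finite_dim W -> ~ topological_direct_sum Z Y W.
Proof.
move=> sY nY sW nW [ZE YW [P [/subspace_continuousP Pc PE]]].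
have Z0 : Z 0 by rewrite ZE; exists 0; [case: sY|exists 0; [case: sW|rewrite addr0]].
have P0 : P 0 = 0 by have := PE 0 0 sY.1 sW.1; rewrite addr0.
have Pc0 : P x @[x --> within Z (nbhs (0 : X))] --> P 0 := Pc _ Z0.
have /cvgrPdist_lt/(_ 1 ltr01) := Pc0; rewrite P0.
move=> /nbhs_ballP[d /= d0 Hd].
apply: (@unbounded_projection Y W (2 / d) sY nY sW nW) => y w Yy Ww.
have [yw|yw] := eqVneq (y - w) 0.
  have : (Y `&` W) y by split=> //; move/eqP: yw; rewrite subr_eq0 => /eqP ->.
  by rewrite YW => ->; rewrite normr0 mulr_ge0// divr_ge0// ltW.
have nyw : 0 < `|y - w| by rewrite normr_gt0.
pose t := d / 2 / `|y - w|; have t0 : 0 < t by rewrite !divr_gt0.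
have Yt : Y (t *: y) by exact: subspaceZ.
have Wt : W (- (t *: w)) by apply: subspaceN => //; exact: subspaceZ.
have Zt : Z (t *: y - t *: w) by rewrite ZE; exists (t *: y) => //; exists (- (t *: w)).
have tn : `|t *: y - t *: w| < d.
  rewrite -scalerBr normrZ gtr0_norm// /t divfK ?gt_eqF//.
  by rewrite ltr_pdivrMr// ltr_pMr// ltr1n.
have h : t * `|y| < 1.
  have := Hd (t *: y - t *: w); rewrite PE// sub0r normrN normrZ gtr0_norm//; apply=> //.
  by rewrite -ball_normE /= sub0r normrN.
apply: ltW; rewrite /t in h.
have -> : `|y| = (d / 2 / `|y - w| * `|y|) * (2 / d * `|y - w|).
  by field; rewrite !gt_eqF.
by rewrite gtr_pMl// mulr_gt0// divr_gt0.
Qed.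

Lemma gap_hereditarily_indecomposable : ~ finite_dim [set: X] ->
  hereditarily_indecomposable X.
Proof.
move=> nT; split=> // -[Z [Y [W [_ [_ sY nY] [_ sW nW]]]]].
exact: not_topological_direct_sum.
Qed.

End Gap.

(** * Expansions, subseries and unconditional bases *)

Section PartialSums.
Variables (R : realType) (X : completeNormedModType R) (u : nat -> X).
Implicit Types (a b : nat -> R) (c : bool) (x y z : X).

Definition psum a n : X := \sum_(0 <= i < n) a i *: u i.

Definition expansion a x : Prop := tends (psum a) x.

(** [part true] keeps the coefficients of even rank and [part false] is the identity; one bound over
    [c] then covers the partial sums of an expansion and of its even half. *)
Definition part c a : nat -> R := fun i => if c && odd i then 0 else a i.

Lemma psum_lin t a b n : psum (fun i => t * a i + b i) n = t *: psum a n + psum b n.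
Proof.
rewrite /psum scaler_sumr -big_split /=; apply: eq_bigr => i _.
by rewrite scalerDl scalerA.
Qed.

Lemma part_lin c t a b : part c (fun i => t * a i + b i) = (fun i => t * part c a i + part c b i).
Proof. by apply/funext => i; rewrite /part; case: ifP => _ //; rewrite mulr0 addr0. Qed.

Lemma part_false a : part false a = a.
Proof. by apply/funext. Qed.

Lemma expansion_lin t a b x y : expansion a x -> expansion b y ->
  expansion (fun i => t * a i + b i) (t *: x + y).
Proof.
move=> ax byy; rewrite /expansion.
have -> : psum (fun i => t * a i + b i) = (fun n => t *: psum a n + psum b n).
  by apply/funext => n; exact: psum_lin.
exact: tends_lin.
Qed.

Lemma expansion_zero : expansion (fun=> 0) 0.
Proof.
move=> e e0; exists 0%N => n _; rewrite /psum big1 ?subrr ?normr0// => i _.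
by rewrite scale0r.
Qed.

Lemma expansion_unit q : expansion (fun i => (i == q)%:R) (u q).
Proof.
move=> e e0; exists q.+1 => n qn; rewrite /psum (bigD1_seq q)//=; last 2 first.
- by rewrite mem_index_iota.
- exact: iota_uniq.
rewrite eqxx scale1r big1 ?addr0 ?subrr ?normr0// => i /negbTE ->.
by rewrite scale0r.
Qed.

Lemma expansion_sum n (t : 'I_n -> R) (a : 'I_n -> nat -> R) (x : 'I_n -> X) :
  (forall p, expansion (a p) (x p)) ->
  expansion (fun i => \sum_(p < n) t p * a p i) (\sum_(p < n) t p *: x p).
Proof.
move=> H; elim: (index_enum _) => [|p r IH].
  rewrite big_nil (_ : (fun i => _) = fun=> 0); first exact: expansion_zero.
  by apply/funext => i; rewrite big_nil.
rewrite big_cons (_ : (fun i => _) = fun i => t p * a p i + \sum_(p <- r) t p * a p i).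
  exact: expansion_lin.
by apply/funext => i; rewrite big_cons.
Qed.

Lemma expansion_closed_span a x : expansion a x -> closed_span u x.
Proof.
move=> ax B /nbhs_ballP[e /= e0 xB]; have [N HN] := ax _ e0.
exists (psum a N); split; first by exists N, a; rewrite /psum big_mkord.
by apply: xB; rewrite -ball_normE /=; exact: HN.
Qed.

End PartialSums.

Section Subseries.
Variables (R : realType) (X : completeNormedModType R).

(* If the subseries is not Cauchy, cut the integers into blocks on which its sum stays
   away from 0, and enumerate in each block first the indices in Q: the rearranged series
   is not Cauchy either. *)
Lemma unconditional_subseries (f : nat -> X) (Q : pred nat) :
  (forall p, bijective p -> exists x, tends (fun n => \sum_(0 <= i < n) f (p i)) x) ->
  exists x, tends (fun n => \sum_(0 <= i < n | Q i) f i) x.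
Proof.
move=> unc; pose g n := \sum_(0 <= i < n | Q i) f i.
apply: contrapT => nx.
have [e e0 He] : exists2 e : R, 0 < e & forall N, exists n, (N <= n)%N /\ e <= `|g N - g n|.
  apply: contrapT => H; apply: nx; apply: cauchy_tends => e e0.
  apply: contrapT => H'; apply: H; exists e => // N.
  apply: contrapT => H''; apply: H'; exists N => n Nn.
  by rewrite ltNge; apply/negP => le_e; apply: H''; exists n.
have [h hP] := choice He.
have h_gt N : (N < h N)%N.
  have [Nh eh] := hP N; rewrite ltn_neqAle Nh andbT; apply/eqP => E.
  by move: eh; rewrite -E subrr normr0 leNgt e0.
pose P K := iter K h 0%N.
have P_ge K : (K <= P K)%N by elim: K => // K IH; exact: leq_ltn_trans IH (h_gt _).
pose ev K := [seq i <- index_iota (P K) (P K.+1) | Q i].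
pose od K := [seq i <- index_iota (P K) (P K.+1) | predC Q i].
pose LL := fix LL K := if K is K'.+1 then LL K' ++ (ev K' ++ od K') else [::].
have LL_perm K : perm_eq (LL K) (index_iota 0 (P K)).
  elim: K => //= K IH.
  have -> : index_iota 0 (P K.+1) = index_iota 0 (P K) ++ index_iota (P K) (P K.+1).
    by rewrite /index_iota !subn0 -iotaD subnKC// ltnW// h_gt.
  by apply: perm_cat => //; apply/permPl; exact: perm_filterC.
have LL_size K : size (LL K) = P K by rewrite (perm_size (LL_perm K)) size_iota subn0.
have LL_uniq K : uniq (LL K) by rewrite (perm_uniq (LL_perm K)) iota_uniq.
have LL_prefix K K' : (K <= K')%N -> exists r, LL K' = LL K ++ r.
  move=> /subnK <-; elim: (K' - K)%N => [|j [r E]]; first by exists [::]; rewrite cats0.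
  by rewrite addSn /= E -catA; eexists.
have LL_nth K K' n : (K <= K')%N -> (n < P K)%N -> nth 0%N (LL K') n = nth 0%N (LL K) n.
  by move=> /LL_prefix[r ->] nK; rewrite nth_cat LL_size nK.
(* [LL n.+1] has more than n entries, and all longer lists extend it. *)
pose p n := nth 0%N (LL n.+1) n.
have pE K n : (n < P K)%N -> p n = nth 0%N (LL K) n.
  move=> nK; have [Kn|nK'] := leqP K n.+1; first exact: LL_nth.
  by apply/esym/LL_nth; [exact: ltnW|exact: P_ge].
have p_inj : injective p.
  move=> n n' E; pose K := maxn n.+1 n'.+1.
  have nK : (n < P K)%N by apply: leq_trans (P_ge K); exact: leq_maxl.
  have nK' : (n' < P K)%N by apply: leq_trans (P_ge K); exact: leq_maxr.
  by apply/eqP; rewrite -(nth_uniq 0%N _ _ (LL_uniq K)) ?LL_size// -!pE// E.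
have p_surj i : exists n, p n = i.
  have iL : i \in LL i.+1.
    by rewrite (perm_mem (LL_perm _)) mem_index_iota/=; exact: P_ge.
  exists (index i (LL i.+1)); rewrite (pE i.+1) ?nth_index//.
  by rewrite -LL_size index_mem.
have [q pq] := choice p_surj.
have [|x px] := unc p; first by exists q => // n; apply: p_inj; rewrite pq.
have sumE K n : (n <= P K)%N ->
    \sum_(0 <= i < n) f (p i) = \sum_(i <- take n (LL K)) f i.
  move=> nK; rewrite -(big_map p xpredT f); congr bigop; apply: (@eq_from_nth _ 0%N).
    by rewrite size_map size_iota subn0 size_take_min LL_size; apply/esym/minn_idPl.
  move=> j; rewrite size_map size_iota subn0 => jn.
  rewrite (nth_map 0%N) ?size_iota ?subn0// nth_iota ?subn0// add0n nth_take//.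
  by apply: pE; exact: leq_trans jn nK.
have e2 : 0 < e / 2 by rewrite divr_gt0.
have [N HN] := px _ e2.
have [_] := hP (P N); apply/negP; rewrite -ltNge.
(* At this stage the rearranged series has added to a complete initial segment exactly the [Q]-terms
   of the next block, whose sum has norm at least [e]. *)
pose n := (P N + size (ev N))%N.
have nP : (n <= P N.+1)%N.
  rewrite -(LL_size N.+1) /= !size_cat LL_size /n leq_add2l leq_addr//.
have h1 := HN n (leq_trans (P_ge N) (leq_addr _ _)); have h2 := HN _ (P_ge N).
rewrite (sumE N.+1)// (_ : take n (LL N.+1) = LL N ++ ev N) in h1; last first.
  by rewrite /= catA take_size_cat// size_cat LL_size.
rewrite (sumE N)// take_oversize ?LL_size// in h2.
have -> : g (P N) - g (h (P N)) = (x - \sum_(i <- LL N ++ ev N) f i) - (x - \sum_(i <- LL N) f i).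
  have -> : g (h (P N)) = g (P N) + \sum_(i <- ev N) f i.
    rewrite /g (@big_cat_nat _ _ _ (P N))//=; last exact: ltnW (h_gt _).
    by rewrite big_filter.
  by rewrite big_cat /= [RHS]addrC opprB !opprD !addrA subrK !subrr.
apply: le_lt_trans (ler_normB _ _) _; rewrite [e]splitr; exact: ltrD.
Qed.

End Subseries.

Section UnconditionalBasis.
Variables (R : realType) (X : completeNormedModType R) (u : nat -> X).
Implicit Types (a b : nat -> R) (c : bool) (x y z w : X).
Local Notation psum := (@psum R X u).
Local Notation expansion := (@expansion R X u).
Local Notation CS := (closed_span u).

Lemma psumS a n : psum a n.+1 = psum a n + a n *: u n.
Proof. by rewrite /psum big_nat_recr. Qed.

Lemma tends_scale (f : nat -> R^o) (t : R^o) x : tends f t ->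
  tends (fun n => (f n : R) *: x) ((t : R) *: x).
Proof.
move=> ft e e0; have x1 : 0 < `|x| + 1 by rewrite ltr_wpDl.
have [N HN] := ft _ (divr_gt0 e0 x1); exists N => n /HN h.
rewrite -scalerBl normrZ; apply: (@le_lt_trans _ _ (`|t - f n| * (`|x| + 1))).
  by apply: ler_wpM2l => //; rewrite lerDl.
by rewrite -ltr_pdivlMr.
Qed.

Lemma psum_tends (bb : nat -> nat -> R) b c n :
  (forall i, tends (fun K => bb K i : R^o) (b i)) ->
  tends (fun K => psum (part c (bb K)) n) (psum (part c b) n).
Proof.
move=> H; elim: n => [|n IH].
  move=> e e0; exists 0%N => K _; by rewrite /psum !big_geq// subrr normr0.
rewrite psumS -[psum _ n]scale1r.
rewrite (_ : (fun K => _) = fun K => 1 *: psum (part c (bb K)) n + part c (bb K) n *: u n).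
  apply: tends_lin => //; apply: tends_scale; rewrite /part; case: (c && odd n) => //.
  by move=> e e0; exists 0%N => K _; rewrite subrr normr0.
by apply/funext => K; rewrite psumS scale1r.
Qed.

Hypothesis basis : basic_sequence u.

Lemma expansion_ex x : CS x -> exists a, expansion a x.
Proof. by move=> /basis[a [/tendsP ax _]]; exists a. Qed.

Lemma expansion_unique a b x : expansion a x -> expansion b x -> a = b.
Proof.
move=> ax bx; have [a0 [_ H]] := basis (expansion_closed_span ax).
by rewrite -(H a) ?(H b)//; apply/tendsP.
Qed.

Lemma closed_span_lin t x y : CS x -> CS y -> CS (t *: x + y).
Proof.
move=> /expansion_ex[a ax] /expansion_ex[b bby]; apply: expansion_closed_span.
exact: expansion_lin ax bby.
Qed.

Lemma closed_span0 : CS 0.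
Proof. exact: (expansion_closed_span (expansion_zero u)). Qed.

Lemma basic_neq0 i : u i != 0.
Proof.
apply/eqP => ui; have h := expansion_unit u i; rewrite ui in h.
have /(congr1 (fun f => f i)) := expansion_unique h (expansion_zero u).
by rewrite eqxx => /eqP; rewrite oner_eq0.
Qed.

Definition bounded_parts (B : R) a : Prop := forall c n, `|psum (part c a) n| <= B.

Section Approximation.
Variables (B r : R).
Hypotheses (B_ge0 : 0 <= B) (r_gt0 : 0 < r).
Hypothesis approx : forall z, CS z -> `|z| < r -> forall e, 0 < e ->
  exists a y, [/\ expansion a y, bounded_parts B a & `|z - y| < e].

(** As in the open mapping theorem: approximating within r/2 and doubling the remainder gives z as a
    sum of terms scaled by 2^-K, and the bounds [B] add up to [2 B]. *)
Lemma small_expansion z : CS z -> `|z| < r -> exists b, expansion b z /\ bounded_parts (2 * B) b.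
Proof.
move=> Cz zr.
have step (q : nat * ((nat -> R) * X)) : exists q' : (nat -> R) * X, CS q.2.2 -> `|q.2.2| < r ->
    [/\ CS q'.2, `|q'.2| < r & exists a, [/\ bounded_parts B a,
      q'.1 = (fun i => 2^-1 ^+ q.1 * a i + q.2.1 i) & expansion a (q.2.2 - 2^-1 *: q'.2)]].
  case: q => K [b w] /=; have [Cw|nC] := pselect (CS w); last by exists (b, w).
  have [wr|] := ltP `|w| r; last by exists (b, w).
  have r2 : 0 < r / 2 by rewrite divr_gt0.
  have [a [y [ay aB wy]]] := approx Cw wr r2.
  exists ((fun i => 2^-1 ^+ K * a i + b i), 2 *: (w - y)) => _ _ /=; split.
  - rewrite -[_ *: _]addr0; apply: closed_span_lin; last exact: closed_span0.
    by rewrite addrC -scaleN1r; apply: closed_span_lin => //; exact: expansion_closed_span ay.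
  - by rewrite normrZ ger0_norm// mulrC -ltr_pdivlMr.
  - by exists a; split=> //; rewrite scalerA mulVf ?pnatr_eq0// scale1r subKr.
have [g gP] := choice step.
pose F := fix F K : (nat -> R) * X := if K is K'.+1 then g (K', F K') else (fun=> 0, z).
have FP K : CS (F K).2 /\ `|(F K).2| < r.
  by elim: K => //= K [h1 h2]; have [] := gP (K, F K) h1 h2.
have FS K : exists a, [/\ bounded_parts B a,
      (F K.+1).1 = (fun i => 2^-1 ^+ K * a i + (F K).1 i) &
      expansion a ((F K).2 - 2^-1 *: (F K.+1).2)].
  by have [] := gP (K, F K) (FP K).1 (FP K).2.
have FE K : expansion (F K).1 (z - 2^-1 ^+ K *: (F K).2).
  elim: K => [|K IH]; first by rewrite expr0 scale1r subrr; exact: expansion_zero.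
  have [a [_ -> ay]] := FS K.
  have -> : z - 2^-1 ^+ K.+1 *: (F K.+1).2 =
    2^-1 ^+ K *: ((F K).2 - 2^-1 *: (F K.+1).2) + (z - 2^-1 ^+ K *: (F K).2).
    by rewrite scalerBr scalerA -exprSr [RHS]addrC addrA subrK.
  exact: expansion_lin.
pose rho K : R := 2 * B * 2^-1 ^+ K.
have rho0 K : 0 <= rho K by rewrite !mulr_ge0// exprn_ge0// invr_ge0.
have D c n K K' : (K <= K')%N ->
    `|psum (part c (F K').1) n - psum (part c (F K).1) n| <= rho K.
  apply: (telescope_dist_le (f := fun K => psum (part c (F K).1) n)) => // {}K.
  have [a [aB -> _]] := FS K; rewrite part_lin psum_lin addrK normrZ ger0_norm; last first.
    by rewrite exprn_ge0// invr_ge0.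
  have -> : rho K - rho K.+1 = 2^-1 ^+ K * B by rewrite /rho exprS; field.
  by apply: ler_wpM2l; [rewrite exprn_ge0// invr_ge0|exact: aB].
(* The i-th term is a difference of two partial sums and [u i] is nonzero, so the Cauchy estimates
   pass to the coefficients. *)
have coefs i : exists t : R, tends (fun K => (F K).1 i : R^o) t.
  have ui : 0 < `|u i| by rewrite normr_gt0 basic_neq0.
  have nZ (t : R^o) x : `|t| * `|x| = `|(t : R) *: x| by rewrite normrZ.
  have [||t [ft _]] := @radius_limit R R^o (fun K => (F K).1 i) (fun K => 2 * rho K / `|u i|).
  - move=> K K' KK'; rewrite ler_pdivlMr// nZ.
    have -> : ((F K').1 i - (F K).1 i) *: u i =
        (psum (part false (F K').1) i.+1 - psum (part false (F K).1) i.+1) -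
        (psum (part false (F K').1) i - psum (part false (F K).1) i).
      by rewrite !psumS !part_false scalerBl opprD addrACA [RHS]addrC addKr.
    apply: le_trans (ler_normB _ _) _; rewrite mulr_natl mulr2n.
    by apply: lerD; exact: D.
  - move=> e /(half_pow_lt (2 * (2 * B) / `|u i|))[K HK]; exists K.
    by apply: le_lt_trans HK; rewrite /rho le_eqVlt; apply/orP; left; apply/eqP; ring.
  by exists t.
have [b bP] := choice coefs.
have bF c n K : `|psum (part c b) n - psum (part c (F K).1) n| <= rho K.
  apply: (tends_dist_le (N := K) (psum_tends (bb := fun K => (F K).1) c n bP)) => K'.
  exact: D.
exists b; split; last first.
  move=> c n; have := bF c n 0%N; rewrite /rho expr0 mulr1 /= [X in _ - X]big1 ?subr0//.
  by move=> i _; rewrite /part; case: ifP; rewrite scale0r.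
move=> e e0; have e2 : 0 < e / 2 by rewrite divr_gt0.
have [K HK] := half_pow_lt (r + 2 * B) e2.
have [N HN] := FE K _ e2; exists N => n /HN h.
have h2 := bF false n K; rewrite !part_false distrC in h2.
have h3 : `|2^-1 ^+ K *: (F K).2| <= 2^-1 ^+ K * r.
  rewrite normrZ ger0_norm ?exprn_ge0 ?invr_ge0//.
  by apply: ler_wpM2l; [rewrite exprn_ge0// invr_ge0|exact: ltW (FP K).2].
have -> : z - psum b n = 2^-1 ^+ K *: (F K).2 +
    ((z - 2^-1 ^+ K *: (F K).2 - psum (F K).1 n) + (psum (F K).1 n - psum b n)).
  by rewrite [X in _ = _ + X]addrA subrK [RHS]addrC addrAC subrK.
apply: le_lt_trans (ler_normD _ _) _.
have h4 := ler_normD (z - 2^-1 ^+ K *: (F K).2 - psum (F K).1 n) (psum (F K).1 n - psum b n).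
rewrite /rho in h2; move: h h2 h3 h4 HK.
set t1 := `|_|; set t2 := `|_|; set t3 := `|_|; set t4 := `|_|; set q := _ ^+ K.
by clear; nra.
Qed.

End Approximation.

Hypothesis uncond : forall a : nat -> R, cvgn (series (fun n => a n *: u n)) ->
  forall p : nat -> nat, bijective p -> cvgn (series (fun n => a (p n) *: u (p n))).

Lemma expansion_part c a x : expansion a x -> exists y, expansion (part c a) y.
Proof.
move=> ax; case: c; last by exists x; rewrite part_false.
have [p bp|y ay] := @unconditional_subseries R X (fun i => a i *: u i) (fun i => ~~ odd i).
  have h : cvgn (series (fun n => a n *: u n)).
    by apply/cvg_ex; exists x; apply/tendsP.
  by have /cvg_ex[y /tendsP ay] := uncond h bp; exists y.
suff E : psum (part true a) = fun n => \sum_(0 <= i < n | ~~ odd i) a i *: u i.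
  by exists y; move: ay; rewrite -E.
apply/funext => n; rewrite [RHS]big_mkcond; apply: eq_bigr => i _.
by rewrite /part/=; case: (odd i); rewrite ?scale0r.
Qed.

Lemma bounded_parts_ex a x : expansion a x -> exists B : nat, bounded_parts B%:R a.
Proof.
move=> ax; have [x1 /tends_bounded[B1 H1]] := expansion_part true ax.
have [x2 /tends_bounded[B2 H2]] := expansion_part false ax.
exists (maxn B1 B2) => -[] n.
  by apply: le_trans (H1 n) _; rewrite ler_nat leq_maxl.
by apply: le_trans (H2 n) _; rewrite ler_nat leq_maxr.
Qed.

Lemma bounded_parts_lin t B B' a b : bounded_parts B a -> bounded_parts B' b ->
  bounded_parts (`|t| * B + B') (fun i => t * a i + b i).
Proof.
move=> aB bB c n; rewrite part_lin psum_lin; apply: le_trans (ler_normD _ _) _.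
by apply: lerD => //; rewrite normrZ; apply: ler_wpM2l.
Qed.

(** Pointwise each expansion has bounded parts; Baire's theorem makes the bound [N] uniform on a
    dense part of a ball around some [x0]. Halved differences of approximations to x0 + z and x0 - z
    recentre the ball at 0. Then [small_expansion] gives [2 N] for [|z| < r], and scaling by
    r/(2|z|) gives the constant 4N/r. *)
Lemma expansion_bound : exists C, forall a z, expansion a z -> bounded_parts (C * `|z|) a.
Proof.
have [|||N [x0 [r [Cx0 r0 H]]]] := @closed_cover R X CS
    (fun N => [set x | exists2 a, expansion a x & bounded_parts N%:R a]).
- exact: closed_closure.
- by exists 0; exact: closed_span0.
- move=> x /expansion_ex[a ax]; have [N aN] := bounded_parts_ex ax.
  by exists N, a.
have approx z : CS z -> `|z| < r -> forall e, 0 < e ->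
    exists a y, [/\ expansion a y, bounded_parts N%:R a & `|z - y| < e].
  move=> Cz zr e e0.
  have [||y1 [a1 ay1 aN1] d1] := H (z + x0) _ _ e e0.
  - by rewrite -[z]scale1r; exact: closed_span_lin.
  - by rewrite addrK.
  have [||y2 [a2 ay2 aN2] d2] := H (-1 *: z + x0) _ _ e e0.
  - exact: closed_span_lin.
  - by rewrite addrK scaleN1r normrN.
  have e2 := expansion_lin (- 2^-1) ay2 (expansion_zero u).
  have n2 : 0 <= 2^-1 :> R by rewrite invr_ge0.
  exists (fun i => 2^-1 * a1 i + (- 2^-1 * a2 i + 0)), (2^-1 *: y1 + (- 2^-1 *: y2 + 0)); split.
  - exact: expansion_lin.
  - have b0 : bounded_parts 0 (fun=> 0 : R).
      move=> c n; rewrite /psum big1 ?normr0// => i _.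
      by rewrite /part if_same scale0r.
    have -> : N%:R = `|2^-1| * N%:R + (`|- 2^-1| * N%:R + 0) :> R.
      by rewrite normrN ger0_norm//; field.
    by apply: bounded_parts_lin => //; exact: bounded_parts_lin.
  have -> : z - (2^-1 *: y1 + (- 2^-1 *: y2 + 0)) =
      2^-1 *: (y2 - (-1 *: z + x0)) - 2^-1 *: (y1 - (z + x0)).
    rewrite -scalerBr addr0 scaleNr -scalerBr.
    have {1}-> : z = 2^-1 *: (2 *: z) by rewrite scalerA mulVf ?scale1r.
    rewrite -scalerBr; congr (_ *: _); rewrite scaleN1r scaler_nat mulr2n.
    have -> : y2 - (- z + x0) = (z + y2) - x0 by rewrite opprD opprK addrA [y2 + z]addrC.
    have -> : y1 - (z + x0) = (y1 - z) - x0 by rewrite opprD addrA.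
    by rewrite (opprB _ x0) addrA subrK !opprB addrACA.
  apply: le_lt_trans (ler_normB _ _) _; rewrite !normrZ !ger0_norm//.
  move: d1 d2; set t1 := `|_|; set t2 := `|_|; clear; lra.
have N0 : 0 <= N%:R :> R by [].
exists (4 * N%:R / r) => a z az; have [z0|z0] := eqVneq z 0.
  have -> : a = fun=> 0 by apply: expansion_unique az _; rewrite z0; exact: expansion_zero.
  move=> c n; rewrite z0 normr0 mulr0 normr_le0 /psum big1// => i _.
  by rewrite /part if_same scale0r.
have nz : 0 < `|z| by rewrite normr_gt0.
pose t := r / 2 / `|z|; have t0 : 0 < t by rewrite !divr_gt0.
have tz := expansion_lin t az (expansion_zero u); rewrite addr0 in tz.
have [||b [bz bB]] := small_expansion N0 r0 approx (z := t *: z).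
- exact: expansion_closed_span tz.
- by rewrite normrZ gtr0_norm// /t divfK ?gt_eqF// ltr_pdivrMr// ltr_pMr// ltr1n.
move=> c n; have := bB c n; rewrite (expansion_unique bz tz) part_lin psum_lin.
rewrite [psum (part c (fun=> 0)) n]big1 ?addr0; last first.
  by move=> i _; rewrite /part if_same scale0r.
rewrite normrZ gtr0_norm// mulrC -ler_pdivlMr// => h; apply: le_trans h _.
by rewrite /t le_eqVlt; apply/orP; left; apply/eqP; field; rewrite !gt_eqF.
Qed.

(** Defined by expansions and not as a closed span, so that members come with their coefficients;
    the closeness estimate holds for arbitrary infinite-dimensional subspaces. *)
Definition parity_span c : set X :=
  [set x | exists2 a, expansion a x & forall i, odd i != c -> a i = 0].

Lemma parity_span_subspace c : subspace_of_X (parity_span c).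
Proof.
split=> [|t x y [a ax ac] [b bby bc]]; first by exists (fun=> 0) => //; exact: expansion_zero.
exists (fun i => t * a i + b i); first exact: expansion_lin.
by move=> i ic; rewrite ac// bc// mulr0 addr0.
Qed.

Lemma parity_span_not_finite_dim c : ~ finite_dim (parity_span c).
Proof.
apply: (free_not_finite_dim (v := fun p => u (c + p.*2)%N)) => [p|n t E p].
  exists (fun i => (i == (c + p.*2)%N)%:R); first exact: expansion_unit.
  move=> i ic; case: eqP => // ip; move: ic; rewrite ip oddD odd_double addbF.
  by rewrite oddb eqxx.
have h := expansion_sum t (fun p : 'I_n => expansion_unit u (c + p.*2)%N).
rewrite E in h.
have /(congr1 (fun f => f (c + p.*2)%N)) := expansion_unique h (expansion_zero u).
rewrite (bigD1 p)//= eqxx mulr1 big1 ?addr0// => q qp.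
rewrite eqn_add2l -!muln2 eqn_pmul2r// eq_sym (inj_eq val_inj) (negbTE qp).
by rewrite mulr0.
Qed.

(** The even part of the expansion of [y - w] is the expansion of [y]. *)
Lemma parity_span_bounded : exists C, forall y w, parity_span false y -> parity_span true w ->
  `|y| <= C * `|y - w|.
Proof.
have [C HC] := expansion_bound; exists C => y w [a ay aE] [b bw bE].
have := HC _ _ (expansion_lin (-1) bw ay); rewrite scaleN1r [- w + y]addrC => /(_ true).
rewrite (_ : part true _ = a) => [H|]; last first.
  apply/funext => i; rewrite /part /=; case: ifP => oi; first by rewrite aE// oi.
  by rewrite bE ?oi// mulr0 add0r.
rewrite -[y]subr0; apply: (tends_dist_le (N := 0%N) ay) => n _.
by rewrite !subr0.
Qed.

End UnconditionalBasis.

Theorem mainTheorem2 (R : realType)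
  (tnorm : nat -> (nat -> R) -> R)
  (m k s l : nat -> nat)
  (Phi : seq (nat -> R) -> nat)
  (X : completeNormedModType R) (iota : (nat -> R) -> X) :
  (forall n, is_implicit_norm n (tnorm n)) ->
  valid_choice tnorm m k s l ->
  is_coding m (Mfam s l) Phi ->
  is_completion (normL m (Mfam s l) Phi) iota ->
  hereditarily_indecomposable X /\
  ~ (exists u : nat -> X, unconditional_basic_sequence u).
Proof.
move=> tnormP choiceP codingP complP.
have close := subspaces_close tnormP choiceP codingP complP.
split.
  by apply: gap_hereditarily_indecomposable close _; exact: not_finite_dimT choiceP complP.
move=> [u [basis uncond]]; have [C HC] := parity_span_bounded basis uncond.
apply: (unbounded_projection close (Y := parity_span u false) (W := parity_span u true) _ _ _ _ HC).
- exact: parity_span_subspace.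
- exact: parity_span_not_finite_dim.
- exact: parity_span_subspace.
- exact: parity_span_not_finite_dim.
Qed.
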